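(* Let $p\ge1$ and $k\ge0$ be integers (of either parity). The monomials $\alpha^a\beta^b$ with integers $a,b\ge0$, $a+b=k$ and $a-b\equiv0\pmod p$, together with all their siblings (restricted to $S^3$), form a basis of the space of modes of wavenumber $k$ of the lens space $L(p,1)=S^3/Z_p$. This space has dimension $(2\lfloor k/p\rfloor+1)(k+1)$ if $p$ and $k$ are even; $0$ if $p$ is even and $k$ is odd; $(2\lfloor k/(2p)\rfloor+1)(k+1)$ if $p$ is odd and $k$ is even; $2(\lfloor (k-p)/(2p)\rfloor+1)(k+1)$ if $p$ and $k$ are odd. In particular for $p=2n$ the dimension is $(2\lfloor\frac{k/2}{n}\rfloor+1)(k+1)$ for even $k$ and $0$ for odd $k$.
   Context: Identify $\mathbb R^4$ with $\mathbb C^2$ via $\alpha=x+iy$, $\beta=z+iw$, $S^3=\{|\alpha|^2+|\beta|^2=1\}$. Wirtinger derivatives $\frac{\partial}{\partial\alpha}=\frac12(\partial_x-i\partial_y)$, similarly for $\beta$ with $(z,w)$. $\mathrm{twist}_-=-\bar\beta\frac{\partial}{\partial\alpha}+\bar\alpha\frac{\partial}{\partial\beta}$. For a polynomial $f$ in $\alpha,\beta$ only, homogeneous of degree $k$, its siblings are $\mathrm{twist}_-^j f$, $j=0,\dots,k$. $\gamma\in SU(2)$ acts on $\mathbb C^2$ by $(\alpha,\beta)^T\mapsto\gamma(\alpha,\beta)^T$ and on functions by $(R_\gamma F)(x)=F(\gamma^{-1}x)$. For a finite subgroup $\Gamma\subset SU(2)$, the space of modes of wavenumber $k$ of $S^3/\Gamma$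 is the complex vector space of $\Gamma$-invariant $F:S^3\to\mathbb C$ with $\Delta_{S^3}F=-k(k+2)F$. $Z_p\subset SU(2)$ is the cyclic group generated by $\mathrm{diag}(e^{2\pi i/p},e^{-2\pi i/p})$, and $L(p,1)=S^3/Z_p$. *)

(* Defs.v *)
From Stdlib Require Import Reals ZArith List.
From Coquelicot Require Import Coquelicot.
Open Scope R_scope.

(* Functions on R^4 = C^2, written in real coordinates (x,y,z,w),
   alpha = x + i y, beta = z + i w. *)
Definition fn4R := R -> R -> R -> R -> R.
Definition fn4C := R -> R -> R -> R -> C.

Definition onS3 (x y z w : R) : Prop := x*x + y*y + z*z + w*w = 1.
Definition nonzero4 (x y z w : R) : Prop := ~ (x = 0 /\ y = 0 /\ z = 0 /\ w = 0).

Definition pd (i : nat) (g : fn4R) : fn4R := fun x y z w =>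
  match i with
  | 0%nat => Derive (fun t => g t y z w) x
  | 1%nat => Derive (fun t => g x t z w) y
  | 2%nat => Derive (fun t => g x y t w) z
  | _ => Derive (fun t => g x y z t) w
  end.

Definition exd (i : nat) (g : fn4R) (x y z w : R) : Prop :=
  match i with
  | 0%nat => ex_derive (fun t => g t y z w) x
  | 1%nat => ex_derive (fun t => g x t z w) y
  | 2%nat => ex_derive (fun t => g x y t w) z
  | _ => ex_derive (fun t => g x y z t) w
  end.

Definition cont4 (g : fn4R) (x y z w : R) : Prop :=
  continuous (fun p : R * R * R * R => let '(a, b, c, d) := p in g a b c d)
             (x, y, z, w).

Definition C2_off0 (g : fn4R) : Prop :=
  forall x y z w, nonzero4 x y z w ->
    cont4 g x y z w /\
    (forall i, (i < 4)%nat -> exd i g x y z w /\ cont4 (pd i g) x y z w) /\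
    (forall i j, (i < 4)%nat -> (j < 4)%nat ->
        exd j (pd i g) x y z w /\ cont4 (pd j (pd i g)) x y z w).

Definition lap4 (g : fn4R) : fn4R := fun x y z w =>
  pd 0 (pd 0 g) x y z w + pd 1 (pd 1 g) x y z w
  + pd 2 (pd 2 g) x y z w + pd 3 (pd 3 g) x y z w.

Definition ReF (F : fn4C) : fn4R := fun x y z w => Re (F x y z w).
Definition ImF (F : fn4C) : fn4R := fun x y z w => Im (F x y z w).

Definition pdC (i : nat) (F : fn4C) : fn4C := fun x y z w =>
  (pd i (ReF F) x y z w, pd i (ImF F) x y z w).
Definition lap4C (F : fn4C) : fn4C := fun x y z w =>
  (lap4 (ReF F) x y z w, lap4 (ImF F) x y z w).

(* A function on S^3 is represented by any F : fn4C; only its values on S^3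
   matter. Its degree-0 homogeneous extension to R^4 \ {0}: *)
Definition ext0 (F : fn4C) : fn4C := fun x y z w =>
  let r := sqrt (x*x + y*y + z*z + w*w) in F (x / r) (y / r) (z / r) (w / r).

(* Laplace-Beltrami operator of S^3, evaluated at points of S^3:
   Delta_{S^3} F = (Delta_{R^4} ext0 F) restricted to S^3. *)
Definition lapS3 (F : fn4C) : fn4C := lap4C (ext0 F).

Definition C2_S3 (F : fn4C) : Prop :=
  C2_off0 (ReF (ext0 F)) /\ C2_off0 (ImF (ext0 F)).

Definition Ci : C := (0, 1).
Definition d_alpha (F : fn4C) : fn4C := fun x y z w =>
  Cmult (RtoC (1/2)) (Cminus (pdC 0 F x y z w) (Cmult Ci (pdC 1 F x y z w))).
Definition d_beta (F : fn4C) : fn4C := fun x y z w =>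
  Cmult (RtoC (1/2)) (Cminus (pdC 2 F x y z w) (Cmult Ci (pdC 3 F x y z w))).

Definition twist_minus (F : fn4C) : fn4C := fun x y z w =>
  Cplus (Cmult (Copp (Cconj (z, w))) (d_alpha F x y z w))
        (Cmult (Cconj (x, y)) (d_beta F x y z w)).

Fixpoint cpow (u : C) (n : nat) : C :=
  match n with 0%nat => RtoC 1 | S n => Cmult u (cpow u n) end.

Definition monomial (a b : nat) : fn4C := fun x y z w =>
  Cmult (cpow (x, y) a) (cpow (z, w) b).

Definition sibling (j : nat) (f : fn4C) : fn4C := Nat.iter j twist_minus f.

(* gamma_p m = diag(e^{2 pi i m/p}, e^{-2 pi i m/p}) = g^m for the generator
   g = diag(e^{2 pi i/p}, e^{-2 pi i/p}); Z_p = { gamma_p m | m : Z }. *)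
Definition zeta_pow (p : nat) (m : Z) : C :=
  (cos (2 * PI * IZR m / INR p), sin (2 * PI * IZR m / INR p)).

Definition diag_act (u v : C) (F : fn4C) : fn4C := fun x y z w =>
  let a := Cmult u (x, y) in let b := Cmult v (z, w) in
  F (fst a) (snd a) (fst b) (snd b).

(* (R_gamma F)(x) = F(gamma^{-1} x) with gamma = gamma_p m, so that
   gamma^{-1} = diag(e^{-2 pi i m/p}, e^{2 pi i m/p}) = gamma_p (-m). *)
Definition R_Zp (p : nat) (m : Z) (F : fn4C) : fn4C :=
  diag_act (zeta_pow p (- m)) (zeta_pow p m) F.

Definition Zp_invariant (p : nat) (F : fn4C) : Prop :=
  forall (m : Z) x y z w, onS3 x y z w -> R_Zp p m F x y z w = F x y z w.

Definition mode (p k : nat) (F : fn4C) : Prop :=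
  C2_S3 F /\ Zp_invariant p F /\
  forall x y z w, onS3 x y z w ->
    lapS3 F x y z w = Cmult (RtoC (- INR (k * (k + 2)))) (F x y z w).

Definition good_a (p k a : nat) : bool :=
  Z.eqb (Z.modulo (Z.of_nat a - Z.of_nat (k - a)) (Z.of_nat p)) 0.

(* index list of the basis: (a, j) stands for twist_-^j (alpha^a beta^(k-a)) *)
Definition basis_idx (p k : nat) : list (nat * nat) :=
  list_prod (filter (good_a p k) (seq 0 (S k))) (seq 0 (S k)).

Definition basis_fn (k : nat) (aj : nat * nat) : fn4C :=
  sibling (snd aj) (monomial (fst aj) (k - fst aj)).

Definition lincomb (k : nat) (L : list (nat * nat)) (c : nat * nat -> C) : fn4C :=
  fun x y z w =>
    fold_right Cplus (RtoC 0) (map (fun aj => Cmult (c aj) (basis_fn k aj x y z w)) L).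

Definition dim_formula (p k : nat) : Z :=
  let P := Z.of_nat p in let K := Z.of_nat k in
  if Nat.even p then
    (if Nat.even k then (2 * (K / P) + 1) * (K + 1) else 0)
  else
    (if Nat.even k then (2 * (K / (2 * P)) + 1) * (K + 1)
     else 2 * ((K - P) / (2 * P) + 1) * (K + 1)).

(* Main.v *)
Require Import Defs.
From Stdlib Require Import Reals ZArith List.
From Stdlib Require Import Lra Lia Psatz Classical ClassicalEpsilon FunctionalExtensionality.
From Coquelicot Require Import Coquelicot.

(** Let [u] be the degree-0 extension of the real or imaginary part of an eigenfunction. By
    Euler's relation [H = r^k u] is harmonic on R^4 minus the origin and homogeneous of degree
    [k]. The maximum principle, applied to the odd part of a harmonic function on a half cube
    with a quadratic barrier, shows that a difference along a coordinate axis gains one order of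
    decay at infinity. Hence every [(k+1)]-fold difference of [H] tends to 0 at infinity; it is
    harmonic off finitely many points near which it is bounded, so comparison with
    [eps / |v - q|^2] makes it vanish. By homogeneity [k! H(x)] is the [k]-fold difference of
    [H] at 0 in direction [x], and [k]-fold differences are now additive and continuous, hence
    linear, in each direction: [H] is a homogeneous polynomial.

    Write such a polynomial in the monomials alpha^A beta^B conj(alpha)^C conj(beta)^D.
    Harmonicity is a two-term recurrence along the lines [A + D = a], [C + D = j], so each line
    carries one free constant, and the [j]-th sibling of alpha^a beta^(k-a) is supported on
    exactly that line with nonzero entries there. Invariance under [Z_p] selects the lines with
    [a - (k - a)] divisible by [p]. *)

(** The only regularity given is C^2 away from the origin, through continuous partial derivatives,
    and nothing of higher order is known for [H]. Differences therefore take the place of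
    derivatives: translates of harmonic functions are harmonic, so differences can be iterated with
    no loss of regularity, and decay comes from the maximum principle without any integration. The
    price is that every difference adds a translated copy of the singular set, so that the origin
    grows into a finite list of points where only boundedness is known. The order [k+1] is forced:
    from O(|v|^k), [k] differences reach O(1) and one more reaches O(1/|v|). The comparison function
    1/|v|^2 is harmonic because the dimension is four. The degree [k = 0] is exceptional: [H] is
    then the extension itself, whose value at the origin is arbitrary, so continuity fails there and
    constancy is proved on the complement of the origin. Polynomials are kept as coefficient
    functions, so that derivatives, twists and rotations become identities between coefficients. *)

(** * Points of R^4, cubes and compactness *)

Definition pt := (R * R * R * R)%type.

Definition crd (i : nat) (v : pt) : R :=
  let '(x, y, z, w) := v in
  match i with 0%nat => x | 1%nat => y | 2%nat => z | _ => w end.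

Definition padd (v w : pt) : pt :=
  let '(x, y, z, t) := v in let '(x', y', z', t') := w in
  (x + x', y + y', z + z', t + t').

Definition pscal (s : R) (v : pt) : pt :=
  let '(x, y, z, w) := v in (s * x, s * y, s * z, s * w).

Definition axis (i : nat) (t : R) : pt :=
  match i with
  | 0%nat => (t, 0, 0, 0) | 1%nat => (0, t, 0, 0)
  | 2%nat => (0, 0, t, 0) | _ => (0, 0, 0, t)
  end.

Definition p0 : pt := (0, 0, 0, 0).

Definition nrm2 (v : pt) : R :=
  let '(x, y, z, w) := v in x * x + y * y + z * z + w * w.

Definition inbox (r : R) (v : pt) : Prop := forall i, Rabs (crd i v) <= r.

Definition near_by (d : R) (v w : pt) : Prop := forall i, Rabs (crd i w - crd i v) < d.

Ltac dpt v := destruct v as [[[? ?] ?] ?].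
Ltac dix i := destruct i as [|[|[|i]]].

Lemma near_by_ball (d : R) (v w : pt) : near_by d v w <-> ball v d w.
Proof.
  dpt v; dpt w; split.
  - intro H.
    pose proof (H 0%nat); pose proof (H 1%nat); pose proof (H 2%nat); pose proof (H 3%nat).
    simpl in *. repeat split; assumption.
  - intros [[[H0 H1] H2] H3]. intro ix; dix ix; [exact H0|exact H1|exact H2|exact H3].
Qed.

Lemma locally_near_by (v : pt) (P : pt -> Prop) :
  locally v P <-> exists d, 0 < d /\ forall w, near_by d v w -> P w.
Proof.
  split.
  - intros [d Hd]. exists d; split; [apply cond_pos|]. intros w Hw. apply Hd. apply near_by_ball, Hw.
  - intros [d [Hd H]]. exists (mkposreal d Hd). intros w Hw. apply H. apply near_by_ball, Hw.
Qed.

Lemma crd_padd (i : nat) (v w : pt) : crd i (padd v w) = crd i v + crd i w.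
Proof. dpt v; dpt w; dix i; reflexivity. Qed.

Lemma crd_pscal (i : nat) (s : R) (v : pt) : crd i (pscal s v) = s * crd i v.
Proof. dpt v; dix i; reflexivity. Qed.

Lemma pt_eq (v w : pt) : (forall i, crd i v = crd i w) -> v = w.
Proof.
  dpt v; dpt w; intro H.
  pose proof (H 0%nat); pose proof (H 1%nat); pose proof (H 2%nat); pose proof (H 3%nat).
  simpl in *; subst; reflexivity.
Qed.

Lemma crd_axis_le (i j : nat) (t : R) : Rabs (crd i (axis j t)) <= Rabs t.
Proof.
  dix j; dix i; simpl; rewrite ?Rabs_R0; auto using Rabs_pos, Rle_refl.
Qed.

Lemma padd_0_r (v : pt) : padd v p0 = v.
Proof. apply pt_eq; intro i; rewrite crd_padd; dix i; simpl; ring. Qed.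

Lemma padd_0_l (v : pt) : padd p0 v = v.
Proof. apply pt_eq; intro i; rewrite crd_padd; dix i; simpl; ring. Qed.

Lemma axis_0 (i : nat) : axis i 0 = p0.
Proof. dix i; reflexivity. Qed.

Lemma padd_comm (v w : pt) : padd v w = padd w v.
Proof. apply pt_eq; intro; rewrite !crd_padd; ring. Qed.

Lemma padd_assoc (u v w : pt) : padd u (padd v w) = padd (padd u v) w.
Proof. apply pt_eq; intro; rewrite !crd_padd; ring. Qed.

Lemma near_by_padd (d : R) (v w u : pt) : near_by d v w -> near_by d (padd v u) (padd w u).
Proof.
  intros H i. rewrite !crd_padd.
  replace (crd i w + crd i u - (crd i v + crd i u)) with (crd i w - crd i v) by ring. apply H.
Qed.

Lemma locally_padd (v u : pt) (P : pt -> Prop) :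
  locally (padd v u) P -> locally v (fun w => P (padd w u)).
Proof.
  rewrite !locally_near_by. intros [d [Hd H]]. exists d; split; auto.
  intros w Hw. apply H, near_by_padd, Hw.
Qed.

Lemma locally_R (a : R) (P : R -> Prop) :
  locally a P <-> exists d, 0 < d /\ forall t : R, Rabs (t - a) < d -> P t.
Proof.
  split.
  - intros [d Hd]. exists d. split; [apply cond_pos|exact Hd].
  - intros [d [Hd H]]. exists (mkposreal d Hd). exact H.
Qed.

Lemma locally_line (v : pt) (i : nat) (P : pt -> Prop) :
  locally v P -> locally 0 (fun t => P (padd v (axis i t))).
Proof.
  rewrite locally_near_by. intros [d [Hd H]]. apply locally_R. exists d. split; auto.
  intros t Ht. apply H. intro j. rewrite crd_padd.
  replace (crd j v + crd j (axis i t) - crd j v) with (crd j (axis i t)) by ring.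
  eapply Rle_lt_trans; [apply crd_axis_le|].
  replace t with (t - 0) by ring. exact Ht.
Qed.

Lemma continuous_near_by (f : pt -> R) (v : pt) :
  continuous f v <->
  forall e, 0 < e -> exists d, 0 < d /\ forall w, near_by d v w -> Rabs (f w - f v) < e.
Proof.
  split.
  - intros H e He. apply locally_near_by.
    apply (H (fun y => Rabs (y - f v) < e)). exists (mkposreal e He). intros y Hy. exact Hy.
  - intros H P [e He]. apply locally_near_by. destruct (H e (cond_pos e)) as [d [Hd H']].
    exists d; split; auto. intros w Hw. apply He. apply H', Hw.
Qed.

Lemma continuous_padd (f : pt -> R) (v u : pt) :
  continuous f (padd v u) -> continuous (fun w => f (padd w u)) v.
Proof.
  rewrite !continuous_near_by. intros H e He. destruct (H e He) as [d [Hd H']].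
  exists d; split; auto. intros w Hw. apply H', near_by_padd, Hw.
Qed.

Lemma continuous_crd (i : nat) (v : pt) : continuous (crd i) v.
Proof. apply continuous_near_by. intros e He. exists e; split; auto. Qed.

Lemma nrm2_crd (v : pt) :
  nrm2 v = crd 0 v * crd 0 v + crd 1 v * crd 1 v + crd 2 v * crd 2 v + crd 3 v * crd 3 v.
Proof. dpt v; reflexivity. Qed.

Lemma continuous_ext_fun {U V : UniformSpace} (f g : U -> V) (x : U) :
  (forall y, f y = g y) -> continuous f x -> continuous g x.
Proof. intros H. replace g with f; auto. apply functional_extensionality, H. Qed.

Lemma continuous_Rplus {U : UniformSpace} (f g : U -> R) (x : U) :
  continuous f x -> continuous g x -> continuous (fun y => f y + g y) x.
Proof. apply (@continuous_plus U R_AbsRing R_NormedModule). Qed.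

Lemma continuous_Rmult {U : UniformSpace} (f g : U -> R) (x : U) :
  continuous f x -> continuous g x -> continuous (fun y => f y * g y) x.
Proof. apply (@continuous_mult U R_AbsRing). Qed.

Lemma continuous_Rminus {U : UniformSpace} (f g : U -> R) (x : U) :
  continuous f x -> continuous g x -> continuous (fun y => f y - g y) x.
Proof. apply (@continuous_minus U R_AbsRing R_NormedModule). Qed.

Lemma continuous_nrm2 (v : pt) : continuous nrm2 v.
Proof.
  apply (continuous_ext_fun (fun v => crd 0 v * crd 0 v + crd 1 v * crd 1 v
    + crd 2 v * crd 2 v + crd 3 v * crd 3 v)).
  - intro; symmetry; apply nrm2_crd.
  - apply continuous_Rplus; [apply continuous_Rplus; [apply continuous_Rplus|]|];
      apply continuous_Rmult; apply continuous_crd.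
Qed.

Definition tn (v : pt) : Compactness.Tn 4 R :=
  let '(x, y, z, w) := v in (x, (y, (z, (w, tt)))).
Definition nt (t : Compactness.Tn 4 R) : pt :=
  let '(x, (y, (z, (w, _)))) := t in (x, y, z, w).

Lemma box_compact (r : R) (delta : pt -> posreal) :
  exists l : list pt, forall v, inbox r v ->
    exists u, In u l /\ inbox r u /\ near_by (delta u) u v.
Proof.
  set (a := tn (-r, -r, -r, -r)). set (b := tn (r, r, r, r)).
  (* The finite subcover is only asserted under a double negation, removed here classically. *)
  destruct (NNPP _ (compactness_list 4 a b (fun t => delta (nt t)))) as [l Hl].
  exists (map nt l). intros v Hv. destruct (Hl (tn v)) as [t [H1 [H2 H3]]].
  - dpt v. pose proof (Hv 0%nat); pose proof (Hv 1%nat); pose proof (Hv 2%nat); pose proof (Hv 3%nat).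
    simpl in *. repeat match goal with H : Rabs _ <= _ |- _ => apply Rabs_le_between in H end. tauto.
  - exists (nt t). split; [apply in_map, H1|].
    destruct t as [x [y [z [w []]]]]. dpt v. simpl in *. split.
    + intro ix; dix ix; simpl; apply Rabs_le_between; tauto.
    + intro ix; dix ix; simpl; tauto.
Qed.

(** Finitely many local bounds cover the cube, and their maximum still satisfies [Q]. With [Q]
    trivial this gives boundedness; with [Q m] meaning [m < M] it replaces the attainment of a
    supremum, since a strict local bound at every point becomes a strict global one. The bound
    concerns [g] on [dom] only, but every point of the closed cube must be handled, including
    boundary points of [dom]. *)
Lemma box_bound (g : pt -> R) (dom : pt -> Prop) (Q : R -> Prop) (r : R) :
  (exists m, Q m) -> (forall a b, Q a -> Q b -> Q (Rmax a b)) ->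
  (forall v, inbox r v -> exists m, Q m /\ locally v (fun w => dom w -> g w <= m)) ->
  exists m, Q m /\ forall v, inbox r v -> dom v -> g v <= m.
Proof.
  intros [m0 Hm0] HQ H.
  (* The gauge has to be a function on all of R^4; points outside the cube receive the dummy bound
     [m0] and radius 1. *)
  assert (H' : forall v, exists md : R * posreal, inbox r v ->
     Q (fst md) /\ forall w, near_by (snd md) v w -> dom w -> g w <= fst md).
  { intro v. destruct (classic (inbox r v)) as [Hv|Hv].
    - destruct (H v Hv) as [m [Hm Hl]]. apply locally_near_by in Hl. destruct Hl as [d [Hd Hl]].
      exists (m, mkposreal d Hd). intros _. split; auto.
    - exists (m0, mkposreal 1 Rlt_0_1). tauto. }
  set (md := fun v => proj1_sig (constructive_indefinite_description _ (H' v))).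
  assert (Hmd : forall v, inbox r v -> Q (fst (md v)) /\
     forall w, near_by (snd (md v)) v w -> dom w -> g w <= fst (md v)).
  { intro v. unfold md. destruct (constructive_indefinite_description _ (H' v)); auto. }
  destruct (box_compact r (fun v => snd (md v))) as [l Hl].
  assert (Hlist : forall l', exists m, Q m /\ forall u, In u l' -> inbox r u -> fst (md u) <= m).
  { induction l' as [|u l' [m [Hm IH]]].
    - exists m0. split; auto. intros u [].
    - destruct (classic (inbox r u)) as [Hu|Hu].
      + exists (Rmax (fst (md u)) m). split; [apply HQ; auto; apply Hmd, Hu|].
        intros u' [<-|Hin] Hb; [apply Rmax_l|].
        eapply Rle_trans; [apply IH; auto|apply Rmax_r].
      + exists m. split; auto. intros u' [<-|Hin] Hb; [tauto|auto]. }
  destruct (Hlist l) as [m [Hm Hml]]. exists m. split; auto.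
  intros v Hv Hd. destruct (Hl v Hv) as [u [Hu [Hbu Hc]]].
  eapply Rle_trans; [apply (Hmd u Hbu); auto|apply Hml; auto].
Qed.

(** * Second derivatives along coordinate lines *)

(** A second derivative at the single point 0, with a first derivative nearby and no continuity:
    enough for the second derivative test at a maximum, and stable under sums, products and
    reflections. *)
Definition has_d2 (g : R -> R) (d : R) : Prop :=
  locally 0 (fun t => ex_derive g t) /\ is_derive (Derive g) 0 d.

Definition line (f : pt -> R) (v : pt) (i : nat) : R -> R :=
  fun t => f (padd v (axis i t)).

(** A relation rather than an operator built on [Derive]: it carries differentiability along with
    the value, so the closure rules come without side conditions. *)
Definition has_lap (f : pt -> R) (v : pt) (L : R) : Prop :=
  exists d : nat -> R, (forall i, has_d2 (line f v i) (d i)) /\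
    L = d 0%nat + d 1%nat + d 2%nat + d 3%nat.

Lemma has_d2_ext (f g : R -> R) (d : R) :
  locally 0 (fun t => f t = g t) -> has_d2 f d -> has_d2 g d.
Proof.
  intros E [H1 H2]. apply locally_locally in E. split.
  - generalize (filter_and _ _ E H1). apply filter_imp. intros t [He Hx].
    eapply ex_derive_ext_loc; [apply He|apply Hx].
  - eapply is_derive_ext_loc; [|apply H2]. revert E. apply filter_imp.
    intros t He. apply Derive_ext_loc, He.
Qed.

Lemma has_d2_intro (f f1 : R -> R) (d : R) :
  locally 0 (fun t => is_derive f t (f1 t)) -> is_derive f1 0 d -> has_d2 f d.
Proof.
  intros H1 H2. split.
  - revert H1. apply filter_imp. intros t H. eexists; apply H.
  - eapply is_derive_ext_loc; [|apply H2]. revert H1. apply filter_imp.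
    intros t H. symmetry. apply is_derive_unique, H.
Qed.

Lemma has_d2_elim (f : R -> R) (d : R) :
  has_d2 f d -> locally 0 (fun t => is_derive f t (Derive f t)) /\ is_derive (Derive f) 0 d.
Proof.
  intros [H1 H2]. split; auto. revert H1. apply filter_imp. intros t H. apply Derive_correct, H.
Qed.

Lemma has_d2_plus (f g : R -> R) (a b : R) :
  has_d2 f a -> has_d2 g b -> has_d2 (fun t => f t + g t) (a + b).
Proof.
  intros Hf Hg. apply has_d2_elim in Hf, Hg. destruct Hf as [F1 F2], Hg as [G1 G2].
  apply has_d2_intro with (fun t => Derive f t + Derive g t).
  - generalize (filter_and _ _ F1 G1). apply filter_imp. intros t [? ?].
    apply (is_derive_plus f g); assumption.
  - apply (is_derive_plus (Derive f) (Derive g)); assumption.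
Qed.

Lemma is_derive_Rmult (f g : R -> R) (t a b : R) :
  is_derive f t a -> is_derive g t b ->
  is_derive (fun s => f s * g s) t (a * g t + f t * b).
Proof. intros Hf Hg. apply (is_derive_mult f g t a b Hf Hg). intros; apply Rmult_comm. Qed.

Lemma has_d2_mult (f g : R -> R) (a b : R) :
  has_d2 f a -> has_d2 g b ->
  has_d2 (fun t => f t * g t) (a * g 0 + 2 * (Derive f 0 * Derive g 0) + f 0 * b).
Proof.
  intros Hf Hg. apply has_d2_elim in Hf, Hg. destruct Hf as [F1 F2], Hg as [G1 G2].
  apply has_d2_intro with (fun t => Derive f t * g t + f t * Derive g t).
  - generalize (filter_and _ _ F1 G1). apply filter_imp. intros t [? ?].
    apply is_derive_Rmult; assumption.
  - replace (a * g 0 + 2 * (Derive f 0 * Derive g 0) + f 0 * b)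
      with ((a * g 0 + Derive f 0 * Derive g 0) + (Derive f 0 * Derive g 0 + f 0 * b)) by ring.
    apply (is_derive_plus (fun t => Derive f t * g t) (fun t => f t * Derive g t));
      apply is_derive_Rmult; auto.
    + apply (locally_singleton _ _ G1).
    + apply (locally_singleton _ _ F1).
Qed.

Lemma has_d2_const (c : R) : has_d2 (fun _ => c) 0.
Proof.
  apply has_d2_intro with (fun _ => 0).
  - apply filter_forall. intro t. apply (is_derive_const c).
  - apply (is_derive_const 0).
Qed.

Lemma has_d2_scal (c : R) (f : R -> R) (a : R) :
  has_d2 f a -> has_d2 (fun t => c * f t) (c * a).
Proof.
  intro Hf. pose proof (has_d2_mult _ _ _ _ (has_d2_const c) Hf) as H.
  rewrite Derive_const in H.
  replace (c * a) with (0 * f 0 + 2 * (0 * Derive f 0) + c * a) by ring. exact H.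
Qed.

Lemma locally_Ropp (P : R -> Prop) : locally 0 P -> locally 0 (fun t => P (- t)).
Proof.
  rewrite !locally_R. intros [d [Hd H]]. exists d. split; auto. intros t Ht. apply H.
  replace (- t - 0) with (- (t - 0)) by ring.
  rewrite Rabs_Ropp. exact Ht.
Qed.

Lemma is_derive_Ropp (t : R) : is_derive Ropp t (-1).
Proof. auto_derive; auto; ring. Qed.

Lemma has_d2_opp_arg (f : R -> R) (a : R) : has_d2 f a -> has_d2 (fun t => f (- t)) a.
Proof.
  intros Hf. apply has_d2_elim in Hf. destruct Hf as [F1 F2].
  apply has_d2_intro with (fun t => -1 * Derive f (- t)).
  - generalize (locally_Ropp _ F1). apply filter_imp. intros t Ht.
    apply (is_derive_comp f Ropp t); [exact Ht|apply is_derive_Ropp].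
  - replace a with (-1 * (-1 * a)) by ring.
    apply (is_derive_scal (fun t => Derive f (- t))).
    apply (is_derive_comp (Derive f) Ropp 0).
    + rewrite Ropp_0. exact F2.
    + apply is_derive_Ropp.
Qed.

Lemma is_derive_pos_right (g : R -> R) (a d : R) :
  is_derive g a d -> 0 < d -> locally a (fun t => a < t -> g a < g t).
Proof.
  intros H Hd. apply is_derive_Reals in H. destruct (H (d / 2)) as [e He]; [lra|].
  apply locally_R. exists e. split; [apply cond_pos|]. intros t Ht Hlt.
  specialize (He (t - a)). assert (t - a <> 0) by lra. specialize (He H0 Ht).
  replace (a + (t - a)) with t in He by ring.
  apply Rabs_lt_between in He. assert (0 < (g t - g a) / (t - a)) by lra.
  assert (0 < (g t - g a) / (t - a) * (t - a)) by (apply Rmult_lt_0_compat; lra).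
  replace ((g t - g a) / (t - a) * (t - a)) with (g t - g a) in H2 by (field; lra). lra.
Qed.

Lemma exists_right (P : R -> Prop) : locally 0 P -> exists t, 0 < t /\ forall s, Rabs s <= t -> P s.
Proof.
  rewrite locally_R. intros [e [He H]]. exists (e / 2). split; [lra|].
  intros s Hs. apply H.
  replace (s - 0) with s by ring. lra.
Qed.

Lemma max_derive_0 (g : R -> R) (d : R) :
  is_derive g 0 d -> locally 0 (fun t => g t <= g 0) -> d = 0.
Proof.
  assert (G : forall h e, is_derive h 0 e -> locally 0 (fun t => h t <= h 0) -> e <= 0).
  { intros h e H M. destruct (Rle_or_lt e 0); auto. exfalso.
    destruct (exists_right _ (filter_and _ _ M (is_derive_pos_right _ _ _ H H0))) as [t [Ht Hs]].
    destruct (Hs t); [rewrite Rabs_pos_eq; lra|]. specialize (H2 Ht). lra. }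
  intros H M. apply Rle_antisym; [eapply G; eauto|].
  assert (- d <= 0); [|lra]. apply (G (fun t => g (- t))).
  - replace (- d) with (-1 * d) by ring. apply (is_derive_comp g Ropp 0).
    + rewrite Ropp_0. exact H.
    + apply is_derive_Ropp.
  - rewrite Ropp_0. apply (locally_Ropp _ M).
Qed.

(** If [d] were positive, the derivative would vanish at 0 and be positive just to the right, so [g]
    would rise strictly above [g 0]. *)
Lemma max_d2_nonpos (g : R -> R) (d : R) :
  has_d2 g d -> locally 0 (fun t => g t <= g 0) -> d <= 0.
Proof.
  intros Hg M. apply has_d2_elim in Hg. destruct Hg as [G1 G2].
  destruct (Rle_or_lt d 0); auto. exfalso.
  pose proof (max_derive_0 _ _ (locally_singleton _ _ G1) M) as D0.
  destruct (exists_right _ (filter_and _ _ (filter_and _ _ G1 M)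
     (is_derive_pos_right _ _ _ G2 H))) as [t [Ht Hs]].
  assert (MV : forall a b, 0 <= a -> a < b -> b <= t ->
    exists c, a <= c <= b /\ g b - g a = Derive g c * (b - a)).
  { intros a b Ha Hab Hb. destruct (MVT_gen g a b (Derive g)) as [c [Hc E]].
    - rewrite Rmin_left, Rmax_right by lra. intros x Hx. apply Hs. rewrite Rabs_pos_eq; lra.
    - rewrite Rmin_left, Rmax_right by lra. intros x Hx.
      apply derivable_continuous_pt. exists (Derive g x). apply is_derive_Reals, Hs.
      rewrite Rabs_pos_eq; lra.
    - rewrite Rmin_left, Rmax_right in Hc by lra. eauto. }
  assert (DP : forall c, 0 < c <= t -> 0 < Derive g c).
  { intros c Hc. destruct (Hs c) as [_ P]; [rewrite Rabs_pos_eq; lra|].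
    specialize (P (proj1 Hc)). lra. }
  (* The interval is halved because the mean value point of the first half may be 0 itself, where
     the derivative is zero; only the second half yields a strict increase. *)
  destruct (MV 0 (t / 2)) as [c1 [Hc1 E1]]; try lra.
  destruct (MV (t / 2) t) as [c2 [Hc2 E2]]; try lra.
  assert (0 < Derive g c2) by (apply DP; lra).
  assert (0 <= Derive g c1).
  { destruct (Rle_lt_or_eq_dec 0 c1) as [Hlt|<-]; [lra| |lra]. left. apply DP; lra. }
  destruct (Hs t) as [[_ M'] _]; [rewrite Rabs_pos_eq; lra|]. nra.
Qed.

Lemma line_0 (f : pt -> R) (v : pt) (i : nat) : line f v i 0 = f v.
Proof. unfold line. rewrite axis_0, padd_0_r. reflexivity. Qed.

Lemma has_lap_ext_loc (f g : pt -> R) (v : pt) (L : R) :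
  locally v (fun w => f w = g w) -> has_lap f v L -> has_lap g v L.
Proof.
  intros E [d [Hd HL]]. exists d. split; auto. intro i.
  eapply has_d2_ext; [|apply Hd]. unfold line. apply (locally_line v i (fun w => f w = g w)), E.
Qed.

Lemma has_lap_plus (f g : pt -> R) (v : pt) (a b : R) :
  has_lap f v a -> has_lap g v b -> has_lap (fun w => f w + g w) v (a + b).
Proof.
  intros [d [Hd ->]] [e [He ->]]. exists (fun i => d i + e i). split; [|ring].
  intro i. apply (has_d2_plus (line f v i) (line g v i)); auto.
Qed.

Lemma has_lap_scal (c : R) (f : pt -> R) (v : pt) (a : R) :
  has_lap f v a -> has_lap (fun w => c * f w) v (c * a).
Proof.
  intros [d [Hd ->]]. exists (fun i => c * d i). split; [|ring].
  intro i. apply (has_d2_scal c (line f v i)); auto.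
Qed.

Lemma has_lap_minus (f g : pt -> R) (v : pt) (a b : R) :
  has_lap f v a -> has_lap g v b -> has_lap (fun w => f w - g w) v (a - b).
Proof.
  intros Hf Hg. replace (a - b) with (a + (-1) * b) by ring.
  replace (fun w => f w - g w) with (fun w => f w + (-1) * g w)
    by (apply functional_extensionality; intro; ring).
  apply has_lap_plus; auto. apply has_lap_scal, Hg.
Qed.

Lemma has_lap_const (c : R) (v : pt) : has_lap (fun _ => c) v 0.
Proof. exists (fun _ => 0). split; [intro; apply has_d2_const|ring]. Qed.

Lemma has_lap_padd (f : pt -> R) (v u : pt) (L : R) :
  has_lap f (padd v u) L -> has_lap (fun w => f (padd w u)) v L.
Proof.
  intros [d [Hd HL]]. exists d. split; auto. intro i.
  eapply has_d2_ext; [|apply (Hd i)]. apply filter_forall. intro t. unfold line.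
  f_equal. apply pt_eq; intro j. rewrite !crd_padd. ring.
Qed.

Lemma has_lap_crd2 (i : nat) (v : pt) : has_lap (fun w => crd i w * crd i w) v 2.
Proof.
  assert (H2 : forall x, has_d2 (fun t => (x + t) * (x + t)) 2).
  { intro x. apply has_d2_intro with (fun t => 2 * (x + t)).
    - apply filter_forall. intro t. auto_derive; auto. ring.
    - auto_derive; auto. ring. }
  assert (H0 : forall x, has_d2 (fun t => (x + 0) * (x + 0)) 0).
  { intro x. apply has_d2_const. }
  dpt v; dix i; [ exists (fun j => match j with 0%nat => 2 | _ => 0 end)
   | exists (fun j => match j with 1%nat => 2 | _ => 0 end)
   | exists (fun j => match j with 2%nat => 2 | _ => 0 end)
   | exists (fun j => match j with 0%nat | 1%nat | 2%nat => 0 | _ => 2 end)];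
  (split; [|simpl; ring]); intro ix; dix ix; unfold line; simpl; auto.
Qed.

Lemma has_lap_crd (i : nat) (v : pt) : has_lap (crd i) v 0.
Proof.
  assert (H2 : forall x, has_d2 (fun t => x + t) 0).
  { intro x. apply has_d2_intro with (fun t => 1).
    - apply filter_forall. intro t. auto_derive; auto.
    - auto_derive; auto. }
  assert (H0 : forall x, has_d2 (fun t => x + 0) 0).
  { intro x. apply has_d2_const. }
  exists (fun _ => 0). split; [|ring].
  dpt v; dix i; intro ix; dix ix; unfold line; simpl; auto.
Qed.

Lemma has_lap_ext (f g : pt -> R) (v : pt) (L : R) :
  (forall w, f w = g w) -> has_lap f v L -> has_lap g v L.
Proof. intros E. apply has_lap_ext_loc, filter_forall, E. Qed.

Lemma has_lap_nrm2 (v : pt) : has_lap nrm2 v 8.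
Proof.
  eapply has_lap_ext; [intro; symmetry; apply nrm2_crd|].
  replace 8 with (2 + 2 + 2 + 2) by ring.
  apply has_lap_plus; [apply has_lap_plus; [apply has_lap_plus|]|]; apply has_lap_crd2.
Qed.

Lemma inbox_nrm2 (r : R) (v : pt) : inbox r v -> nrm2 v <= 4 * (r * r).
Proof.
  intro H. rewrite nrm2_crd.
  assert (forall i, crd i v * crd i v <= r * r).
  { intro i. specialize (H i). apply Rabs_le_between in H. nra. }
  pose proof (H0 0%nat); pose proof (H0 1%nat); pose proof (H0 2%nat); pose proof (H0 3%nat). lra.
Qed.

Lemma nrm2_pos (v : pt) : 0 <= nrm2 v.
Proof. dpt v; unfold nrm2. nra. Qed.

(** * Maximum principle and the gradient estimate *)

(** Boundary and singular points are treated alike: near them [f] must be at most any [e > 0] on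
    [dom], while elsewhere [f] is subharmonic at an interior point of [dom]. Adding [eta |v|^2]
    makes the Laplacian strictly positive. If the supremum [M] of the perturbed function were not
    approached locally anywhere, compactness would bound it strictly below [M]; it is shown that
    this is indeed the case, a contradiction. *)
Lemma max_principle (f : pt -> R) (dom : pt -> Prop) (r : R) :
  (forall v, dom v -> inbox r v) ->
  (forall v, inbox r v ->
     (forall e, 0 < e -> locally v (fun w => dom w -> f w <= e)) \/
     (locally v dom /\ continuous f v /\ exists L, 0 <= L /\ has_lap f v L)) ->
  forall v, dom v -> f v <= 0.
Proof.
  intros Hdom H v0 Hv0. destruct (Rle_or_lt (f v0) 0) as [|Hpos]; auto. exfalso.
  (* On the cube |v|^2 is at most [4 r^2], so the perturbation adds at most half of [f v0]; the
     [+ 1] keeps the denominator positive. *)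
  set (eta := f v0 / (2 * (4 * (r * r) + 1))).
  assert (Hr : 0 <= r * r) by nra.
  assert (Heta : 0 < eta) by (apply Rdiv_lt_0_compat; lra).
  assert (Heta2 : eta * (4 * (r * r)) <= f v0 / 2).
  { assert (E : eta * (2 * (4 * (r * r) + 1)) = f v0) by (unfold eta; field; lra). nra. }
  set (g := fun v => f v + eta * nrm2 v).
  assert (Hgle : forall w, dom w -> g w <= f w + f v0 / 2).
  { intros w Hw. unfold g. pose proof (inbox_nrm2 r w (Hdom w Hw)). nra. }
  assert (Hg0 : f v0 <= g v0). { unfold g. pose proof (nrm2_pos v0). nra. }
  assert (Hcont : forall v, continuous f v -> continuous g v).
  { intros v Hc. apply continuous_Rplus; auto. apply continuous_Rmult; [apply continuous_const|apply continuous_nrm2]. }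
  destruct (box_bound g dom (fun _ => True) r) as [B [_ HB]].
  - exists 0; auto.
  - auto.
  - intros v Hv. destruct (H v Hv) as [Ha|[_ [Hc _]]].
    + exists (1 + f v0 / 2). split; auto. generalize (Ha 1 Rlt_0_1). apply filter_imp.
      intros w Hw Hd. specialize (Hw Hd). specialize (Hgle w Hd). lra.
    + exists (g v + 1). split; auto. pose proof (Hcont v Hc) as Hgc.
      apply locally_near_by. destruct (proj1 (continuous_near_by _ _) Hgc 1 Rlt_0_1) as [d [Hd Hw]].
      exists d. split; auto. intros w Hcl _. specialize (Hw w Hcl). apply Rabs_lt_between in Hw. lra.
  - destruct (completeness (fun y => exists v, dom v /\ y = g v)) as [M [Hub Hlub]].
    { exists B. intros y [v [Hv ->]]. auto. }
    { exists (g v0). eauto. }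
    assert (HMg : forall v, dom v -> g v <= M). { intros v Hv. apply Hub. eauto. }
    assert (HM0 : f v0 <= M). { specialize (HMg v0 Hv0). lra. }
    destruct (box_bound g dom (fun m => m < M) r) as [m [Hm Hmb]].
    + exists (M - 1). lra.
    + intros a b Ha Hb. apply Rmax_lub_lt; auto.
    + intros v Hv. destruct (H v Hv) as [Ha|[Hl [Hc [L [HL Hlap]]]]].
      (* A quarter of [f v0] from the local bound and a half from the perturbation stay strictly
         below [f v0 <= M]. *)
      * exists (3 / 4 * f v0). split; [lra|].
        assert (0 < f v0 / 4) by lra. generalize (Ha _ H0). apply filter_imp.
        intros w Hw Hd. specialize (Hw Hd). specialize (Hgle w Hd). lra.
      * pose proof (locally_singleton _ _ Hl) as Hdv.
        assert (Hlt : g v < M).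
        { destruct (Rle_lt_or_eq_dec (g v) M (HMg v Hdv)) as [|Heq]; auto. exfalso.
          (* At a point where [g] equals [M] the four second derivatives would be nonpositive,
             against the positive sum [L + 8 eta]. *)
          assert (Hgl : has_lap g v (L + eta * 8)).
          { apply has_lap_plus; auto. apply has_lap_scal, has_lap_nrm2. }
          destruct Hgl as [d [Hd Es]].
          assert (forall i, d i <= 0).
          { intro i. apply (max_d2_nonpos (line g v i)); auto.
            rewrite line_0, Heq. unfold line. apply (locally_line v i (fun w => g w <= M)).
            revert Hl. apply filter_imp. auto. }
          pose proof (H0 0%nat); pose proof (H0 1%nat); pose proof (H0 2%nat); pose proof (H0 3%nat).
          lra. }
        exists ((M + g v) / 2). split; [lra|]. pose proof (Hcont v Hc) as Hgc.
        apply locally_near_by.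
        destruct (proj1 (continuous_near_by _ _) Hgc ((M - g v) / 2)) as [d [Hd Hw]]; [lra|].
        exists d. split; auto. intros w Hcl _. specialize (Hw w Hcl). apply Rabs_lt_between in Hw. lra.
    + assert (M <= m); [|lra]. apply Hlub. intros y [v [Hv ->]]. apply Hmb; auto.
Qed.

Definition refl (i : nat) (v : pt) : pt := padd v (axis i (-2 * crd i v)).

Lemma crd_axis_same (i : nat) (t : R) : crd i (axis i t) = t.
Proof. dix i; reflexivity. Qed.

(** Every index from 3 on denotes the last coordinate, so coincidence of two axes is expressed by
    equal functions instead of [i = j]. *)
Lemma crd_axis_cases (i j : nat) :
  (forall t, crd j (axis i t) = t) /\ axis i = axis j /\ crd i = crd j \/
  (forall t, crd j (axis i t) = 0) /\ (forall t, crd i (axis j t) = 0).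
Proof. dix i; dix j; simpl; auto. Qed.

Lemma crd_refl_abs (i j : nat) (v : pt) : Rabs (crd j (refl i v)) = Rabs (crd j v).
Proof.
  unfold refl. rewrite crd_padd.
  destruct (crd_axis_cases i j) as [[H [E Ec]]|[H H']]; rewrite H.
  - rewrite Ec, <- Rabs_Ropp. f_equal. ring.
  - f_equal. ring.
Qed.

Lemma crd_refl_close (i j : nat) (v w : pt) :
  Rabs (crd j (refl i w) - crd j (refl i v)) = Rabs (crd j w - crd j v).
Proof.
  unfold refl. rewrite !crd_padd.
  destruct (crd_axis_cases i j) as [[H [E Ec]]|[H H']]; rewrite !H.
  - rewrite Ec, <- Rabs_Ropp. f_equal. ring.
  - f_equal. ring.
Qed.

Lemma has_lap_refl (f : pt -> R) (i : nat) (v : pt) (L : R) :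
  has_lap f (refl i v) L -> has_lap (fun w => f (refl i w)) v L.
Proof.
  intros [d [Hd HL]]. exists d. split; auto. intro j.
  destruct (crd_axis_cases i j) as [[H [E Ec]]|[H H']].
  - eapply has_d2_ext; [|apply has_d2_opp_arg, (Hd j)]. apply filter_forall. intro t.
    unfold line, refl. f_equal. apply pt_eq. intro l. rewrite !crd_padd, Ec, E, crd_axis_same.
    dix j; dix l; simpl; ring.
  - eapply has_d2_ext; [|apply (Hd j)]. apply filter_forall. intro t.
    unfold line, refl. f_equal. apply pt_eq. intro l. rewrite !crd_padd, H', Rplus_0_r. ring.
Qed.

Lemma continuous_refl (f : pt -> R) (i : nat) (v : pt) :
  continuous f (refl i v) -> continuous (fun w => f (refl i w)) v.
Proof.
  rewrite !continuous_near_by. intros H e He. destruct (H e He) as [d [Hd H']].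
  exists d. split; auto. intros w Hw. apply H'. intro j. rewrite crd_refl_close. apply Hw.
Qed.

Lemma locally_crd_lt (r : R) (v : pt) :
  (forall j, Rabs (crd j v) < r) -> locally v (fun w => forall j, Rabs (crd j w) < r).
Proof.
  intro H.
  assert (G : forall j, locally v (fun w => Rabs (crd j w) < r)).
  { intro j. apply locally_near_by. exists (r - Rabs (crd j v)). split; [specialize (H j); lra|].
    intros w Hw. specialize (Hw j). pose proof (Rabs_triang_inv (crd j w) (crd j v)). lra. }
  generalize (filter_and _ _ (filter_and _ _ (G 0%nat) (G 1%nat)) (filter_and _ _ (G 2%nat) (G 3%nat))).
  apply filter_imp. intros w [[? ?] [? ?]] j. dpt w; dix j; simpl in *; assumption.
Qed.

Lemma locally_gt_continuous (f : pt -> R) (v : pt) (a : R) :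
  continuous f v -> a < f v -> locally v (fun w => a < f w).
Proof.
  rewrite continuous_near_by, locally_near_by. intros H Ha. destruct (H (f v - a)) as [d [Hd Hw]]; [lra|].
  exists d. split; auto. intros w Hc. specialize (Hw w Hc). apply Rabs_lt_between in Hw. lra.
Qed.

Lemma locally_lt_continuous (f : pt -> R) (v : pt) (a : R) :
  continuous f v -> f v < a -> locally v (fun w => f w < a).
Proof.
  rewrite continuous_near_by, locally_near_by. intros H Ha. destruct (H (a - f v)) as [d [Hd Hw]]; [lra|].
  exists d. split; auto. intros w Hc. specialize (Hw w Hc). apply Rabs_lt_between in Hw. lra.
Qed.

(* On a half cube the odd part of [D] vanishes on the symmetry plane and is dominated by the
   harmonic barrier [2M (|v|^2/rho^2 + 4 (v_i/rho - v_i^2/rho^2))], which is at least [2M] on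
   the remaining faces. *)
Lemma odd_part_estimate (D : pt -> R) (i : nat) (rho M : R) :
  0 < rho -> 0 <= M ->
  (forall v, (forall j, Rabs (crd j v) < rho) ->
     has_lap D v 0 /\ continuous D v /\ Rabs (D v) <= M) ->
  forall h, 0 < h < rho -> D (axis i h) - D (axis i (- h)) <= 8 * M * h / rho.
Proof.
  intros Hrho HM HD h Hh.
  set (q := / rho). assert (Hq : 0 < q) by (apply Rinv_0_lt_compat; auto).
  assert (Hqr : q * rho = 1) by (unfold q; field; lra).
  set (B := fun v => 2 * M * (q * q * nrm2 v + 4 * (q * crd i v - q * q * (crd i v * crd i v)))).
  assert (HBc : forall v, continuous B v).
  { intro v. unfold B. apply continuous_Rmult; [apply continuous_const|].
    apply continuous_Rplus.
    - apply continuous_Rmult; [apply continuous_const|apply continuous_nrm2].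
    - apply continuous_Rmult; [apply continuous_const|]. apply continuous_Rminus.
      + apply continuous_Rmult; [apply continuous_const|apply continuous_crd].
      + apply continuous_Rmult; [apply continuous_const|]. apply continuous_Rmult; apply continuous_crd. }
  assert (HBl : forall v, has_lap B v 0).
  { intro v. replace 0 with (2 * M * (q * q * 8 + 4 * (q * 0 - q * q * 2))) by ring.
    unfold B. apply has_lap_scal, has_lap_plus; [apply has_lap_scal, has_lap_nrm2|].
    apply has_lap_scal, has_lap_minus; apply has_lap_scal; [apply has_lap_crd|apply has_lap_crd2]. }
  set (f := fun v => D v - D (refl i v) - B v).
  set (dom := fun v => (forall j, Rabs (crd j v) < rho) /\ 0 < crd i v).
  assert (Hrefl : forall v, (forall j, Rabs (crd j v) < rho) -> forall j, Rabs (crd j (refl i v)) < rho).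
  { intros v Hv j. rewrite crd_refl_abs. apply Hv. }
  assert (Hfc : forall v, (forall j, Rabs (crd j v) < rho) -> continuous f v).
  { intros v Hv. unfold f. apply continuous_Rminus; auto. apply continuous_Rminus.
    - apply HD, Hv.
    - apply continuous_refl. apply HD, Hrefl, Hv. }
  assert (Hsq : forall v j, crd j v * crd j v <= nrm2 v).
  { intros v j. dpt v; dix j; unfold nrm2; simpl; nra. }
  assert (key : f (axis i h) <= 0).
  { apply (max_principle f dom rho).
    - intros v [Hv _] j. left. apply Hv.
    - intros v Hv. destruct (Rlt_or_le (crd i v) 0) as [Hneg|Hnn].
      { left. intros e He. generalize (locally_lt_continuous _ v 0 (continuous_crd i v) Hneg).
        apply filter_imp. intros w Hw [_ Hp]. lra. }
      destruct (classic (forall j, Rabs (crd j v) < rho)) as [Hin|Hout].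
      + destruct (Rle_lt_or_eq_dec _ _ Hnn) as [Hp|Hz].
        * right. split; [|split; [auto|exists 0; split; [lra|]]].
          -- unfold dom. apply filter_and; [apply locally_crd_lt, Hin|].
             apply locally_gt_continuous; [apply continuous_crd|auto].
          -- replace 0 with (0 - 0 - 0) by ring. unfold f.
             apply has_lap_minus; auto. apply has_lap_minus; [apply HD, Hin|].
             apply has_lap_refl, HD, Hrefl, Hin.
        * left. intros e He.
          assert (f v <= 0).
          { unfold f. replace (refl i v) with v.
            - unfold B. rewrite <- Hz. pose proof (nrm2_pos v).
              assert (0 <= 2 * M * (q * q * nrm2 v)) by (apply Rmult_le_pos; [lra|apply Rmult_le_pos; nra]).
              lra.
            - unfold refl. rewrite <- Hz. replace (-2 * 0) with 0 by ring.
              rewrite axis_0, padd_0_r; auto. }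
          assert (f v < e) by lra.
          generalize (locally_lt_continuous _ v e (Hfc v Hin) H0). apply filter_imp. intros; lra.
      + left. intros e He. apply not_all_ex_not in Hout. destruct Hout as [j Hj].
        apply Rnot_lt_le in Hj.
        assert (HB : 2 * M <= B v).
        { pose proof (Hsq v j) as Hn.
          assert (rho * rho <= nrm2 v).
          { assert (crd j v * crd j v = Rabs (crd j v) * Rabs (crd j v)) as E
              by (rewrite <- Rabs_mult, Rabs_pos_eq; nra). nra. }
          assert (1 <= q * q * nrm2 v).
          { replace 1 with (q * q * (rho * rho)) by (rewrite <- (Rmult_1_l 1), <- Hqr; ring).
            apply Rmult_le_compat_l; nra. }
          assert (Hi : Rabs (crd i v) <= rho) by apply Hv. apply Rabs_le_between in Hi.
          assert (0 <= q * crd i v) by nra. assert (q * crd i v <= 1) by nra.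
          unfold B. rewrite <- (Rmult_1_r (2 * M)) at 1. apply Rmult_le_compat_l; [lra|]. nra. }
        assert (HB' : 2 * M - e < B v) by lra.
        generalize (locally_gt_continuous _ v _ (HBc v) HB'). apply filter_imp.
        intros w Hw [Hwin _]. unfold f.
        destruct (HD w Hwin) as [_ [_ H1]]. destruct (HD _ (Hrefl w Hwin)) as [_ [_ H2]].
        apply Rabs_le_between in H1, H2. lra.
    - split.
      + intro j. eapply Rle_lt_trans; [apply crd_axis_le|]. rewrite Rabs_pos_eq; lra.
      + rewrite crd_axis_same. lra. }
  unfold f in key.
  replace (refl i (axis i h)) with (axis i (- h)) in key.
  2: { unfold refl. rewrite crd_axis_same. dix i; simpl; repeat f_equal; ring. }
  (* On the axis the quadratic terms of the barrier combine to [-3 q^2 h^2], which is dropped; the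
     linear term is the bound. *)
  assert (B (axis i h) <= 8 * M * h / rho); [|lra].
  unfold B. rewrite crd_axis_same.
  replace (nrm2 (axis i h)) with (h * h) by (dix i; unfold nrm2; simpl; ring).
  replace (8 * M * h / rho) with (2 * M * (4 * (q * h))) by (unfold q; field; lra).
  apply Rmult_le_compat_l; [lra|]. assert (0 <= q * q * (h * h)) by nra. lra.
Qed.

Definition diff (h : pt) (f : pt -> R) : pt -> R := fun v => f (padd v h) - f v.

(** Seen from the midpoint of the segment, the difference is the odd part of [f] at [h = |t|/2]. The
    cube of radius [rho] around the midpoint lies in the one of radius [2 rho] around [v], and
    applying the one-sided estimate to [-f] as well bounds the absolute value. *)
Lemma diff_estimate (f : pt -> R) (i : nat) (t : R) (v : pt) (rho M : R) :
  Rabs t < rho -> 0 <= M ->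
  (forall w, (forall j, Rabs (crd j w - crd j v) < 2 * rho) ->
     has_lap f w 0 /\ continuous f w /\ Rabs (f w) <= M) ->
  Rabs (diff (axis i t) f v) <= 4 * M * Rabs t / rho.
Proof.
  intros Ht HM Hf.
  assert (Hrho : 0 < rho) by (pose proof (Rabs_pos t); lra).
  set (c := padd v (axis i (t / 2))). set (D := fun w => f (padd w c)).
  assert (HD : forall w, (forall j, Rabs (crd j w) < rho) ->
     has_lap D w 0 /\ continuous D w /\ Rabs (D w) <= M).
  { intros w Hw.
    assert (Hin : forall j, Rabs (crd j (padd w c) - crd j v) < 2 * rho).
    { intro j. unfold c. rewrite !crd_padd.
      replace (crd j w + (crd j v + crd j (axis i (t / 2))) - crd j v)
        with (crd j w + crd j (axis i (t / 2))) by ring.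
      eapply Rle_lt_trans; [apply Rabs_triang|]. specialize (Hw j).
      pose proof (crd_axis_le j i (t / 2)).
      assert (Rabs (t / 2) = Rabs t / 2).
      { unfold Rdiv. rewrite Rabs_mult, (Rabs_pos_eq (/ 2)) by lra. reflexivity. }
      pose proof (Rabs_pos t). lra. }
    destruct (Hf _ Hin) as [H1 [H2 H3]]. split; [|split].
    - apply has_lap_padd, H1.
    - apply continuous_padd, H2.
    - exact H3. }
  assert (HD' : forall w, (forall j, Rabs (crd j w) < rho) ->
     has_lap (fun w => -1 * D w) w 0 /\ continuous (fun w => -1 * D w) w /\ Rabs (-1 * D w) <= M).
  { intros w Hw. destruct (HD w Hw) as [H1 [H2 H3]]. split; [|split].
    - replace 0 with (-1 * 0) by ring. apply has_lap_scal, H1.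
    - apply continuous_Rmult; [apply continuous_const|apply H2].
    - replace (-1 * D w) with (- D w) by ring. rewrite Rabs_Ropp. exact H3. }
  assert (G : forall h, 0 < h < rho -> Rabs (D (axis i h) - D (axis i (- h))) <= 8 * M * h / rho).
  { intros h Hh. pose proof (odd_part_estimate D i rho M Hrho HM HD h Hh).
    pose proof (odd_part_estimate _ i rho M Hrho HM HD' h Hh). apply Rabs_le_between. lra. }
  assert (E1 : D (axis i (t / 2)) = f (padd v (axis i t))).
  { unfold D, c. f_equal. apply pt_eq. intro l. rewrite !crd_padd. dix i; dix l; simpl; field. }
  assert (E2 : D (axis i (- (t / 2))) = f v).
  { unfold D, c. f_equal. apply pt_eq. intro l. rewrite !crd_padd. dix i; dix l; simpl; field. }
  unfold diff. rewrite <- E1, <- E2.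
  destruct (Rtotal_order t 0) as [Hn|[Hz|Hp]].
  - rewrite (Rabs_left t) in * by auto. specialize (G (- (t / 2))).
    rewrite Ropp_involutive in G. rewrite Rabs_minus_sym.
    replace (4 * M * - t / rho) with (8 * M * - (t / 2) / rho) by (field; lra). apply G. lra.
  - rewrite Hz. replace (- (0 / 2)) with (0 / 2) by field. rewrite Rminus_diag, !Rabs_R0.
    right. field. lra.
  - rewrite (Rabs_pos_eq t) in * by lra. specialize (G (t / 2)).
    replace (4 * M * t / rho) with (8 * M * (t / 2) / rho) by (field; lra). apply G. lra.
Qed.

(** * Growth at infinity and the effect of a difference *)

Definition nrm (v : pt) : R :=
  let '(x, y, z, w) := v in Rmax (Rmax (Rabs x) (Rabs y)) (Rmax (Rabs z) (Rabs w)).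

Lemma crd_nrm (i : nat) (v : pt) : Rabs (crd i v) <= nrm v.
Proof.
  dpt v; dix i; unfold nrm; simpl.
  - eapply Rle_trans; [apply Rmax_l|apply Rmax_l].
  - eapply Rle_trans; [apply Rmax_r|apply Rmax_l].
  - eapply Rle_trans; [apply Rmax_l|apply Rmax_r].
  - eapply Rle_trans; [apply Rmax_r|apply Rmax_r].
Qed.

Lemma nrm_lub (r : R) (v : pt) : inbox r v -> nrm v <= r.
Proof.
  intro H. pose proof (H 0%nat); pose proof (H 1%nat); pose proof (H 2%nat); pose proof (H 3%nat).
  dpt v; simpl in *. repeat apply Rmax_lub; assumption.
Qed.

Lemma nrm_attained (v : pt) : exists i, nrm v = Rabs (crd i v).
Proof.
  dpt v. unfold nrm.
  set (a := Rabs r). set (b := Rabs r0). set (c := Rabs r1). set (d := Rabs r2).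
  unfold Rmax. repeat destruct Rle_dec;
    solve [exists 0%nat; reflexivity|exists 1%nat; reflexivity|exists 2%nat; reflexivity|exists 3%nat; reflexivity].
Qed.

Lemma nrm_close (v w : pt) (d : R) :
  (forall j, Rabs (crd j w - crd j v) < d) -> nrm v - d <= nrm w <= nrm v + d.
Proof.
  intro H. split.
  - destruct (nrm_attained v) as [i ->]. pose proof (crd_nrm i w). specialize (H i).
    pose proof (Rabs_triang_inv (crd i v) (crd i w)). rewrite Rabs_minus_sym in H. lra.
  - apply nrm_lub. intro i. specialize (H i). pose proof (crd_nrm i v).
    pose proof (Rabs_triang_inv (crd i w) (crd i v)). lra.
Qed.

Lemma nrm_nonneg (v : pt) : 0 <= nrm v.
Proof. eapply Rle_trans; [apply (Rabs_pos (crd 0 v))|apply crd_nrm]. Qed.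

Lemma list_nrm_bound (S : list pt) : exists B, 0 <= B /\ forall p, In p S -> nrm p <= B.
Proof.
  induction S as [|p S [B [HB IH]]].
  - exists 0. split; [lra|]. intros p [].
  - exists (Rmax (nrm p) B). split.
    + eapply Rle_trans; [apply HB|apply Rmax_r].
    + intros p' [<-|Hp]; [apply Rmax_l|]. eapply Rle_trans; [apply IH, Hp|apply Rmax_r].
Qed.

(* [S] is the singular set; the growth condition says [f = O(|v|^(k-j))] at infinity. *)
Record tame (k j : nat) (S : list pt) (f : pt -> R) : Prop := {
  tame_regular : forall v, ~ In v S -> has_lap f v 0 /\ continuous f v;
  tame_bounded : forall v, exists B, locally v (fun w => Rabs (f w) <= B);
  tame_growth : exists C r, 0 <= C /\ 0 < r /\
    forall v, r <= nrm v -> Rabs (f v) * nrm v ^ j <= C * nrm v ^ k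
}.

Lemma continuous_diff (h : pt) (f : pt -> R) :
  (forall v, continuous f v) -> forall v, continuous (diff h f) v.
Proof. intros H v. apply continuous_Rminus; [apply continuous_padd|]; apply H. Qed.

(** The estimate is applied on a cube of radius proportional to |v|, where [f] is O(|v|^(k-j));
    dividing by that radius gains one power. A difference reads [f] at two points, hence the
    singular set is joined by its translate. *)
Lemma tame_diff (k j : nat) (S : list pt) (f : pt -> R) (i : nat) (t : R) :
  tame k j S f ->
  tame k (j + 1) (S ++ map (fun p => padd p (axis i (- t))) S) (diff (axis i t) f).
Proof.
  intros [HS Hb [C [r [HC [Hr Hg]]]]]. split.
  - intros v Hv.
    assert (H1 : ~ In (padd v (axis i t)) S).
    { intro H. apply Hv, in_or_app. right. apply in_map_iff.
      exists (padd v (axis i t)). split; auto. apply pt_eq; intro l. rewrite !crd_padd.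
      dix i; dix l; simpl; ring. }
    assert (H2 : ~ In v S) by (intro H; apply Hv, in_or_app; auto).
    split.
    + replace 0 with (0 - 0) by ring. apply has_lap_minus; [|apply HS, H2].
      apply has_lap_padd, HS, H1.
    + apply continuous_Rminus; [|apply HS, H2]. apply continuous_padd, HS, H1.
  - intro v. destruct (Hb v) as [B1 H1]. destruct (Hb (padd v (axis i t))) as [B2 H2].
    exists (B2 + B1). apply locally_padd in H2. generalize (filter_and _ _ H1 H2).
    apply filter_imp. intros w [G1 G2]. unfold diff, Rminus.
    eapply Rle_trans; [apply Rabs_triang|]. rewrite Rabs_Ropp. lra.
  - destruct (list_nrm_bound S) as [B [HB HBS]].
    (* With [n] the norm of [v] and [rho = n/4], norms on the cube lie between [n/2] and [3n/2],
       which gives the factors [2^j] and [(3/2)^k], and [4 |t| / rho] gives the 16. In the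
       threshold, [2r] keeps the cube in the range of the growth bound, [2B] keeps it off the
       singular points, and [4|t|] ensures [|t| < rho]. *)
    exists (16 * Rabs t * (C * (3 / 2) ^ k * 2 ^ j)), (2 * r + 2 * B + 4 * Rabs t + 1).
    pose proof (Rabs_pos t) as Htp.
    split; [|split].
    + apply Rmult_le_pos; [lra|]. apply Rmult_le_pos; [apply Rmult_le_pos; auto|]; apply pow_le; lra.
    + lra.
    + intros v Hv. set (n := nrm v) in *.
      assert (Hn : 0 < n) by lra.
      set (M := C * (3 / 2 * n) ^ k / (n / 2) ^ j).
      assert (Hp2 : 0 < (n / 2) ^ j) by (apply pow_lt; lra).
      assert (HM : 0 <= M).
      { unfold M. apply Rmult_le_pos; [apply Rmult_le_pos; auto; apply pow_le; lra|].
        left. apply Rinv_0_lt_compat; auto. }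
      assert (E : Rabs (diff (axis i t) f v) <= 4 * M * Rabs t / (n / 4)).
      { apply diff_estimate; auto; [lra|]. intros w Hw.
        assert (Hnw : n - n / 2 <= nrm w <= n + n / 2).
        { apply nrm_close. intro l. specialize (Hw l). lra. }
        assert (HwS : ~ In w S) by (intro Hin; specialize (HBS w Hin); lra).
        split; [|split]; try apply HS, HwS.
        assert (Hrw : r <= nrm w) by lra. specialize (Hg w Hrw).
          assert (Hw2 : (n / 2) ^ j <= nrm w ^ j) by (apply pow_incr; lra).
          assert (Hw3 : nrm w ^ k <= (3 / 2 * n) ^ k) by (apply pow_incr; lra).
          unfold M. apply Rmult_le_reg_r with ((n / 2) ^ j); auto.
          unfold Rdiv at 2. rewrite Rmult_assoc, Rinv_l, Rmult_1_r by lra.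
          eapply Rle_trans; [apply Rmult_le_compat_l; [apply Rabs_pos|apply Hw2]|].
          eapply Rle_trans; [apply Hg|]. apply Rmult_le_compat_l; auto. }
      eapply Rle_trans; [apply Rmult_le_compat_r; [apply pow_le; lra|apply E]|].
      right. unfold M. rewrite pow_add, pow_1.
      replace ((3 / 2 * n) ^ k) with ((3 / 2) ^ k * n ^ k) by (symmetry; apply Rpow_mult_distr).
      replace ((n / 2) ^ j) with (n ^ j * / 2 ^ j)
        by (unfold Rdiv; rewrite Rpow_mult_distr, pow_inv; reflexivity).
      field. repeat split; try lra; apply pow_nonzero; lra.
Qed.

(** * Fundamental solutions and isolated singularities *)

Definition pole (v : pt) : R := / nrm2 v.

Lemma nrm2_gt0 (v : pt) : v <> p0 -> 0 < nrm2 v.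
Proof.
  intro H. destruct (Rle_lt_or_eq_dec _ _ (nrm2_pos v)) as [|E]; auto. exfalso. apply H.
  dpt v. unfold nrm2 in E.
  assert (r = 0) by nra. assert (r0 = 0) by nra. assert (r1 = 0) by nra. assert (r2 = 0) by nra.
  subst. reflexivity.
Qed.

Lemma locally_gt_0 (g : R -> R) : continuous g 0 -> 0 < g 0 -> locally 0 (fun t => 0 < g t).
Proof.
  intros Hc Hp. apply (Hc (fun y => 0 < y)). apply locally_R. exists (g 0). split; auto.
  intros y Hy. apply Rabs_lt_between in Hy. lra.
Qed.

Lemma sq_line_pos (x c : R) : 0 < x * x + c -> locally 0 (fun t => 0 < (x + t) * (x + t) + c).
Proof.
  intro H. apply (locally_gt_0 (fun t => (x + t) * (x + t) + c)).
  - apply (@ex_derive_continuous R_AbsRing R_NormedModule). auto_derive; auto.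
  - rewrite Rplus_0_r. exact H.
Qed.

Lemma has_d2_pole (x c : R) : 0 < x * x + c ->
  has_d2 (fun t => / ((x + t) * (x + t) + c))
    (8 * (x * x) / (x * x + c) ^ 3 - 2 / (x * x + c) ^ 2).
Proof.
  intro H. apply has_d2_intro with (fun t => - (2 * (x + t)) / ((x + t) * (x + t) + c) ^ 2).
  - generalize (sq_line_pos x c H). apply filter_imp. intros t Ht. auto_derive; [lra|]. field. lra.
  - assert ((x + 0) * (x + 0) + c <> 0) by (rewrite Rplus_0_r; lra).
    auto_derive; [|rewrite !Rplus_0_r; field; lra].
    simpl. rewrite Rmult_1_r. apply Rmult_integral_contrapositive_currified; auto.
Qed.

Lemma line_nrm2 (v : pt) (i : nat) (t : R) :
  nrm2 (padd v (axis i t)) = (crd i v + t) * (crd i v + t) + (nrm2 v - crd i v * crd i v).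
Proof. dpt v; dix i; simpl; unfold nrm2; ring. Qed.

(** The axes contribute [8 v_i^2/|v|^6 - 2/|v|^4]; summed over four axes this is
    [8/|v|^4 - 8/|v|^4]. This is where the dimension enters. *)
Lemma has_lap_pole (v : pt) : v <> p0 -> has_lap pole v 0.
Proof.
  intro Hv. apply nrm2_gt0 in Hv.
  exists (fun i => 8 * (crd i v * crd i v) / nrm2 v ^ 3 - 2 / nrm2 v ^ 2). split.
  - intro i. pose proof (has_d2_pole (crd i v) (nrm2 v - crd i v * crd i v)) as H.
    replace (crd i v * crd i v + (nrm2 v - crd i v * crd i v)) with (nrm2 v) in H by ring.
    eapply has_d2_ext; [|apply H, Hv]. apply filter_forall. intro t. unfold line, pole.
    rewrite line_nrm2. reflexivity.
  - pose proof (nrm2_crd v). assert (nrm2 v <> 0) by lra.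
    replace (_ + _) with (8 * (crd 0 v * crd 0 v + crd 1 v * crd 1 v + crd 2 v * crd 2 v + crd 3 v * crd 3 v) / nrm2 v ^ 3 - 8 / nrm2 v ^ 2).
    + rewrite <- H. field. auto.
    + field. auto.
Qed.

Lemma continuous_pole (v : pt) : v <> p0 -> continuous pole v.
Proof.
  intro Hv. apply nrm2_gt0 in Hv. unfold pole.
  apply (continuous_comp nrm2 Rinv); [apply continuous_nrm2|].
  apply (@ex_derive_continuous R_AbsRing R_NormedModule). auto_derive. lra.
Qed.

Definition psub (v p : pt) : pt := padd v (pscal (-1) p).

Lemma psub_neq (v p : pt) : v <> p -> psub v p <> p0.
Proof.
  intros H E. apply H. apply pt_eq. intro i. assert (crd i (psub v p) = 0) by (rewrite E; dix i; reflexivity).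
  unfold psub in H0. rewrite crd_padd, crd_pscal in H0. lra.
Qed.

Fixpoint poles (S : list pt) (v : pt) : R :=
  match S with nil => 0 | p :: S' => pole (psub v p) + poles S' v end.

Lemma poles_nonneg (S : list pt) (v : pt) : 0 <= poles S v.
Proof.
  induction S as [|p S IH]; simpl; [lra|]. unfold pole.
  pose proof (nrm2_pos (psub v p)).
  destruct (Rle_lt_or_eq_dec _ _ H) as [Hl|E].
  - pose proof (Rinv_0_lt_compat _ Hl). lra.
  (* At the pole itself the value is [/ 0 = 0]. *)
  - rewrite <- E, Rinv_0. lra.
Qed.

Lemma poles_ge (S : list pt) (p v : pt) : In p S -> pole (psub v p) <= poles S v.
Proof.
  induction S as [|p' S IH]; intros []; simpl.
  - subst. pose proof (poles_nonneg S v). lra.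
  - specialize (IH H). pose proof (poles_nonneg (p' :: nil) v). simpl in H0. lra.
Qed.

Lemma has_lap_poles (S : list pt) (v : pt) : ~ In v S -> has_lap (poles S) v 0 /\ continuous (poles S) v.
Proof.
  induction S as [|p S IH]; intro H; simpl.
  - split; [apply (has_lap_const 0)|apply (continuous_const 0)].
  - destruct IH as [I1 I2]; [intro; apply H; right; auto|].
    assert (Hp : psub v p <> p0) by (apply psub_neq; intro; apply H; left; auto).
    split.
    + replace 0 with (0 + 0) by ring.
      apply (has_lap_plus (fun v => pole (psub v p)) (poles S)); auto.
      apply has_lap_padd, has_lap_pole, Hp.
    + apply (continuous_Rplus (fun v => pole (psub v p)) (poles S)); auto.
      apply continuous_padd, continuous_pole, Hp.
Qed.

Lemma locally_not_in (S : list pt) (v : pt) : ~ In v S -> locally v (fun w => ~ In w S).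
Proof.
  induction S as [|p S IH]; intro H.
  - apply filter_forall. auto.
  - assert (Hp : psub v p <> p0) by (apply psub_neq; intro; apply H; left; auto).
    apply nrm2_gt0 in Hp.
    assert (L : locally v (fun w => 0 < nrm2 (psub w p))).
    { apply (locally_gt_continuous (fun w => nrm2 (psub w p))); auto.
      apply continuous_padd, continuous_nrm2. }
    assert (I : ~ In v S) by (intro; apply H; right; auto).
    generalize (filter_and _ _ L (IH I)). apply filter_imp. intros w [H1 H2] [E|Hin]; auto.
    subst. replace (nrm2 (psub w w)) with 0 in H1; [lra|].
    unfold psub. rewrite nrm2_crd, !crd_padd, !crd_pscal. ring.
Qed.

Lemma pole_large (p : pt) (K : R) : locally p (fun w => w <> p -> K <= pole (psub w p)).
Proof.
  set (K' := Rabs K + 1). assert (HK : 0 < K') by (pose proof (Rabs_pos K); unfold K'; lra).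
  assert (L : locally p (fun w => nrm2 (psub w p) < / K')).
  { apply (locally_lt_continuous (fun w => nrm2 (psub w p))).
    - apply continuous_padd, continuous_nrm2.
    - replace (nrm2 (psub p p)) with 0; [apply Rinv_0_lt_compat; auto|].
      unfold psub. rewrite nrm2_crd, !crd_padd, !crd_pscal. ring. }
  revert L. apply filter_imp. intros w Hw Hne. apply psub_neq, nrm2_gt0 in Hne.
  unfold pole. assert (K' < / nrm2 (psub w p)).
  { rewrite <- (Rinv_inv K'). apply Rinv_lt_contravar; auto. apply Rmult_lt_0_compat; auto.
    apply Rinv_0_lt_compat; auto. }
  pose proof (Rle_abs K). unfold K' in H. lra.
Qed.

(** Here [j = k + 1] says that [f] is O(1/|v|). In the barrier [e (1 + poles S)] the constant
    dominates [f] on the faces of a large cube and the poles dominate it near [S], where [f] is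
    merely bounded; then [e] is made small at a fixed point. *)
Lemma tame_nonpos_off (k : nat) (f : pt -> R) (S : list pt) :
  tame k (k + 1) S f -> forall v, ~ In v S -> f v <= 0.
Proof.
  intros [HS Hb [C [r [HC [Hr Hg]]]]] v0 Hv0.
  assert (key : forall e, 0 < e -> f v0 <= e * (1 + poles S v0)).
  { intros e He.
    (* Beyond [C / e] the decay gives [|f| <= e]; the other summands place [v0] inside the cube and
       the faces in the range of the growth bound. *)
    set (R1 := nrm v0 + r + C / e + 1).
    assert (HCe : 0 <= C / e) by (apply Rmult_le_pos; auto; left; apply Rinv_0_lt_compat; auto).
    pose proof (nrm_nonneg v0) as Hn0.
    assert (Hfar : forall v, R1 <= nrm v -> Rabs (f v) <= e).
    { intros v Hv. unfold R1 in Hv. assert (r <= nrm v) by lra. specialize (Hg v H).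
      assert (0 < nrm v ^ k) by (apply pow_lt; lra).
      rewrite pow_add, pow_1, (Rmult_comm (nrm v ^ k)), <- Rmult_assoc in Hg.
      apply Rmult_le_reg_r in Hg; auto.
      assert (C <= e * nrm v).
      { assert (C / e <= nrm v) by lra. apply (Rmult_le_compat_l e) in H1; [|lra].
        replace (e * (C / e)) with C in H1 by (field; lra). exact H1. }
      apply Rmult_le_reg_r with (nrm v); lra. }
    set (g := fun v => f v - e * (1 + poles S v)).
    assert (Hgc : forall v, ~ In v S -> continuous g v).
    { intros v Hv. apply continuous_Rminus; [apply HS, Hv|]. apply continuous_Rmult; [apply continuous_const|].
      apply continuous_Rplus; [apply continuous_const|apply has_lap_poles, Hv]. }
    set (dom := fun v => (forall j, Rabs (crd j v) < R1) /\ ~ In v S).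
    assert (g v0 <= 0); [|unfold g in H; lra].
    apply (max_principle g dom R1).
    - intros v [Hv _] j. left. apply Hv.
    - intros v Hv. destruct (classic (In v S)) as [Hin|Hin].
      + left. intros e' He'.
        destruct (Hb v) as [B HB].
        generalize (filter_and _ _ (pole_large v (B / e)) HB).
        apply filter_imp. intros w [H1 H2] [_ Hw]. unfold g.
        assert (w <> v) by (intro; subst; auto). specialize (H1 H).
        pose proof (poles_ge S v w Hin).
        assert (e * (B / e) <= e * poles S w) by (apply Rmult_le_compat_l; lra).
        replace (e * (B / e)) with B in H3 by (field; lra).
        pose proof (Rle_abs (f w)). nra.
      + destruct (classic (forall j, Rabs (crd j v) < R1)) as [Hlt|Hlt].
        * right. split; [|split; auto; exists 0; split; [lra|]].
          -- apply filter_and; [apply locally_crd_lt, Hlt|apply locally_not_in, Hin].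
          -- replace 0 with (0 - e * (0 + 0)) by ring.
             apply has_lap_minus; [apply HS, Hin|]. apply has_lap_scal, has_lap_plus; [apply has_lap_const|].
             apply has_lap_poles, Hin.
        * left. intros e' He'. apply not_all_ex_not in Hlt. destruct Hlt as [j Hj].
          assert (R1 <= nrm v) by (pose proof (crd_nrm j v); lra).
          specialize (Hfar v H). pose proof (poles_nonneg S v). apply Rabs_le_between in Hfar.
          assert (g v < e') by (unfold g; nra).
          generalize (locally_lt_continuous g v e' (Hgc v Hin) H1). apply filter_imp. intros; lra.
    - split; auto. intro j. pose proof (crd_nrm j v0). unfold R1. lra. }
  apply Rnot_lt_le. intro Hp. pose proof (poles_nonneg S v0) as Hq.
  (* This [e] turns the inequality into [f v0 <= f v0 / 2]. *)
  specialize (key (f v0 / (2 * (1 + poles S v0)))).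
  assert (0 < f v0 / (2 * (1 + poles S v0))) by (apply Rdiv_lt_0_compat; lra).
  specialize (key H). replace (f v0 / (2 * (1 + poles S v0)) * (1 + poles S v0)) with (f v0 / 2) in key by (field; lra).
  lra.
Qed.

Lemma tame_opp (k j : nat) (S : list pt) (f : pt -> R) :
  tame k j S f -> tame k j S (fun v => -1 * f v).
Proof.
  intros [HS Hb [C [r [HC [Hr Hg]]]]].
  assert (E : forall v, Rabs (-1 * f v) = Rabs (f v)).
  { intro v. replace (-1 * f v) with (- f v) by ring. apply Rabs_Ropp. }
  split.
  - intros v Hv. split.
    + replace 0 with (-1 * 0) by ring. apply has_lap_scal, HS, Hv.
    + apply continuous_Rmult; [apply continuous_const|apply HS, Hv].
  - intro v. destruct (Hb v) as [B HB]. exists B. revert HB. apply filter_imp.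
    intro w. rewrite E. auto.
  - exists C, r. split; [|split]; auto. intros v Hv. rewrite E. auto.
Qed.

Lemma tame_zero (k : nat) (S : list pt) (f : pt -> R) :
  tame k (k + 1) S f -> forall v, ~ In v S -> f v = 0.
Proof.
  intros T v Hv. apply Rle_antisym.
  - eapply tame_nonpos_off; eauto.
  - assert (-1 * f v <= 0); [|lra].
    apply (tame_nonpos_off k (fun v => -1 * f v) S); auto. apply tame_opp, T.
Qed.

(** A line meets a finite list finitely often. The induction needs a whole interval free of the
    list, not just one parameter. *)
Lemma avoid_list (S : list pt) (v : pt) (d : R) :
  0 < d -> exists t, Rabs t < d /\ ~ In (padd v (axis 0 t)) S.
Proof.
  intros Hd. revert d Hd. 
  assert (G : forall d, 0 < d -> exists t, 0 < t < d /\ forall s, 0 < s < t -> ~ In (padd v (axis 0 s)) S).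
  { induction S as [|p S IH]; intros d Hd.
    - exists (d / 2). split; [lra|]. auto.
    - destruct (IH d Hd) as [t [Ht Hs]].
      set (a := crd 0 p - crd 0 v).
      assert (Hin : forall s, padd v (axis 0 s) = p -> s = a).
      { intros s E. unfold a. rewrite <- E, crd_padd, crd_axis_same. ring. }
      destruct (Rlt_or_le 0 a) as [Ha|Ha].
      + exists (Rmin t a). split.
        * split; [apply Rmin_glb_lt; lra|]. eapply Rle_lt_trans; [apply Rmin_l|lra].
        * intros s Hs' [E|Hi].
          -- apply eq_sym, Hin in E. pose proof (Rmin_r t a). lra.
          -- revert Hi. apply Hs. pose proof (Rmin_l t a). lra.
      + exists t. split; auto. intros s Hs' [E|Hi].
        * apply eq_sym, Hin in E. lra.
        * revert Hi. apply Hs. lra. }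
  intros d Hd. destruct (G d Hd) as [t [Ht Hs]]. exists (t / 2). split.
  - rewrite Rabs_pos_eq; lra.
  - apply Hs. lra.
Qed.

Lemma zero_off_list (f : pt -> R) (S : list pt) :
  (forall v, continuous f v) -> (forall v, ~ In v S -> f v = 0) -> forall v, f v = 0.
Proof.
  intros Hc H v. destruct (Req_dec (f v) 0) as [|Hn]; auto. exfalso.
  destruct (proj1 (continuous_near_by f v) (Hc v) (Rabs (f v))) as [d [Hd Hw]].
  - apply Rabs_pos_lt, Hn.
  - destruct (avoid_list S v d Hd) as [t [Ht Hin]].
    assert (Hcl : near_by d v (padd v (axis 0 t))).
    { intro j. rewrite crd_padd. replace (crd j v + crd j (axis 0 t) - crd j v) with (crd j (axis 0 t)) by ring.
      eapply Rle_lt_trans; [apply crd_axis_le|auto]. }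
    specialize (Hw _ Hcl). rewrite H in Hw by auto. rewrite Rminus_0_l, Rabs_Ropp in Hw. lra.
Qed.

(** * Polynomials in alpha, beta and their conjugates *)

Open Scope C_scope.

Definition isd (f : R -> C) (t : R) (l : C) : Prop :=
  is_derive (fun s => Re (f s)) t (Re l) /\ is_derive (fun s => Im (f s)) t (Im l).

Lemma isd_const (c : C) (t : R) : isd (fun _ => c) t 0.
Proof. split; [apply (is_derive_const (Re c))|apply (is_derive_const (Im c))]. Qed.

Lemma isd_plus (f g : R -> C) (t : R) (a b : C) :
  isd f t a -> isd g t b -> isd (fun s => f s + g s) t (a + b).
Proof.
  intros [F1 F2] [G1 G2]. split.
  - apply (is_derive_plus (fun s => Re (f s)) (fun s => Re (g s))); assumption.
  - apply (is_derive_plus (fun s => Im (f s)) (fun s => Im (g s))); assumption.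
Qed.

Lemma isd_eq (f : R -> C) (t : R) (a b : C) : isd f t a -> a = b -> isd f t b.
Proof. intros H <-. exact H. Qed.

Lemma isd_mult (f g : R -> C) (t : R) (a b : C) :
  isd f t a -> isd g t b -> isd (fun s => f s * g s) t (a * g t + f t * b).
Proof.
  intros [F1 F2] [G1 G2]. split.
  - replace (Re (a * g t + f t * b)) with
      ((Re a * Re (g t) + Re (f t) * Re b) - (Im a * Im (g t) + Im (f t) * Im b))%R
      by (unfold Re, Im; simpl; ring).
    apply (is_derive_minus (fun s => Re (f s) * Re (g s))%R (fun s => Im (f s) * Im (g s))%R);
      apply is_derive_Rmult; assumption.
  - replace (Im (a * g t + f t * b)) with
      ((Re a * Im (g t) + Re (f t) * Im b) + (Im a * Re (g t) + Im (f t) * Re b))%R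
      by (unfold Re, Im; simpl; ring).
    apply (is_derive_plus (fun s => Re (f s) * Im (g s))%R (fun s => Im (f s) * Re (g s))%R);
      apply is_derive_Rmult; assumption.
Qed.

Definition succC (n : nat) : C := RtoC (INR (S n)).

Lemma succC_S (n : nat) : succC (S n) = succC n + 1.
Proof. unfold succC. rewrite S_INR, RtoC_plus. reflexivity. Qed.

Lemma succC_0 : succC 0 = 1.
Proof. reflexivity. Qed.

Lemma succC_neq (n : nat) : succC n <> 0.
Proof.
  intro H. apply (f_equal fst) in H. simpl in H. fold (INR (S n)) in H.
  apply (not_0_INR (S n)); auto.
Qed.

Lemma isd_cpow (z : R -> C) (t : R) (z' : C) (n : nat) :
  isd z t z' -> isd (fun s => cpow (z s) (S n)) t (succC n * cpow (z t) n * z').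
Proof.
  intro Hz. induction n as [|n IH].
  - simpl. eapply isd_eq; [apply isd_mult; [apply Hz|apply (isd_const (RtoC 1))]|].
    rewrite succC_0. ring.
  - eapply isd_eq; [apply (isd_mult z (fun s => cpow (z s) (S n))); [apply Hz|apply IH]|].
    rewrite succC_S. simpl. ring.
Qed.

Fixpoint psum (N : nat) (c : nat -> C) (z : C) : C :=
  match N with 0%nat => 0 | S n => psum n c z + c n * cpow z n end.

Definition dco (c : nat -> C) (n : nat) : C := succC n * c (S n).

Lemma psum_ext (N : nat) (c c' : nat -> C) (z : C) :
  (forall n, (n < N)%nat -> c n = c' n) -> psum N c z = psum N c' z.
Proof. induction N; simpl; intro H; auto. rewrite IHN, H; auto. Qed.

Lemma psum_plus (N : nat) (c c' : nat -> C) (z : C) :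
  psum N (fun n => c n + c' n) z = psum N c z + psum N c' z.
Proof. induction N; simpl; [ring|rewrite IHN; ring]. Qed.

Lemma psum_scal (N : nat) (k : C) (c : nat -> C) (z : C) :
  psum N (fun n => k * c n) z = k * psum N c z.
Proof. induction N; simpl; [ring|rewrite IHN; ring]. Qed.

Lemma psum_0 (N : nat) (z : C) : psum N (fun _ => 0) z = 0.
Proof. induction N; simpl; [ring|rewrite IHN; ring]. Qed.

Lemma psum_single (N : nat) (c : nat -> C) (z : C) (a : nat) :
  (a < N)%nat -> (forall n, n <> a -> c n = 0) -> psum N c z = c a * cpow z a.
Proof.
  intros Ha H. induction N as [|N IH]; [lia|]. simpl.
  destruct (Nat.eq_dec N a) as [->|Hn].
  - rewrite (psum_ext a c (fun _ => 0)), psum_0; [ring|]. intros n Hn. apply H. lia.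
  - rewrite IH, (H N) by lia. ring.
Qed.

Definition sh (c : nat -> C) (n : nat) : C := match n with 0%nat => 0 | S n => c n end.

Lemma psum_sh (N : nat) (c : nat -> C) (z : C) :
  c (pred N) = 0 -> psum N (sh c) z = z * psum N c z.
Proof.
  assert (G : forall M, psum (S M) (sh c) z = z * psum M c z).
  { induction M as [|M IH]; [simpl; ring|].
    change (psum (S (S M)) (sh c) z) with (psum (S M) (sh c) z + c M * cpow z (S M)).
    rewrite IH. simpl. ring. }
  destruct N as [|N]; intro H; [simpl; ring|]. rewrite G. simpl in *. rewrite H. ring.
Qed.

(** The coefficients may vary with the parameter, so that the rule can be nested: the coefficients
    of one variable are sums in the next. The formal derivative summed below [N] contains a term
    with the coefficient of index [N], which is why that coefficient is asked to vanish. *)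
Lemma isd_psum (N : nat) (c : R -> nat -> C) (c' : nat -> C) (z : R -> C) (z' : C) (t : R) :
  (forall n, isd (fun s => c s n) t (c' n)) -> isd z t z' -> c t N = 0 ->
  isd (fun s => psum N (c s) (z s)) t
      (psum N c' (z t) + psum N (dco (c t)) (z t) * z').
Proof.
  intros Hc Hz HN.
  assert (G : forall M, isd (fun s => psum M (c s) (z s)) t
      (psum M c' (z t) + psum (pred M) (dco (c t)) (z t) * z')).
  { induction M as [|M IH].
    - simpl. eapply isd_eq; [apply (isd_const (RtoC 0))|ring].
    - destruct M as [|M].
      + simpl. eapply isd_eq.
        * apply isd_plus; [apply (isd_const (RtoC 0))|].
          apply (isd_mult (fun s => c s 0%nat) (fun _ => RtoC 1)); [apply Hc|apply (isd_const (RtoC 1))].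
        * ring.
      + eapply isd_eq.
        * apply (isd_plus (fun s => psum (S M) (c s) (z s)) (fun s => c s (S M) * cpow (z s) (S M)));
            [apply IH|]. apply isd_mult; [apply Hc|apply isd_cpow, Hz].
        * simpl. unfold dco. ring. }
  eapply isd_eq; [apply G|]. destruct N as [|N]; simpl; auto.
  unfold dco at 3. rewrite HN. ring.
Qed.

(* [h A B C D] is the coefficient of alpha^A beta^B conj(alpha)^C conj(beta)^D; [eval N] only sees
   exponents below [N], so that [degree_lt N h] below means that nothing is truncated. *)
Definition coef2 := nat -> nat -> C.
Definition coef3 := nat -> coef2.
Definition coef := nat -> coef3.

Definition eval2 (N : nat) (h : coef2) (c d : C) : C := psum N (fun n => psum N (h n) d) c.
Definition eval3 (N : nat) (h : coef3) (b c d : C) : C := psum N (fun n => eval2 N (h n) c d) b.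
Definition eval (N : nat) (h : coef) (a b c d : C) : C := psum N (fun n => eval3 N (h n) b c d) a.

Definition evp (N : nat) (h : coef) : fn4C := fun x y z w =>
  eval N h (x, y) (z, w) (Cconj (x, y)) (Cconj (z, w)).

Definition cadd (g h : coef) : coef := fun A B C D => g A B C D + h A B C D.
Definition cscal (k : C) (h : coef) : coef := fun A B C D => k * h A B C D.

Lemma eval_ext (N : nat) (g h : coef) (a b c d : C) :
  (forall A B C D, g A B C D = h A B C D) -> eval N g a b c d = eval N h a b c d.
Proof.
  intro H. unfold eval, eval3, eval2.
  repeat (apply psum_ext; intros). apply H.
Qed.

Lemma eval2_plus N (g h : coef2) c d :
  eval2 N (fun A B => g A B + h A B) c d = eval2 N g c d + eval2 N h c d.
Proof.
  unfold eval2. rewrite <- psum_plus. apply psum_ext; intros. apply psum_plus.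
Qed.

Lemma eval3_plus N (g h : coef3) b c d :
  eval3 N (fun A B C => g A B C + h A B C) b c d = eval3 N g b c d + eval3 N h b c d.
Proof.
  unfold eval3. rewrite <- psum_plus. apply psum_ext; intros. apply (eval2_plus N (g n) (h n)).
Qed.

Lemma eval_plus N (g h : coef) a b c d :
  eval N (cadd g h) a b c d = eval N g a b c d + eval N h a b c d.
Proof.
  unfold eval, cadd. rewrite <- psum_plus. apply psum_ext; intros. apply (eval3_plus N (g n) (h n)).
Qed.

Lemma eval2_scal N k (h : coef2) c d :
  eval2 N (fun A B => k * h A B) c d = k * eval2 N h c d.
Proof.
  unfold eval2. rewrite <- psum_scal. apply psum_ext; intros. apply psum_scal.
Qed.

Lemma eval3_scal N k (h : coef3) b c d :
  eval3 N (fun A B C => k * h A B C) b c d = k * eval3 N h b c d.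
Proof.
  unfold eval3. rewrite <- psum_scal. apply psum_ext; intros. apply (eval2_scal N k (h n)).
Qed.

Lemma eval_scal N k (h : coef) a b c d :
  eval N (cscal k h) a b c d = k * eval N h a b c d.
Proof.
  unfold eval, cscal. rewrite <- psum_scal. apply psum_ext; intros. apply (eval3_scal N k (h n)).
Qed.

Definition dA (h : coef) : coef := fun A B C D => succC A * h (S A) B C D.
Definition dB (h : coef) : coef := fun A B C D => succC B * h A (S B) C D.
Definition dC (h : coef) : coef := fun A B C D => succC C * h A B (S C) D.
Definition dD (h : coef) : coef := fun A B C D => succC D * h A B C (S D).

Definition degree_lt (N : nat) (h : coef) : Prop :=
  forall A B C D, (N <= A + B + C + D)%nat -> h A B C D = 0.

Lemma eval2_zero N (h : coef2) c d : (forall A B, h A B = 0) -> eval2 N h c d = 0.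
Proof.
  intro H. unfold eval2. rewrite (psum_ext N _ (fun _ => 0)); [apply psum_0|].
  intros. rewrite (psum_ext N _ (fun _ => 0)); [apply psum_0|]. auto.
Qed.

Lemma eval3_zero N (h : coef3) b c d : (forall A B C, h A B C = 0) -> eval3 N h b c d = 0.
Proof.
  intro H. unfold eval3. rewrite (psum_ext N _ (fun _ => 0)); [apply psum_0|].
  intros. apply eval2_zero. auto.
Qed.

Lemma isd_eval2 N (h : coef2) (c d : R -> C) t c' d' :
  (forall A B, (N <= A + B)%nat -> h A B = 0) -> isd c t c' -> isd d t d' ->
  isd (fun s => eval2 N h (c s) (d s)) t
   (eval2 N (fun A B => succC A * h (S A) B) (c t) (d t) * c'
    + eval2 N (fun A B => succC B * h A (S B)) (c t) (d t) * d').
Proof.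
  intros Hb Hc Hd. unfold eval2. eapply isd_eq.
  - apply (isd_psum N (fun s n => psum N (h n) (d s))
      (fun n => psum N (fun _ => 0) (d t) + psum N (dco (h n)) (d t) * d') c c').
    + intro n. apply (isd_psum N (fun _ => h n) (fun _ => 0) d d').
      * intro. apply isd_const.
      * apply Hd.
      * apply Hb. lia.
    + apply Hc.
    + rewrite (psum_ext N _ (fun _ => 0)); [apply psum_0|]. intros. apply Hb. lia.
  - rewrite (psum_ext N _ (fun n => d' * psum N (dco (h n)) (d t))).
    2: { intros. rewrite psum_0. ring. }
    rewrite psum_scal.
    rewrite (psum_ext N (dco _) (fun n => psum N (fun B => succC n * h (S n) B) (d t))).
    2: { intros. unfold dco. rewrite psum_scal. reflexivity. }
    unfold dco. ring.
Qed.

Lemma isd_eval3 N (h : coef3) (b c d : R -> C) t b' c' d' :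
  (forall A B C, (N <= A + B + C)%nat -> h A B C = 0) -> isd b t b' -> isd c t c' -> isd d t d' ->
  isd (fun s => eval3 N h (b s) (c s) (d s)) t
   (eval3 N (fun A B C => succC A * h (S A) B C) (b t) (c t) (d t) * b'
    + eval3 N (fun A B C => succC B * h A (S B) C) (b t) (c t) (d t) * c'
    + eval3 N (fun A B C => succC C * h A B (S C)) (b t) (c t) (d t) * d').
Proof.
  intros Hb Hb' Hc Hd. unfold eval3. eapply isd_eq.
  - apply (isd_psum N (fun s n => eval2 N (h n) (c s) (d s))
      (fun n => eval2 N (fun A B => succC A * h n (S A) B) (c t) (d t) * c'
        + eval2 N (fun A B => succC B * h n A (S B)) (c t) (d t) * d') b b').
    + intro n. apply (isd_eval2 N (h n)); auto. intros. apply Hb. lia.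
    + apply Hb'.
    + apply eval2_zero. intros. apply Hb. lia.
  - rewrite (psum_ext N _ (fun n => c' * eval2 N (fun A B => succC A * h n (S A) B) (c t) (d t)
        + d' * eval2 N (fun A B => succC B * h n A (S B)) (c t) (d t))).
    2: { intros. ring. }
    rewrite psum_plus, !psum_scal.
    rewrite (psum_ext N (dco _) (fun n => eval2 N (fun A B => succC n * h (S n) A B) (c t) (d t))).
    2: { intros. unfold dco. rewrite eval2_scal. reflexivity. }
    ring.
Qed.

Lemma isd_eval N (h : coef) (a b c d : R -> C) t a' b' c' d' :
  degree_lt N h -> isd a t a' -> isd b t b' -> isd c t c' -> isd d t d' ->
  isd (fun s => eval N h (a s) (b s) (c s) (d s)) t
   (eval N (dA h) (a t) (b t) (c t) (d t) * a'
    + eval N (dB h) (a t) (b t) (c t) (d t) * b'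
    + eval N (dC h) (a t) (b t) (c t) (d t) * c'
    + eval N (dD h) (a t) (b t) (c t) (d t) * d').
Proof.
  intros Hb Ha Hb' Hc Hd. unfold eval. eapply isd_eq.
  - apply (isd_psum N (fun s n => eval3 N (h n) (b s) (c s) (d s))
      (fun n => eval3 N (fun A B C => succC A * h n (S A) B C) (b t) (c t) (d t) * b'
        + eval3 N (fun A B C => succC B * h n A (S B) C) (b t) (c t) (d t) * c'
        + eval3 N (fun A B C => succC C * h n A B (S C)) (b t) (c t) (d t) * d') a a').
    + intro n. apply (isd_eval3 N (h n)); auto. intros. apply Hb. lia.
    + apply Ha.
    + apply eval3_zero. intros. apply Hb. lia.
  - rewrite (psum_ext N _ (fun n =>
        b' * eval3 N (fun A B C => succC A * h n (S A) B C) (b t) (c t) (d t)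
        + (c' * eval3 N (fun A B C => succC B * h n A (S B) C) (b t) (c t) (d t)
        + d' * eval3 N (fun A B C => succC C * h n A B (S C)) (b t) (c t) (d t)))).
    2: { intros. ring. }
    rewrite !psum_plus, !psum_scal.
    rewrite (psum_ext N (dco _) (fun n => eval3 N (fun A B C => succC n * h (S n) A B C) (b t) (c t) (d t))).
    2: { intros. unfold dco. rewrite eval3_scal. reflexivity. }
    unfold dA, dB, dC, dD. ring.
Qed.

(** With conjugates as independent variables, d/dx is the sum of the derivatives in alpha and
    conj(alpha), and d/dy is [i] times their difference; likewise for z, w and beta. *)
Definition pdc (i : nat) (h : coef) : coef :=
  match i with
  | 0%nat => cadd (dA h) (dC h)
  | 1%nat => cscal Ci (cadd (dA h) (cscal (-(1)) (dC h)))
  | 2%nat => cadd (dB h) (dD h)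
  | _ => cscal Ci (cadd (dB h) (cscal (-(1)) (dD h)))
  end.

Lemma degree_lt_pdc N i h : degree_lt N h -> degree_lt N (pdc i h).
Proof.
  intros H A B C D Hl. dix i; unfold pdc, cadd, cscal, dA, dB, dC, dD;
    rewrite !H by lia; ring.
Qed.

Lemma isd_evp N h x y z w : degree_lt N h ->
  isd (fun t => evp N h t y z w) x (evp N (pdc 0 h) x y z w) /\
  isd (fun t => evp N h x t z w) y (evp N (pdc 1 h) x y z w) /\
  isd (fun t => evp N h x y t w) z (evp N (pdc 2 h) x y z w) /\
  isd (fun t => evp N h x y z t) w (evp N (pdc 3 h) x y z w).
Proof.
  intro Hb. unfold evp, pdc.
  assert (E : forall h' : coef, forall a b c d a1 b1 c1 d1 r,
    eval N (dA h') a b c d * a1 + eval N (dB h') a b c d * b1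
     + eval N (dC h') a b c d * c1 + eval N (dD h') a b c d * d1 = r ->
    forall f t, isd f t (eval N (dA h') a b c d * a1 + eval N (dB h') a b c d * b1
     + eval N (dC h') a b c d * c1 + eval N (dD h') a b c d * d1) -> isd f t r).
  { intros; subst; auto. }
  assert (Hid : forall f t a b, is_derive (fun s => fst (f s)) t a ->
     is_derive (fun s => snd (f s)) t b -> isd f t (a, b)).
  { intros; split; assumption. }
  split; [|split; [|split]].
  - eapply E; [|apply (isd_eval N h (fun t => (t, y)) (fun _ => (z, w)) (fun t => Cconj (t, y))
      (fun _ => Cconj (z, w)) x (1, 0)%R (0, 0)%R (1, 0)%R (0, 0)%R Hb);
      apply Hid; simpl; auto_derive; auto; ring].
    rewrite eval_plus. unfold Cplus, Cmult; simpl. apply injective_projections; simpl; ring.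
  - eapply E; [|apply (isd_eval N h (fun t => (x, t)) (fun _ => (z, w)) (fun t => Cconj (x, t))
      (fun _ => Cconj (z, w)) y (0, 1)%R (0, 0)%R (0, -1)%R (0, 0)%R Hb);
      apply Hid; simpl; auto_derive; auto; ring].
    rewrite eval_scal, eval_plus, eval_scal. apply injective_projections; simpl; ring.
  - eapply E; [|apply (isd_eval N h (fun _ => (x, y)) (fun t => (t, w)) (fun t => Cconj (x, y))
      (fun t => Cconj (t, w)) z (0, 0)%R (1, 0)%R (0, 0)%R (1, 0)%R Hb);
      apply Hid; simpl; auto_derive; auto; ring].
    rewrite eval_plus. apply injective_projections; simpl; ring.
  - eapply E; [|apply (isd_eval N h (fun _ => (x, y)) (fun t => (z, t)) (fun t => Cconj (x, y))
      (fun t => Cconj (z, t)) w (0, 0)%R (0, 1)%R (0, 0)%R (0, -1)%R Hb);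
      apply Hid; simpl; auto_derive; auto; ring].
    rewrite eval_scal, eval_plus, eval_scal. apply injective_projections; simpl; ring.
Qed.

Open Scope C_scope.

Lemma fn4_ext {T : Type} (f g : R -> R -> R -> R -> T) :
  (forall x y z w, f x y z w = g x y z w) -> f = g.
Proof. intro H. repeat (apply functional_extensionality; intro). apply H. Qed.

Lemma pd_evp N h i : degree_lt N h ->
  pd i (ReF (evp N h)) = ReF (evp N (pdc i h)) /\ pd i (ImF (evp N h)) = ImF (evp N (pdc i h)).
Proof.
  intro Hb. split; apply fn4_ext; intros x y z w;
  destruct (isd_evp N h x y z w Hb) as [[? ?] [[? ?] [[? ?] [? ?]]]];
  dix i; simpl; apply is_derive_unique; assumption.
Qed.

Lemma pdC_evp N h i : degree_lt N h -> pdC i (evp N h) = evp N (pdc i h).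
Proof.
  intro Hb. destruct (pd_evp N h i Hb) as [E1 E2]. unfold pdC. rewrite E1, E2.
  apply fn4_ext; intros. unfold ReF, ImF. rewrite <- surjective_pairing. reflexivity.
Qed.

Lemma evp_ext N g h :
  (forall A B C D, g A B C D = h A B C D) -> evp N g = evp N h.
Proof. intro H. apply fn4_ext; intros. apply eval_ext, H. Qed.

Lemma evp_plus N g h x y z w : evp N (cadd g h) x y z w = evp N g x y z w + evp N h x y z w.
Proof. apply eval_plus. Qed.

Lemma evp_scal N k h x y z w : evp N (cscal k h) x y z w = k * evp N h x y z w.
Proof. apply eval_scal. Qed.

Lemma Ci_sqr : Ci * Ci = -(1).
Proof. unfold Ci. apply injective_projections; simpl; ring. Qed.

Lemma half_C : RtoC (1 / 2) * 2 = 1.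
Proof. apply injective_projections; simpl; field. Qed.

Lemma wirtinger_holo (p q : C) :
  RtoC (1 / 2) * ((p + q) + - Ci * (Ci * (p + - (1) * q))) = p.
Proof.
  replace ((p + q) + - Ci * (Ci * (p + - (1) * q))) with ((p + q) - (Ci * Ci) * (p - q)) by ring.
  rewrite Ci_sqr. replace ((p + q) - - (1) * (p - q)) with (2 * p) by ring.
  rewrite Cmult_assoc, half_C. ring.
Qed.

Lemma wirtinger_anti (p q : C) :
  RtoC (1 / 2) * ((p + q) + Ci * (Ci * (p + - (1) * q))) = q.
Proof.
  replace ((p + q) + Ci * (Ci * (p + - (1) * q))) with ((p + q) + (Ci * Ci) * (p - q)) by ring.
  rewrite Ci_sqr. replace ((p + q) + - (1) * (p - q)) with (2 * q) by ring.
  rewrite Cmult_assoc, half_C. ring.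
Qed.

Lemma evp_dA N h x y z w : 
  evp N (dA h) x y z w = RtoC (1 / 2) * (evp N (pdc 0 h) x y z w - Ci * evp N (pdc 1 h) x y z w).
Proof.
  rewrite (evp_ext N (dA h) (cscal (RtoC (1 / 2)) (cadd (pdc 0 h) (cscal (- Ci) (pdc 1 h))))).
  - rewrite evp_scal, evp_plus, evp_scal. ring.
  - intros. symmetry. apply wirtinger_holo.
Qed.

Lemma evp_dC N h x y z w : 
  evp N (dC h) x y z w = RtoC (1 / 2) * (evp N (pdc 0 h) x y z w + Ci * evp N (pdc 1 h) x y z w).
Proof.
  rewrite (evp_ext N (dC h) (cscal (RtoC (1 / 2)) (cadd (pdc 0 h) (cscal Ci (pdc 1 h))))).
  - rewrite evp_scal, evp_plus, evp_scal. ring.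
  - intros. symmetry. apply wirtinger_anti.
Qed.

Lemma evp_dB N h x y z w : 
  evp N (dB h) x y z w = RtoC (1 / 2) * (evp N (pdc 2 h) x y z w - Ci * evp N (pdc 3 h) x y z w).
Proof.
  rewrite (evp_ext N (dB h) (cscal (RtoC (1 / 2)) (cadd (pdc 2 h) (cscal (- Ci) (pdc 3 h))))).
  - rewrite evp_scal, evp_plus, evp_scal. ring.
  - intros. symmetry. apply wirtinger_holo.
Qed.

Lemma evp_dD N h x y z w : 
  evp N (dD h) x y z w = RtoC (1 / 2) * (evp N (pdc 2 h) x y z w + Ci * evp N (pdc 3 h) x y z w).
Proof.
  rewrite (evp_ext N (dD h) (cscal (RtoC (1 / 2)) (cadd (pdc 2 h) (cscal Ci (pdc 3 h))))).
  - rewrite evp_scal, evp_plus, evp_scal. ring.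
  - intros. symmetry. apply wirtinger_anti.
Qed.

Lemma d_alpha_evp N h : degree_lt N h -> d_alpha (evp N h) = evp N (dA h).
Proof.
  intro Hb. apply fn4_ext; intros. unfold d_alpha. rewrite !pdC_evp by auto.
  symmetry. apply evp_dA.
Qed.

Lemma d_beta_evp N h : degree_lt N h -> d_beta (evp N h) = evp N (dB h).
Proof.
  intro Hb. apply fn4_ext; intros. unfold d_beta. rewrite !pdC_evp by auto.
  symmetry. apply evp_dB.
Qed.

Definition shA (h : coef) : coef := fun A B C D =>
  match A with 0%nat => RtoC 0 | S n => h n B C D end.
Definition shB (h : coef) : coef := fun A B C D =>
  match B with 0%nat => RtoC 0 | S n => h A n C D end.
Definition shC (h : coef) : coef := fun A B C D =>
  match C with 0%nat => RtoC 0 | S n => h A B n D end.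
Definition shD (h : coef) : coef := fun A B C D =>
  match D with 0%nat => RtoC 0 | S n => h A B C n end.

Lemma eval_sh N h a b c d : degree_lt (pred N) h ->
  eval N (shA h) a b c d = a * eval N h a b c d /\
  eval N (shB h) a b c d = b * eval N h a b c d /\
  eval N (shC h) a b c d = c * eval N h a b c d /\
  eval N (shD h) a b c d = d * eval N h a b c d.
Proof.
  intro Hb. unfold eval. split; [|split; [|split]].
  - rewrite <- psum_sh.
    + apply psum_ext. intros [|n] _; simpl; auto. apply eval3_zero. auto.
    + apply eval3_zero. intros. apply Hb. lia.
  - rewrite <- psum_scal. apply psum_ext. intros A _. unfold eval3. rewrite <- psum_sh.
    + apply psum_ext. intros [|n] _; simpl; auto. apply eval2_zero. auto.
    + apply eval2_zero. intros. apply Hb. lia.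
  - rewrite <- psum_scal. apply psum_ext. intros A _. unfold eval3.
    rewrite <- psum_scal. apply psum_ext. intros B _. unfold eval2. rewrite <- psum_sh.
    + apply psum_ext. intros [|n] _; simpl; auto. apply psum_0.
    + rewrite (psum_ext N _ (fun _ => 0)); [apply psum_0|]. intros. apply Hb. lia.
  - rewrite <- psum_scal. apply psum_ext. intros A _. unfold eval3.
    rewrite <- psum_scal. apply psum_ext. intros B _. unfold eval2.
    rewrite <- psum_scal. apply psum_ext. intros C _. rewrite <- psum_sh; auto.
    apply Hb. lia.
Qed.

Definition tw (h : coef) : coef := cadd (cscal (-(1)) (shD (dA h))) (shC (dB h)).

Lemma twist_evp N h : degree_lt N h -> twist_minus (evp N h) = evp N (tw h).
Proof.
  intro Hb. apply fn4_ext; intros x y z w. unfold twist_minus.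
  rewrite d_alpha_evp, d_beta_evp by auto. unfold tw. rewrite evp_plus, evp_scal.
  assert (HA : degree_lt (pred N) (dA h)). { intros A B C D Hl. unfold dA. rewrite Hb by lia. ring. }
  assert (HB : degree_lt (pred N) (dB h)). { intros A B C D Hl. unfold dB. rewrite Hb by lia. ring. }
  unfold evp. rewrite (proj2 (proj2 (proj2 (eval_sh N (dA h) _ _ _ _ HA)))).
  rewrite (proj1 (proj2 (proj2 (eval_sh N (dB h) _ _ _ _ HB)))). ring.
Qed.

(** * Coefficients of the siblings *)

Definition factR (n : nat) : R := INR (fact n).

Lemma factR_neq n : factR n <> 0%R.
Proof. apply not_0_INR, fact_neq_0. Qed.

Lemma factR_S n : factR (S n) = (INR (S n) * factR n)%R.
Proof. unfold factR. rewrite <- mult_INR. reflexivity. Qed.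

Definition sib_on (a b j A B C D : nat) : bool :=
  ((A + D =? a)%nat && (B + C =? b)%nat && (C + D =? j)%nat)%bool.

(** The twist is a derivation sending alpha to -conj(beta), beta to conj(alpha), and both conjugates
    to 0. In the Leibniz expansion of its [j]-th power on alpha^a beta^b, the term with [D] twists
    on alpha^a and [C] on beta^b has the binomial factor [j!/(C! D!)], the sign [(-1)^D], and the
    falling factorials [a!/A!] and [b!/B!]. *)
Definition sib_val (a b A B C D : nat) : R :=
  ((-1) ^ D * factR (C + D) / (factR C * factR D) * (factR a * factR b / (factR A * factR B)))%R.

(* Coefficients of twist_-^j (alpha^a beta^b). *)
Definition sibc (a b j : nat) : coef := fun A B C D =>
  if sib_on a b j A B C D then RtoC (sib_val a b A B C D) else 0.

Lemma sib_on_iff a b j A B C D :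
  sib_on a b j A B C D = true <-> (A + D = a /\ B + C = b /\ C + D = j)%nat.
Proof.
  unfold sib_on. rewrite !Bool.andb_true_iff, !Nat.eqb_eq. tauto.
Qed.

Lemma sibc_on a b j A B C D :
  (A + D = a)%nat -> (B + C = b)%nat -> (C + D = j)%nat ->
  sibc a b j A B C D = RtoC (sib_val a b A B C D).
Proof.
  intros H1 H2 H3. unfold sibc.
  replace (sib_on a b j A B C D) with true; auto. symmetry. apply sib_on_iff; auto.
Qed.

Lemma sibc_off a b j A B C D :
  ~ (A + D = a /\ B + C = b /\ C + D = j)%nat -> sibc a b j A B C D = 0.
Proof.
  intro H. unfold sibc. destruct (sib_on a b j A B C D) eqn:E; auto.
  apply sib_on_iff in E. tauto.
Qed.

Lemma sib_val_neq a b A B C D : sib_val a b A B C D <> 0%R.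
Proof.
  unfold sib_val. repeat (apply Rmult_integral_contrapositive_currified || apply Rinv_neq_0_compat
    || apply factR_neq || (apply pow_nonzero; lra)).
Qed.

Lemma degree_lt_sibc a b j : degree_lt (S (a + b)) (sibc a b j).
Proof. intros A B C D Hl. apply sibc_off. lia. Qed.

Lemma tw_sibc a b j A B C D : tw (sibc a b j) A B C D = sibc a b (S j) A B C D.
Proof.
  unfold tw, cadd, cscal, shD, shC, dA, dB.
  destruct (classic (A + D = a /\ B + C = b /\ C + D = S j)%nat) as [[H1 [H2 H3]]|H].
  - rewrite (sibc_on a b (S j)) by auto.
    (* Since [C + D = S j], not both vanish. If one does, a single term of the twist survives;
       otherwise the two terms add up by Pascal's rule. *)
    destruct C as [|C], D as [|D]; cbv beta iota; [lia| | |].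
    + rewrite sibc_on by lia. unfold succC, sib_val.
      rewrite !factR_S. simpl (0 + _)%nat. rewrite !factR_S. simpl pow.
      pose proof (factR_neq A). pose proof (factR_neq B). pose proof (factR_neq D).
      pose proof (factR_neq 0).
      pose proof (not_0_INR (S A) (Nat.neq_succ_0 A)). pose proof (not_0_INR (S D) (Nat.neq_succ_0 D)).
      rewrite <- RtoC_mult. rewrite <- RtoC_opp, <- RtoC_mult, <- RtoC_plus. f_equal. field. tauto.
    + rewrite sibc_on by lia. unfold succC, sib_val. rewrite !Nat.add_0_r.
      rewrite !factR_S. 
      pose proof (factR_neq A). pose proof (factR_neq B). pose proof (factR_neq C).
      pose proof (factR_neq 0).
      pose proof (not_0_INR (S B) (Nat.neq_succ_0 B)). pose proof (not_0_INR (S C) (Nat.neq_succ_0 C)).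
      rewrite <- RtoC_mult. rewrite <- RtoC_opp, <- RtoC_mult, <- RtoC_plus. f_equal. field. tauto.
    + rewrite !sibc_on by lia. unfold succC, sib_val.
      replace (S C + S D)%nat with (S (S C + D)) by lia.
      replace (C + S D)%nat with (S C + D)%nat by lia.
      rewrite (factR_S (S C + D)), !(factR_S A), !(factR_S B), !(factR_S C), !(factR_S D). simpl pow.
      replace (INR (S (S C + D))) with (INR (S C) + INR (S D))%R
        by (rewrite <- plus_INR; f_equal; lia).
      pose proof (factR_neq A). pose proof (factR_neq B). pose proof (factR_neq C). pose proof (factR_neq D).
      pose proof (not_0_INR (S A) (Nat.neq_succ_0 A)). pose proof (not_0_INR (S D) (Nat.neq_succ_0 D)).
      pose proof (not_0_INR (S B) (Nat.neq_succ_0 B)). pose proof (not_0_INR (S C) (Nat.neq_succ_0 C)).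
      rewrite <- !RtoC_mult, <- !RtoC_opp, <- !RtoC_mult, <- RtoC_plus. f_equal.
      generalize dependent (INR (S A)). generalize dependent (INR (S B)).
      generalize dependent (INR (S C)). generalize dependent (INR (S D)).
      intros. field. tauto.
  - rewrite (sibc_off a b (S j)) by auto.
    destruct C as [|C], D as [|D]; rewrite ?sibc_off by lia; ring.
Qed.

Lemma monomial_evp a b : monomial a b = evp (S (a + b)) (sibc a b 0).
Proof.
  apply fn4_ext; intros. unfold monomial, evp, eval.
  rewrite (psum_single _ _ _ a); [|lia|].
  - unfold eval3. rewrite (psum_single _ _ _ b); [|lia|].
    + unfold eval2. rewrite (psum_single _ _ _ 0); [|lia|].
      * rewrite (psum_single _ _ _ 0); [|lia|].
        -- rewrite sibc_on by lia. unfold sib_val.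
           replace (_ * _)%R with 1%R.
           ++ simpl. ring.
           ++ simpl. pose proof (factR_neq a). pose proof (factR_neq b).
              change (factR 0) with 1%R.
              field. tauto.
        -- intros. apply sibc_off. lia.
      * intros. rewrite (psum_ext _ _ (fun _ => 0)); [apply psum_0|]. intros. apply sibc_off. lia.
    + intros. apply eval2_zero. intros. apply sibc_off. lia.
  - intros. apply eval3_zero. intros. apply sibc_off. lia.
Qed.

Lemma sibling_evp a b j : sibling j (monomial a b) = evp (S (a + b)) (sibc a b j).
Proof.
  induction j as [|j IH]; [apply monomial_evp|].
  unfold sibling in *. simpl. rewrite IH, twist_evp by apply degree_lt_sibc.
  apply evp_ext, tw_sibc.
Qed.

(** * Independence of monomials and restriction to the sphere *)

Lemma eval_at_0 N h : (0 < N)%nat -> evp N h 0 0 0 0 = h 0%nat 0%nat 0%nat 0%nat.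
Proof.
  assert (G : forall M c, psum (S M) c (0, 0)%R = c 0%nat).
  { induction M as [|M IH]; intro c; [simpl; ring|].
    change (psum (S M) c (0, 0)%R + c (S M) * cpow (0, 0)%R (S M) = c 0%nat).
    rewrite IH. simpl. replace (0, 0)%R with (RtoC 0) by reflexivity. ring. }
  intro HN. destruct N as [|N]; [lia|].
  unfold evp. replace (Cconj (0, 0)%R) with (0, 0)%R
    by (unfold Cconj; simpl; rewrite Ropp_0; reflexivity).
  unfold eval. rewrite G. unfold eval3. rewrite G. unfold eval2. rewrite G, G. reflexivity.
Qed.

Lemma pdC_zero i x y z w : pdC i (fun _ _ _ _ => 0) x y z w = 0.
Proof.
  unfold pdC. apply injective_projections; dix i; simpl; apply (Derive_const 0).
Qed.

(** All derivatives of the zero function vanish, so formal derivatives lower any coefficient to a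
    constant term, which is the value at the origin. Each step only multiplies by a nonzero
    integer. *)
Lemma evp_independent N h : degree_lt N h ->
  (forall x y z w, evp N h x y z w = 0) -> forall A B C D, h A B C D = 0.
Proof.
  intros Hb Hz A B C D.
  destruct N as [|N]; [apply Hb; lia|].
  assert (G : forall n h A B C D, (A + B + C + D = n)%nat -> degree_lt (S N) h ->
    (forall x y z w, evp (S N) h x y z w = 0) -> h A B C D = 0).
  { clear. induction n as [|n IH]; intros h A B C D Hn Hb Hz.
    - destruct A, B, C, D; try (simpl in Hn; lia). rewrite <- (eval_at_0 (S N) h) by lia. apply Hz.
    - assert (Hp : forall i x y z w, evp (S N) (pdc i h) x y z w = 0).
      { intros. rewrite <- pdC_evp by auto.
        replace (evp (S N) h) with (fun _ _ _ _ : R => RtoC 0)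
          by (apply fn4_ext; intros; symmetry; apply Hz). apply pdC_zero. }
      assert (HA : forall g, degree_lt (S N) g -> (forall x y z w, evp (S N) g x y z w = 0) ->
        forall A B C D, (A + B + C + D = n)%nat -> g A B C D = 0) by (intros; eapply IH; eauto).
      assert (Hdiv : forall m (c : Complex.C), succC m * c = 0 -> c = 0).
      { intros m c E. pose proof (succC_neq m) as Hs.
        replace c with (/ succC m * (succC m * c)) by (field; auto). rewrite E. ring. }
      destruct A as [|A].
      + destruct B as [|B].
        * destruct C as [|C].
          -- destruct D as [|D]; [simpl in Hn; lia|].
             apply (Hdiv D). change (dD h 0%nat 0%nat 0%nat D = 0). apply HA; [| |lia].
             ++ intros ? ? ? ? ?. unfold dD. rewrite Hb by lia. ring.
             ++ intros. rewrite evp_dD, !Hp. ring.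
          -- apply (Hdiv C). change (dC h 0%nat 0%nat C D = 0). apply HA; [| |lia].
             ++ intros ? ? ? ? ?. unfold dC. rewrite Hb by lia. ring.
             ++ intros. rewrite evp_dC, !Hp. ring.
        * apply (Hdiv B). change (dB h 0%nat B C D = 0). apply HA; [| |lia].
          ++ intros ? ? ? ? ?. unfold dB. rewrite Hb by lia. ring.
          ++ intros. rewrite evp_dB, !Hp. ring.
      + apply (Hdiv A). change (dA h A B C D = 0). apply HA; [| |lia].
        ++ intros ? ? ? ? ?. unfold dA. rewrite Hb by lia. ring.
        ++ intros. rewrite evp_dA, !Hp. ring. }
  eapply G; eauto.
Qed.

Definition rescale (u v u' v' : C) (h : coef) : coef := fun A B C D =>
  cpow u A * cpow v B * cpow u' C * cpow v' D * h A B C D.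

Lemma cpow_mult u v n : cpow (u * v) n = cpow u n * cpow v n.
Proof. induction n; simpl; [ring|rewrite IHn; ring]. Qed.

Lemma psum_rescale N k c z : psum N c (k * z) = psum N (fun n => cpow k n * c n) z.
Proof. induction N; simpl; auto. rewrite IHN, cpow_mult. ring. Qed.

Lemma eval_rescale N h u v u' v' a b c d :
  eval N h (u * a) (v * b) (u' * c) (v' * d) = eval N (rescale u v u' v' h) a b c d.
Proof.
  unfold eval. rewrite psum_rescale. apply psum_ext. intros A _.
  unfold eval3. rewrite psum_rescale, <- psum_scal. apply psum_ext. intros B _.
  unfold eval2. rewrite psum_rescale, <- !psum_scal. apply psum_ext. intros C _.
  rewrite psum_rescale, <- !psum_scal. apply psum_ext. intros D _.
  unfold rescale. ring.
Qed.

Definition homog (m : nat) (h : coef) : Prop :=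
  forall A B C D, (A + B + C + D <> m)%nat -> h A B C D = 0.

Lemma homog_degree_lt m N h : homog m h -> (m < N)%nat -> degree_lt N h.
Proof. intros H Hm A B C D Hl. apply H. lia. Qed.

Lemma cpow_add u m n : cpow u (m + n) = cpow u m * cpow u n.
Proof. induction m; simpl; [ring|rewrite IHm; ring]. Qed.

Lemma cpow_RtoC (r : R) n : cpow (RtoC r) n = RtoC (r ^ n).
Proof. induction n; simpl; auto. rewrite IHn, <- RtoC_mult. reflexivity. Qed.

Lemma evp_homog N m h (r x y z w : R) : homog m h ->
  evp N h (r * x)%R (r * y)%R (r * z)%R (r * w)%R = RtoC (r ^ m) * evp N h x y z w.
Proof.
  intro H. unfold evp.
  assert (E : forall a b, (r * a, r * b)%R = RtoC r * (a, b)).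
  { intros. apply injective_projections; simpl; ring. }
  assert (E' : forall a b, Cconj (r * a, r * b)%R = RtoC r * Cconj (a, b)).
  { intros. apply injective_projections; simpl; ring. }
  rewrite !E', !E, eval_rescale, <- eval_scal. apply eval_ext. intros. unfold rescale, cscal.
  destruct (Nat.eq_dec (A + B + C + D) m) as [<-|Hn].
  - rewrite <- cpow_RtoC, !cpow_add. ring.
  - rewrite H by auto. ring.
Qed.

(** Homogeneity spreads vanishing from the sphere to R^4. It has to be assumed: |alpha|^2 + |beta|^2
    - 1 vanishes on the sphere. *)
Lemma evp_sphere_zero N m h : homog m h -> (m < N)%nat ->
  (forall x y z w, onS3 x y z w -> evp N h x y z w = 0) -> forall A B C D, h A B C D = 0.
Proof.
  intros Hh Hm Hz. apply (evp_independent N); [eapply homog_degree_lt; eauto|].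
  intros x y z w. set (r := sqrt (x * x + y * y + z * z + w * w)).
  assert (Hrr : (r * r = x * x + y * y + z * z + w * w)%R) by (apply sqrt_sqrt; nra).
  destruct (Req_dec r 0) as [H0|H0].
  - assert (x = 0 /\ y = 0 /\ z = 0 /\ w = 0)%R as [-> [-> [-> ->]]].
    { rewrite H0 in Hrr. repeat split; nra. }
    (* The origin is written as 0 times the sphere point (1, 0, 0, 0), so homogeneity covers it too,
       in degree 0 as well. *)
    replace 0%R with (0 * 1)%R at 1 by ring. replace 0%R with (0 * 0)%R at 2 3 4 by ring.
    rewrite (evp_homog N m) by auto. rewrite Hz; [ring|]. unfold onS3. ring.
  - replace x with (r * (x / r))%R by (field; auto). replace y with (r * (y / r))%R by (field; auto).
    replace z with (r * (z / r))%R by (field; auto). replace w with (r * (w / r))%R by (field; auto).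
    rewrite (evp_homog N m) by auto. rewrite Hz; [ring|]. unfold onS3.
    replace (x / r * (x / r) + y / r * (y / r) + z / r * (z / r) + w / r * (w / r))%R
      with ((x * x + y * y + z * z + w * w) / (r * r))%R by (field; auto).
    rewrite Hrr. field. rewrite <- Hrr. nra.
Qed.

Open Scope R_scope.

(** * Functions with vanishing iterated differences *)

Fixpoint vanish (n : nat) (f : pt -> R) : Prop :=
  match n with
  | 0%nat => forall v, f v = 0
  | S m => forall i t, vanish m (diff (axis i t) f)
  end.

(** Each difference raises [j] by one until it reaches [k + 1]; continuity then carries the
    vanishing across the singular list. *)
Lemma tame_vanish (k n : nat) : forall j S f,
  (forall v, continuous f v) -> tame k j S f -> (j + n = k + 1)%nat -> vanish n f.
Proof.
  induction n as [|n IH]; intros j S f Hc T E; simpl.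
  - apply (zero_off_list f S Hc). apply (tame_zero k). replace (k + 1)%nat with j by lia. exact T.
  - intros i t. eapply (IH (j + 1)%nat); [|apply tame_diff, T|lia]. apply continuous_diff, Hc.
Qed.

Lemma vanish_plus (n : nat) : forall f g,
  vanish n f -> vanish n g -> vanish n (fun v => f v + g v).
Proof.
  induction n as [|n IH]; simpl; intros f g Hf Hg.
  - intro v. rewrite Hf, Hg. ring.
  - intros i t. replace (diff (axis i t) (fun v => f v + g v))
      with (fun v => diff (axis i t) f v + diff (axis i t) g v).
    + apply IH; auto.
    + apply functional_extensionality. intro v. unfold diff. ring.
Qed.

Lemma vanish_padd (n : nat) (u : pt) : forall f,
  vanish n f -> vanish n (fun v => f (padd v u)).
Proof.
  induction n as [|n IH]; simpl; intros f Hf; auto.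
  intros i t. replace (diff (axis i t) (fun v => f (padd v u)))
    with (fun v => diff (axis i t) f (padd v u)).
  - apply (IH (diff (axis i t) f)). auto.
  - apply functional_extensionality. intro v. unfold diff. do 2 f_equal.
    rewrite <- !padd_assoc. f_equal. apply padd_comm.
Qed.

(** A difference in an arbitrary direction telescopes into four axis differences at shifted base
    points. *)
Lemma vanish_diff (n : nat) (f : pt -> R) (h : pt) : vanish (S n) f -> vanish n (diff h f).
Proof.
  intro H. destruct h as [[[a b] c] d].
  replace (diff (a, b, c, d) f) with (fun v =>
    diff (axis 0 a) f v + (diff (axis 1 b) f (padd v (axis 0 a))
    + (diff (axis 2 c) f (padd v (padd (axis 0 a) (axis 1 b)))
    + diff (axis 3 d) f (padd v (padd (padd (axis 0 a) (axis 1 b)) (axis 2 c)))))).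
  - apply vanish_plus; [apply H|]. apply vanish_plus; [|apply vanish_plus].
    + apply (vanish_padd n (axis 0 a) (diff (axis 1 b) f)), H.
    + apply (vanish_padd n _ (diff (axis 2 c) f)), H.
    + apply (vanish_padd n _ (diff (axis 3 d) f)), H.
  - apply functional_extensionality. intro v. unfold diff.
    rewrite <- !(padd_assoc v).
    replace (padd (padd (padd (axis 0 a) (axis 1 b)) (axis 2 c)) (axis 3 d)) with (a, b, c, d).
    + ring.
    + apply pt_eq. intro i. rewrite !crd_padd. dix i; simpl; ring.
Qed.

Lemma diff_comm (g h : pt) (f : pt -> R) : diff g (diff h f) = diff h (diff g f).
Proof.
  apply functional_extensionality. intro v. unfold diff. rewrite <- !padd_assoc, (padd_comm g h). ring.
Qed.

Lemma iter_diff_comm (m : nat) (x h : pt) (f : pt -> R) :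
  diff h (Nat.iter m (diff x) f) = Nat.iter m (diff x) (diff h f).
Proof. induction m as [|m IH]; simpl; auto. rewrite diff_comm, IH. reflexivity. Qed.

Lemma vanish_iter_diff (m n : nat) (x : pt) : forall f,
  vanish (m + n) f -> vanish n (Nat.iter m (diff x) f).
Proof.
  induction m as [|m IH]; intros f H; auto. simpl. rewrite iter_diff_comm. apply IH.
  apply (vanish_diff (m + n)), H.
Qed.

Lemma continuous_iter_diff (m : nat) (x : pt) (f : pt -> R) :
  (forall v, continuous f v) -> forall v, continuous (Nat.iter m (diff x) f) v.
Proof. intro H. induction m as [|m IH]; simpl; auto. apply continuous_diff, IH. Qed.

Lemma additive_bounded_zero (e : R -> R) (B : R) :
  (forall s t, e (s + t) = e s + e t) -> (forall t, Rabs (e t) <= B) -> forall t, e t = 0.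
Proof.
  intros Ha Hb t. destruct (Req_dec (e t) 0) as [|Hn]; auto. exfalso.
  assert (Hm : forall n, e (INR n * t) = INR n * e t).
  { induction n as [|n IH].
    - assert (e 0 = 0). { specialize (Ha 0 0). rewrite Rplus_0_r in Ha. lra. }
      simpl. rewrite !Rmult_0_l. auto.
    - rewrite S_INR, !Rmult_plus_distr_r, !Rmult_1_l, Ha, IH. reflexivity. }
  apply Rabs_pos_lt in Hn. destruct (nfloor_ex ((Rabs B + 1) / Rabs (e t))) as [n Hfl].
  - left. apply Rdiv_lt_0_compat; auto. pose proof (Rabs_pos B). lra.
  - specialize (Hb (INR (S n) * t)). rewrite Hm, Rabs_mult, Rabs_pos_eq in Hb by apply pos_INR.
    rewrite S_INR in Hb. destruct Hfl as [_ Hfl].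
    apply (Rmult_lt_compat_r (Rabs (e t))) in Hfl; auto.
    replace ((Rabs B + 1) / Rabs (e t) * Rabs (e t)) with (Rabs B + 1) in Hfl by (field; lra).
    pose proof (Rle_abs B). lra.
Qed.

(** The defect [g t - t g 1] is additive and vanishes at 1, hence has period 1; being continuous it
    is bounded on one period and so everywhere, and a bounded additive function is zero. *)
Lemma additive_continuous_linear (g : R -> R) :
  (forall s t, g (s + t) = g s + g t) -> (forall t, continuous g t) -> forall t, g t = t * g 1.
Proof.
  intros Ha Hc. set (e := fun t => g t - t * g 1).
  assert (Hea : forall s t, e (s + t) = e s + e t) by (intros; unfold e; rewrite Ha; ring).
  assert (Hec : forall t, continuity_pt e t).
  { intro t. apply continuity_pt_filterlim. apply (continuous_Rminus g (fun t => t * g 1)); auto.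
    apply continuous_Rmult; [apply continuous_id|apply continuous_const]. }
  assert (He1 : e 1 = 0) by (unfold e; ring).
  assert (Hen : forall n s, e (s + INR n) = e s).
  { induction n as [|n IH]; intro s; [simpl; rewrite Rplus_0_r; auto|].
    rewrite S_INR, <- Rplus_assoc, Hea, IH, He1. ring. }
  assert (HeZ : forall z s, e (s + IZR z) = e s).
  { intros z s. destruct (Z_le_gt_dec 0 z) as [Hz|Hz].
    - rewrite <- (Z2Nat.id z), <- INR_IZR_INZ by lia. apply Hen.
    - rewrite <- (Hen (Z.to_nat (- z)) (s + IZR z)). f_equal.
      rewrite INR_IZR_INZ, Z2Nat.id, opp_IZR by lia. ring. }
  destruct (continuity_ab_maj e 0 1) as [M1 [HM1 _]]; [lra|auto|].
  destruct (continuity_ab_min e 0 1) as [M2 [HM2 _]]; [lra|auto|].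
  intro t. assert (e t = 0); [|unfold e in H; lra].
  apply (additive_bounded_zero e (Rmax (Rabs (e M1)) (Rabs (e M2))) Hea).
  intro s. rewrite <- (HeZ (- Int_part s)%Z s).
  assert (Hb : 0 <= s + IZR (- Int_part s) <= 1).
  { rewrite opp_IZR. destruct (base_Int_part s). lra. }
  specialize (HM1 _ Hb). specialize (HM2 _ Hb).
  set (y := e (s + IZR (- Int_part s))) in *.
  apply Rabs_le_between. split.
  - pose proof (Rmax_r (Rabs (e M1)) (Rabs (e M2))). pose proof (Rabs_maj2 (e M2)). lra.
  - pose proof (Rmax_l (Rabs (e M1)) (Rabs (e M2))). pose proof (Rle_abs (e M1)). lra.
Qed.

(** When second differences vanish, the first difference does not depend on the base point, hence is
    additive in its direction, and continuity makes it linear along each axis. *)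
Lemma vanish2_linear (f : pt -> R) (v : pt) :
  (forall w, continuous f w) -> vanish 2 f ->
  diff v f p0 = crd 0 v * diff (axis 0 1) f p0 + crd 1 v * diff (axis 1 1) f p0
    + crd 2 v * diff (axis 2 1) f p0 + crd 3 v * diff (axis 3 1) f p0.
Proof.
  intros Hc Hv.
  assert (Hconst : forall h w, diff h f w = diff h f p0).
  { intros h w. pose proof (vanish_diff 0 _ w (vanish_diff 1 _ h Hv) p0) as E.
    unfold diff in *. rewrite !padd_0_l in *. lra. }
  assert (Hadd : forall g h, diff (padd g h) f p0 = diff g f p0 + diff h f p0).
  { intros g h. pose proof (Hconst g h) as E. unfold diff in *. rewrite !padd_0_l in *.
    rewrite (padd_comm g h). lra. }
  assert (Hax : forall i t, diff (axis i t) f p0 = t * diff (axis i 1) f p0).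
  { intros i t. apply (additive_continuous_linear (fun t => diff (axis i t) f p0)).
    - intros s s'. rewrite <- Hadd. f_equal. dix i; simpl; repeat f_equal; ring.
    - intro s. unfold diff. apply continuous_Rminus; [|apply continuous_const].
      intros P [e He]. destruct (proj1 (continuous_near_by f _) (Hc (padd p0 (axis i s))) e (cond_pos e)) as [d [Hd H]].
      apply locally_R. exists d. split; auto. intros s' Hs'. apply He. apply H.
      intro j. rewrite !crd_padd.
      replace (crd j p0 + crd j (axis i s') - (crd j p0 + crd j (axis i s)))
        with (crd j (axis i (s' - s))) by (dix i; dix j; simpl; ring).
      eapply Rle_lt_trans; [apply crd_axis_le|auto]. }
  rewrite <- !Hax, <- !Hadd. f_equal.
  dpt v. apply pt_eq. intro i. rewrite !crd_padd. dix i; simpl; ring.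
Qed.

(** * Iterated differences as homogeneous polynomials *)

Definition hpoly (N m : nat) (f : pt -> R) : Prop :=
  exists h, homog m h /\ forall x y z w, RtoC (f (x, y, z, w)) = evp N h x y z w.

Lemma hpoly_const N (c : R) : (0 < N)%nat -> hpoly N 0 (fun _ => c).
Proof.
  intro HN.
  exists (cscal (RtoC c) (sibc 0 0 0)). split.
  - intros A B C D Hn. unfold cscal. rewrite sibc_off by lia. ring.
  - intros. rewrite evp_scal. unfold evp, eval.
    assert (E : forall A B C D : nat, (A, B, C, D) <> (0, 0, 0, 0)%nat -> sibc 0 0 0 A B C D = RtoC 0).
    { intros A B C D Hn. apply sibc_off. intro. apply Hn. repeat f_equal; lia. }
    rewrite (psum_single _ _ _ 0); [|lia|].
    + unfold eval3. rewrite (psum_single _ _ _ 0); [|lia|].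
      * unfold eval2. rewrite (psum_single _ _ _ 0); [|lia|].
        -- rewrite (psum_single _ _ _ 0); [|lia|].
           ++ rewrite sibc_on by lia. unfold sib_val. simpl.
              change (factR 0) with 1. replace (1 * 1 / (1 * 1) * (1 * 1 / (1 * 1))) with 1 by field. ring.
           ++ intros. apply E. congruence.
        -- intros. rewrite (psum_ext _ _ (fun _ => RtoC 0)); [apply psum_0|]. intros. apply E. congruence.
      * intros. apply eval2_zero. intros. apply E. congruence.
    + intros. apply eval3_zero. intros. apply E. congruence.
Qed.

Lemma hpoly_plus N m f g : hpoly N m f -> hpoly N m g -> hpoly N m (fun v => f v + g v).
Proof.
  intros [h [H1 H2]] [h' [H1' H2']]. exists (cadd h h'). split.
  - intros A B C D Hn. unfold cadd. rewrite H1, H1' by auto. ring.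
  - intros. rewrite RtoC_plus, H2, H2', evp_plus. reflexivity.
Qed.

Lemma hpoly_crd N m f i : (m + 1 < N)%nat -> hpoly N m f -> hpoly N (m + 1) (fun v => crd i v * f v).
Proof.
  intros Hm [h [H1 H2]].
  assert (Hb : degree_lt (pred N) h) by (apply (homog_degree_lt m); auto; lia).
  set (q := RtoC (1 / 2)).
  (* Real coordinates come from x = (alpha + conj(alpha))/2 and y = i (conj(alpha) - alpha)/2;
     multiplying by a variable shifts its exponent. *)
  exists (match i with
    | 0%nat => cscal q (cadd (shA h) (shC h))
    | 1%nat => cscal (q * Ci)%C (cadd (shC h) (cscal (-(1))%C (shA h)))
    | 2%nat => cscal q (cadd (shB h) (shD h))
    | _ => cscal (q * Ci)%C (cadd (shD h) (cscal (-(1))%C (shB h))) end). split.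
  - intros A B C D Hn.
    assert (shA h A B C D = RtoC 0 /\ shB h A B C D = RtoC 0 /\ shC h A B C D = RtoC 0 /\ shD h A B C D = RtoC 0)
      as [EA [EB [EC ED]]].
    { unfold shA, shB, shC, shD. repeat split; [destruct A|destruct B|destruct C|destruct D]; auto; apply H1; lia. }
    dix i; unfold cscal, cadd; rewrite ?EA, ?EB, ?EC, ?ED; ring.
  - intros. rewrite RtoC_mult, H2.
    destruct (eval_sh N h (x, y) (z, w) (Cconj (x, y)) (Cconj (z, w)) Hb) as [EA [EB [EC ED]]].
    dix i; rewrite ?evp_scal, ?evp_plus, ?evp_scal; unfold evp; rewrite ?EA, ?EB, ?EC, ?ED;
      generalize (eval N h (x, y) (z, w) (Cconj (x, y)) (Cconj (z, w))); intro K;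
      unfold q, Ci; apply injective_projections; simpl; field.
Qed.

(** The outermost of the differences acts on a function with vanishing second differences, so it is
    linear in its direction. Expanding only that one along the axes yields coordinates times
    [m]-fold differences of axis differences of [g], to which the induction applies. *)
Lemma vanish_hpoly N m : forall g,
  (m < N)%nat -> (forall v, continuous g v) -> vanish (S m) g ->
  hpoly N m (fun x => Nat.iter m (diff x) g p0).
Proof.
  induction m as [|m IH]; intros g Hm Hc Hv.
  - apply (hpoly_const N (g p0)). lia.
  - assert (Hi : forall i, hpoly N (S m) (fun x => crd i x * Nat.iter m (diff x) (diff (axis i 1) g) p0)).
    { intro i. replace (S m) with (m + 1)%nat at 1 by lia. apply hpoly_crd; [lia|]. apply IH; [lia| |].
      - apply continuous_diff, Hc.
      - apply vanish_diff, Hv. }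
    replace (fun x => Nat.iter (S m) (diff x) g p0) with (fun x =>
      crd 0 x * Nat.iter m (diff x) (diff (axis 0 1) g) p0
      + crd 1 x * Nat.iter m (diff x) (diff (axis 1 1) g) p0
      + crd 2 x * Nat.iter m (diff x) (diff (axis 2 1) g) p0
      + crd 3 x * Nat.iter m (diff x) (diff (axis 3 1) g) p0).
    + apply (hpoly_plus N (S m)); [apply (hpoly_plus N (S m)); [apply (hpoly_plus N (S m))|]|]; apply Hi.
    + apply functional_extensionality. intro x. simpl. rewrite <- !iter_diff_comm.
      symmetry. apply vanish2_linear.
      * apply continuous_iter_diff, Hc.
      * apply vanish_iter_diff. replace (m + 2)%nat with (S (S m)) by lia. exact Hv.
Qed.

Definition delta1 (g : R -> R) : R -> R := fun s => g (s + 1) - g s.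

(** A discrete Leibniz rule for multiplication by the variable; it produces the factorial in the top
    difference of a power. *)
Lemma delta1_mul_id (n : nat) (g : R -> R) (s : R) :
  Nat.iter (S n) delta1 (fun s => s * g s) s
  = s * Nat.iter (S n) delta1 g s + INR (S n) * Nat.iter n delta1 g (s + 1).
Proof.
  revert s. induction n as [|n IH]; intro s.
  - simpl. unfold delta1. ring.
  - change (Nat.iter (S (S n)) delta1 (fun s => s * g s) s)
      with (Nat.iter (S n) delta1 (fun s => s * g s) (s + 1) - Nat.iter (S n) delta1 (fun s => s * g s) s).
    rewrite !IH.
    change (Nat.iter (S (S n)) delta1 g s) with (Nat.iter (S n) delta1 g (s + 1) - Nat.iter (S n) delta1 g s).
    change (Nat.iter (S n) delta1 g (s + 1)) with (Nat.iter n delta1 g (s + 1 + 1) - Nat.iter n delta1 g (s + 1)).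
    rewrite (S_INR (S n)). ring.
Qed.

Lemma delta1_pow (k : nat) (s : R) : Nat.iter k delta1 (fun s => s ^ k) s = factR k.
Proof.
  revert s. induction k as [|k IH]; intro s; [reflexivity|].
  change (fun s : R => s ^ S k) with (fun s : R => s * s ^ k).
  rewrite (delta1_mul_id k (fun s => s ^ k)).
  change (Nat.iter (S k) delta1 (fun s => s ^ k) s)
    with (Nat.iter k delta1 (fun s => s ^ k) (s + 1) - Nat.iter k delta1 (fun s => s ^ k) s).
  rewrite !IH, factR_S. ring.
Qed.

(** On the ray through [x] the function is [s^k H(x)]. Forward differences starting at 0 visit only
    nonnegative multiples of [x], so homogeneity for [0 <= s] is enough. *)
Lemma iter_diff_homog (k : nat) (H : pt -> R) (x : pt) :
  (forall s v, 0 <= s -> H (pscal s v) = s ^ k * H v) ->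
  Nat.iter k (diff x) H p0 = factR k * H x.
Proof.
  intro Hh. rewrite <- (delta1_pow k 0).
  assert (G : forall n s, 0 <= s ->
    Nat.iter n (diff x) H (pscal s x) = Nat.iter n delta1 (fun s => s ^ k) s * H x).
  { induction n as [|n IH]; intros s Hs; [apply Hh, Hs|].
    simpl. unfold diff at 1, delta1 at 1.
    replace (padd (pscal s x) x) with (pscal (s + 1) x)
      by (apply pt_eq; intro; rewrite crd_padd, !crd_pscal; ring).
    rewrite !IH by lra. ring. }
  rewrite <- G by lra. f_equal. apply pt_eq. intro i. rewrite crd_pscal. dix i; simpl; ring.
Qed.

Lemma hpoly_scal N m (c : R) f : hpoly N m f -> hpoly N m (fun v => c * f v).
Proof.
  intros [h [H1 H2]]. exists (cscal (RtoC c) h). split.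
  - intros A B C D Hn. unfold cscal. rewrite H1 by auto. ring.
  - intros. rewrite RtoC_mult, H2, evp_scal. reflexivity.
Qed.

Lemma tame_homog_hpoly N k S (H : pt -> R) :
  (k < N)%nat -> (forall v, continuous H v) -> tame k 0 S H ->
  (forall s v, 0 <= s -> H (pscal s v) = s ^ k * H v) -> hpoly N k H.
Proof.
  intros HN Hc T Hh.
  replace H with (fun x => / factR k * Nat.iter k (diff x) H p0).
  - apply hpoly_scal, vanish_hpoly; auto. apply (tame_vanish k (Datatypes.S k) 0 S); auto. lia.
  - apply functional_extensionality. intro x. rewrite (iter_diff_homog k) by auto.
    field. apply factR_neq.
Qed.

Open Scope R_scope.

(** * Homogeneous extensions of eigenfunctions *)

Definition un4 (g : fn4R) : pt -> R := fun v => let '(x, y, z, w) := v in g x y z w.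

Lemma nonzero4_iff x y z w : nonzero4 x y z w <-> (x, y, z, w) <> p0.
Proof.
  unfold nonzero4, p0. split; intros H E; apply H.
  - inversion E; auto.
  - destruct E as [-> [-> [-> ->]]]; auto.
Qed.

Lemma is_derive_shift (g : R -> R) (x t l : R) :
  is_derive g (x + t) l -> is_derive (fun s => g (x + s)) t l.
Proof.
  intro H. replace l with (1 * l) by ring.
  apply (is_derive_comp g (fun s => x + s)); auto. auto_derive; auto.
Qed.

Lemma is_derive_line_shift (f : pt -> R) (v : pt) (i : nat) (t l : R) :
  is_derive (line f (padd v (axis i t)) i) 0 l -> is_derive (line f v i) t l.
Proof.
  intro H. replace l with (1 * l) by ring.
  apply (is_derive_ext (fun s => line f (padd v (axis i t)) i (s - t))).
  - intro s. unfold line. f_equal. apply pt_eq. intro j. rewrite !crd_padd. dix i; dix j; simpl; ring.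
  - apply (is_derive_comp (line f (padd v (axis i t)) i) (fun s => s - t)).
    + rewrite Rminus_diag. exact H.
    + auto_derive; auto; ring.
Qed.

Lemma exd_line (g : fn4R) i x y z w : exd i g x y z w ->
  is_derive (line (un4 g) (x, y, z, w) i) 0 (pd i g x y z w).
Proof.
  intro H. dix i; simpl in *; apply Derive_correct in H; unfold line; simpl.
  - apply (is_derive_ext (fun t => g (x + t) y z w)); [intro; rewrite !Rplus_0_r; auto|].
    apply (is_derive_shift (fun t => g t y z w)). rewrite Rplus_0_r. exact H.
  - apply (is_derive_ext (fun t => g x (y + t) z w)); [intro; rewrite !Rplus_0_r; auto|].
    apply (is_derive_shift (fun t => g x t z w)). rewrite Rplus_0_r. exact H.
  - apply (is_derive_ext (fun t => g x y (z + t) w)); [intro; rewrite !Rplus_0_r; auto|].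
    apply (is_derive_shift (fun t => g x y t w)). rewrite Rplus_0_r. exact H.
  - apply (is_derive_ext (fun t => g x y z (w + t))); [intro; rewrite !Rplus_0_r; auto|].
    apply (is_derive_shift (fun t => g x y z t)). rewrite Rplus_0_r. exact H.
Qed.

Lemma C2_line1 (g : fn4R) i v : C2_off0 g -> v <> p0 ->
  is_derive (line (un4 g) v i) 0 (un4 (pd i g) v).
Proof.
  intros H Hv. destruct v as [[[x y] z] w]. apply nonzero4_iff in Hv.
  destruct (H x y z w Hv) as [_ [H1 _]]. simpl. apply exd_line.
  dix i; [apply (H1 0%nat)|apply (H1 1%nat)|apply (H1 2%nat)|apply (H1 3%nat)]; lia.
Qed.

Lemma C2_line2 (g : fn4R) i v : C2_off0 g -> v <> p0 ->
  is_derive (line (un4 (pd i g)) v i) 0 (un4 (pd i (pd i g)) v).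
Proof.
  intros H Hv. destruct v as [[[x y] z] w]. apply nonzero4_iff in Hv.
  destruct (H x y z w Hv) as [_ [_ H1]]. simpl. apply (exd_line (pd i g)).
  dix i; [apply (H1 0%nat 0%nat)|apply (H1 1%nat 1%nat)|apply (H1 2%nat 2%nat)|apply (H1 3%nat 3%nat)]; lia.
Qed.

Lemma C2_continuous (g : fn4R) v : C2_off0 g -> v <> p0 -> continuous (un4 g) v.
Proof.
  intros H Hv. destruct v as [[[x y] z] w]. apply nonzero4_iff in Hv.
  exact (proj1 (H x y z w Hv)).
Qed.

Lemma C2_continuous1 (g : fn4R) i v : C2_off0 g -> v <> p0 -> continuous (un4 (pd i g)) v.
Proof.
  intros H Hv. destruct v as [[[x y] z] w]. apply nonzero4_iff in Hv.
  destruct (H x y z w Hv) as [_ [H1 _]].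
  dix i; [apply (H1 0%nat)|apply (H1 1%nat)|apply (H1 2%nat)|apply (H1 3%nat)]; lia.
Qed.

Lemma locally_neq0 (v : pt) : v <> p0 -> locally v (fun w => w <> p0).
Proof.
  intro H. assert (Hn : ~ In v (p0 :: nil)) by (intros [E|[]]; auto).
  generalize (locally_not_in _ _ Hn). apply filter_imp. intros w Hw ->. apply Hw. left; auto.
Qed.

Lemma C2_has_d2 (g : fn4R) i v : C2_off0 g -> v <> p0 ->
  has_d2 (line (un4 g) v i) (un4 (pd i (pd i g)) v) /\
  Derive (line (un4 g) v i) 0 = un4 (pd i g) v.
Proof.
  intros H Hv. split.
  - apply has_d2_intro with (line (un4 (pd i g)) v i).
    + generalize (locally_line v i _ (locally_neq0 v Hv)). apply filter_imp. intros t Ht.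
      apply is_derive_line_shift. apply C2_line1; auto.
    + apply C2_line2; auto.
  - apply is_derive_unique, C2_line1; auto.
Qed.

Lemma mvt_axis (f g : pt -> R) (w : pt) (i : nat) (a : R) :
  (forall s, Rabs s <= Rabs a -> is_derive (line f (padd w (axis i s)) i) 0 (g (padd w (axis i s)))) ->
  exists s, Rabs s <= Rabs a /\ f (padd w (axis i a)) - f w = a * g (padd w (axis i s)).
Proof.
  intro H.
  assert (Hd : forall s, Rabs s <= Rabs a -> is_derive (line f w i) s (g (padd w (axis i s)))).
  { intros s Hs. apply is_derive_line_shift, H, Hs. }
  assert (Hin : forall s, Rmin 0 a <= s <= Rmax 0 a -> Rabs s <= Rabs a).
  { intros s. unfold Rmin, Rmax. destruct Rle_dec; intro Hs.
    - rewrite !Rabs_pos_eq; lra.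
    - rewrite !Rabs_left1; lra. }
  destruct (MVT_gen (line f w i) 0 a (fun s => g (padd w (axis i s)))) as [c [Hc E]].
  - intros s Hs. apply Hd, Hin. lra.
  - intros s Hs. apply derivable_continuous_pt. exists (g (padd w (axis i s))).
    apply is_derive_Reals, Hd, Hin, Hs.
  - exists c. split; [apply Hin, Hc|]. rewrite line_0 in E. unfold line in E. rewrite E. ring.
Qed.

(** Only axis derivatives with continuity at [v] are at hand, not a total differential. The point is
    moved from [v] to [(1 + t) v] along four axis segments, with a mean value on each; the total
    change is zero, and the mean values are close to the partials at [v], so a nonzero radial
    derivative [L] is impossible. *)
Lemma euler_homog0 (f : pt -> R) (g : nat -> pt -> R) (v : pt) :
  locally v (fun w => forall i, is_derive (line f w i) 0 (g i w)) ->
  (forall i, continuous (g i) v) ->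
  (forall s, 0 < s -> f (pscal s v) = f v) ->
  crd 0 v * g 0%nat v + crd 1 v * g 1%nat v + crd 2 v * g 2%nat v + crd 3 v * g 3%nat v = 0.
Proof.
  intros Hd Hg Hh. set (L := _ + _). destruct (Req_dec L 0) as [|HL]; auto. exfalso.
  set (K := Rabs (crd 0 v) + Rabs (crd 1 v) + Rabs (crd 2 v) + Rabs (crd 3 v)).
  assert (HK : 0 <= K). { unfold K. repeat apply Rplus_le_le_0_compat; apply Rabs_pos. }
  (* Chosen so that [K e < |L|], against the bound [|L| <= K e] reached at the end. *)
  set (e := Rabs L / (2 * (K + 1))).
  assert (He : 0 < e). { apply Rdiv_lt_0_compat; [apply Rabs_pos_lt, HL|lra]. }
  assert (Hl : forall i, locally v (fun w => Rabs (g i w - g i v) < e)).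
  { intro i. apply locally_near_by. apply (proj1 (continuous_near_by (g i) v) (Hg i) e He). }
  pose proof (filter_and _ _ Hd (filter_and _ _ (filter_and _ _ (Hl 0%nat) (Hl 1%nat))
    (filter_and _ _ (Hl 2%nat) (Hl 3%nat)))) as HH.
  apply locally_near_by in HH. destruct HH as [d [Hdp HH]].
  (* Every displacement [t |v_i|] stays below [d], so the whole broken path lies in the cube where
     the partials are controlled. *)
  set (t := d / (2 * (K + 1))).
  assert (Ht : 0 < t) by (apply Rdiv_lt_0_compat; lra).
  assert (Htd : forall i, Rabs (t * crd i v) < d).
  { intro i. rewrite Rabs_mult, (Rabs_pos_eq t) by lra.
    assert (Rabs (crd i v) <= K).
    { unfold K. pose proof (Rabs_pos (crd 0 v)). pose proof (Rabs_pos (crd 1 v)).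
      pose proof (Rabs_pos (crd 2 v)). pose proof (Rabs_pos (crd 3 v)).
      dpt v; dix i; simpl in *; lra. }
    assert (t * (2 * (K + 1)) = d) by (unfold t; field; lra). nra. }
  assert (Hnb : forall s0 s1 s2 s3, Rabs s0 <= Rabs (t * crd 0 v) -> Rabs s1 <= Rabs (t * crd 1 v) ->
     Rabs s2 <= Rabs (t * crd 2 v) -> Rabs s3 <= Rabs (t * crd 3 v) ->
     near_by d v (padd (padd (padd (padd v (axis 0 s0)) (axis 1 s1)) (axis 2 s2)) (axis 3 s3))).
  { intros s0 s1 s2 s3 H0 H1 H2 H3 j. pose proof (Htd 0%nat). pose proof (Htd 1%nat).
    pose proof (Htd 2%nat). pose proof (Htd 3%nat). rewrite !crd_padd.
    match goal with |- Rabs ?X < d => replace X with (crd j (s0, s1, s2, s3)) by (dix j; simpl; ring) end.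
    dix j; simpl; lra. }
  assert (R0 : forall i, Rabs 0 <= Rabs (t * crd i v)) by (intro; rewrite Rabs_R0; apply Rabs_pos).
  assert (P0 : forall w i, padd w (axis i 0) = w) by (intros; rewrite axis_0, padd_0_r; auto).
  destruct (mvt_axis f (g 0%nat) v 0 (t * crd 0 v)) as [s0 [Hs0 E0]].
  { intros s Hs. apply (proj1 (HH _ ltac:(
      pose proof (Hnb s 0 0 0 Hs (R0 _) (R0 _) (R0 _)) as X; rewrite !P0 in X; exact X))). }
  set (w1 := padd v (axis 0 (t * crd 0 v))) in *.
  destruct (mvt_axis f (g 1%nat) w1 1 (t * crd 1 v)) as [s1 [Hs1 E1]].
  { intros s Hs. apply (proj1 (HH _ ltac:(
      pose proof (Hnb _ s 0 0 (Rle_refl _) Hs (R0 _) (R0 _)) as X; rewrite !P0 in X; exact X))). }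
  set (w2 := padd w1 (axis 1 (t * crd 1 v))) in *.
  destruct (mvt_axis f (g 2%nat) w2 2 (t * crd 2 v)) as [s2 [Hs2 E2]].
  { intros s Hs. apply (proj1 (HH _ ltac:(
      pose proof (Hnb _ _ s 0 (Rle_refl _) (Rle_refl _) Hs (R0 _)) as X; rewrite !P0 in X; exact X))). }
  set (w3 := padd w2 (axis 2 (t * crd 2 v))) in *.
  destruct (mvt_axis f (g 3%nat) w3 3 (t * crd 3 v)) as [s3 [Hs3 E3]].
  { intros s Hs. apply (proj1 (HH _ (Hnb _ _ _ s (Rle_refl _) (Rle_refl _) (Rle_refl _) Hs))). }
  assert (Eend : padd w3 (axis 3 (t * crd 3 v)) = pscal (1 + t) v).
  { unfold w3, w2, w1. apply pt_eq. intro i. rewrite !crd_padd, crd_pscal. dpt v; dix i; simpl; ring. }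
  rewrite Eend, Hh in E3 by lra.
  pose proof (Hnb s0 0 0 0 Hs0 (R0 _) (R0 _) (R0 _)) as N0. rewrite !P0 in N0.
  pose proof (Hnb _ s1 0 0 (Rle_refl _) Hs1 (R0 _) (R0 _)) as N1. rewrite !P0 in N1.
  pose proof (Hnb _ _ s2 0 (Rle_refl _) (Rle_refl _) Hs2 (R0 _)) as N2. rewrite !P0 in N2.
  pose proof (Hnb _ _ _ s3 (Rle_refl _) (Rle_refl _) (Rle_refl _) Hs3) as N3.
  fold w1 in N1, N2, N3. fold w2 in N2, N3. fold w3 in N3.
  destruct (HH _ N0) as [_ [[G0 _] _]]. destruct (HH _ N1) as [_ [[_ G1] _]].
  destruct (HH _ N2) as [_ [_ [G2 _]]]. destruct (HH _ N3) as [_ [_ [_ G3]]].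
  set (a0 := g 0%nat (padd v (axis 0 s0))) in *. set (a1 := g 1%nat (padd w1 (axis 1 s1))) in *.
  set (a2 := g 2%nat (padd w2 (axis 2 s2))) in *. set (a3 := g 3%nat (padd w3 (axis 3 s3))) in *.
  assert (Z : crd 0 v * a0 + crd 1 v * a1 + crd 2 v * a2 + crd 3 v * a3 = 0).
  { apply Rmult_eq_reg_l with t; [|lra]. lra. }
  assert (LL : L = - (crd 0 v * (a0 - g 0%nat v) + crd 1 v * (a1 - g 1%nat v)
     + crd 2 v * (a2 - g 2%nat v) + crd 3 v * (a3 - g 3%nat v))) by (unfold L; lra).
  assert (Rabs L <= K * e).
  { rewrite LL, Rabs_Ropp. unfold K. rewrite !Rmult_plus_distr_r.
    eapply Rle_trans; [apply Rabs_triang|]. apply Rplus_le_compat.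
    eapply Rle_trans; [apply Rabs_triang|]. apply Rplus_le_compat.
    eapply Rle_trans; [apply Rabs_triang|]. apply Rplus_le_compat.
    all: rewrite Rabs_mult; apply Rmult_le_compat_l; [apply Rabs_pos|lra]. }
  assert (e * (2 * (K + 1)) = Rabs L) by (unfold e; field; lra). nra.
Qed.

Definition rpow (k : nat) (v : pt) : R := sqrt (nrm2 v) ^ k.

Lemma is_derive_rpow (k : nat) (x c t : R) : 0 < (x + t) * (x + t) + c ->
  is_derive (fun t => sqrt ((x + t) * (x + t) + c) ^ k) t
    (INR k * (x + t) * sqrt ((x + t) * (x + t) + c) ^ k / ((x + t) * (x + t) + c)).
Proof.
  intro H. pose proof (sqrt_lt_R0 _ H) as Hs. pose proof (sqrt_sqrt _ (Rlt_le _ _ H)) as E.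
  auto_derive; [auto|].
  set (n := (x + t) * (x + t) + c) in *. set (r := sqrt n) in *.
  destruct k as [|k]; [simpl; field; lra|].
  replace (r ^ S k) with (r * r ^ k) by reflexivity. rewrite <- E.
  change (pred (S k)) with k. field. lra.
Qed.

Lemma has_d2_rpow (k : nat) (x c : R) : 0 < x * x + c ->
  has_d2 (fun t => sqrt ((x + t) * (x + t) + c) ^ k)
    (INR k * sqrt (x * x + c) ^ k / (x * x + c)
     + INR k * (INR k - 2) * (x * x) * sqrt (x * x + c) ^ k / (x * x + c) ^ 2).
Proof.
  intro H. set (rho := fun t => sqrt ((x + t) * (x + t) + c) ^ k).
  apply has_d2_intro with (fun t => (INR k * (x + t) / ((x + t) * (x + t) + c)) * rho t).
  - generalize (sq_line_pos x c H). apply filter_imp. intros t Ht.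
    match goal with |- is_derive _ _ ?l => replace l with
      (INR k * (x + t) * sqrt ((x + t) * (x + t) + c) ^ k / ((x + t) * (x + t) + c)) end.
    + apply is_derive_rpow, Ht.
    + unfold rho, Rdiv. change (@eq R (INR k * (x + t) * sqrt ((x + t) * (x + t) + c) ^ k * / ((x + t) * (x + t) + c))
       (INR k * (x + t) * / ((x + t) * (x + t) + c) * sqrt ((x + t) * (x + t) + c) ^ k)). ring.
  - assert (H' : 0 < (x + 0) * (x + 0) + c) by (rewrite Rplus_0_r; auto).
    match goal with |- is_derive _ _ ?l => replace l with
      ((INR k / (x * x + c) - INR k * x * (2 * x) / (x * x + c) ^ 2) * rho 0
       + (INR k * (x + 0) / ((x + 0) * (x + 0) + c)) *
        (INR k * (x + 0) * sqrt ((x + 0) * (x + 0) + c) ^ k / ((x + 0) * (x + 0) + c))) end.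
    + apply (is_derive_Rmult (fun t => INR k * (x + t) / ((x + t) * (x + t) + c)) rho);
        [|apply is_derive_rpow, H'].
      auto_derive; [apply Rgt_not_eq, H'|]. rewrite !Rplus_0_r. field. lra.
    + unfold rho. rewrite !Rplus_0_r. field. lra.
Qed.

Lemma line_rpow (k : nat) (v : pt) (i : nat) : v <> p0 ->
  has_d2 (line (rpow k) v i) (INR k * rpow k v / nrm2 v
     + INR k * (INR k - 2) * (crd i v * crd i v) * rpow k v / nrm2 v ^ 2) /\
  Derive (line (rpow k) v i) 0 = INR k * crd i v * rpow k v / nrm2 v.
Proof.
  intro Hv. apply nrm2_gt0 in Hv.
  set (c := nrm2 v - crd i v * crd i v).
  assert (E : nrm2 v = crd i v * crd i v + c) by (unfold c; ring).
  assert (EL : forall t, sqrt ((crd i v + t) * (crd i v + t) + c) ^ k = line (rpow k) v i t).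
  { intro t. unfold line, rpow. rewrite line_nrm2. reflexivity. }
  split.
  - eapply has_d2_ext; [apply filter_forall, EL|]. unfold rpow. rewrite E. apply has_d2_rpow. lra.
  - apply is_derive_unique. eapply is_derive_ext; [apply EL|].
    assert (H' : 0 < (crd i v + 0) * (crd i v + 0) + c) by (rewrite Rplus_0_r; lra).
    pose proof (is_derive_rpow k (crd i v) c 0 H') as D. rewrite !Rplus_0_r in D.
    unfold rpow. rewrite E. exact D.
Qed.

Definition homog0 (u : fn4R) : Prop :=
  forall s v, 0 < s -> un4 u (pscal s v) = un4 u v.

(** In the product rule the cross term is a multiple of the radial derivative of [u], zero by
    Euler's relation, and in dimension four the Laplacian of [r^k] is [k (k + 2) r^(k-2)]. *)
Lemma has_lap_rpow_mult (k : nat) (u : fn4R) (v : pt) :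
  C2_off0 u -> homog0 u -> v <> p0 ->
  has_lap (fun w => rpow k w * un4 u w) v
    (rpow k v * un4 (lap4 u) v + INR k * (INR k + 2) * rpow k v / nrm2 v * un4 u v).
Proof.
  intros Hu Hh Hv.
  assert (Euler : crd 0 v * un4 (pd 0 u) v + crd 1 v * un4 (pd 1 u) v
     + crd 2 v * un4 (pd 2 u) v + crd 3 v * un4 (pd 3 u) v = 0).
  { apply (euler_homog0 (un4 u) (fun i => un4 (pd i u))).
    - generalize (locally_neq0 v Hv). apply filter_imp. intros w Hw i. apply C2_line1; auto.
    - intro i. apply C2_continuous1; auto.
    - intros s Hs. apply Hh, Hs. }
  pose proof (nrm2_gt0 v Hv) as Hn. pose proof (nrm2_crd v) as En.
  eexists. split.
  - intro i. destruct (line_rpow k v i Hv) as [A1 A2]. destruct (C2_has_d2 u i v Hu Hv) as [B1 B2].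
    pose proof (has_d2_mult _ _ _ _ A1 B1) as M. rewrite A2, B2, !line_0 in M.
    change (line (fun w => rpow k w * un4 u w) v i) with (fun t => line (rpow k) v i t * line (un4 u) v i t).
    exact M.
  - cbv beta.
    replace (un4 (lap4 u) v) with (un4 (pd 0 (pd 0 u)) v + un4 (pd 1 (pd 1 u)) v
      + un4 (pd 2 (pd 2 u)) v + un4 (pd 3 (pd 3 u)) v) by (dpt v; reflexivity).
    set (U := un4 u v) in *. set (P := rpow k v) in *. set (n := nrm2 v) in *.
    assert (X : INR k * (INR k - 2) * (crd 0 v * crd 0 v + crd 1 v * crd 1 v + crd 2 v * crd 2 v + crd 3 v * crd 3 v) * P / n ^ 2 * U
       = INR k * (INR k - 2) * P / n * U) by (rewrite <- En; field; lra).
    assert (Y : 2 * (INR k * P / n) * (crd 0 v * un4 (pd 0 u) v + crd 1 v * un4 (pd 1 u) v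
     + crd 2 v * un4 (pd 2 u) v + crd 3 v * un4 (pd 3 u) v) = 0) by (rewrite Euler; ring).
    assert (Z : INR k * (INR k + 2) * P / n * U = 4 * (INR k * P / n * U) + INR k * (INR k - 2) * P / n * U)
      by (field; lra).
    rewrite Z, <- X. clear - Y Hn.
    match type of Y with ?a = 0 => rewrite <- (Rplus_0_r (_ + (_ + _))), <- Y end.
    field. lra.
Qed.

Lemma has_d2_scale_arg (f : R -> R) (s a : R) :
  has_d2 f a -> has_d2 (fun t => f (s * t)) (s * s * a).
Proof.
  intros Hf. apply has_d2_elim in Hf. destruct Hf as [F1 F2].
  assert (Hs : forall t, is_derive (fun t => s * t) t s) by (intro; auto_derive; auto; ring).
  apply has_d2_intro with (fun t => s * Derive f (s * t)).
  - apply locally_R in F1. destruct F1 as [d [Hd H]].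
    apply locally_R. exists (d / (Rabs s + 1)). pose proof (Rabs_pos s).
    split; [apply Rdiv_lt_0_compat; lra|]. intros t Ht.
    apply (is_derive_comp f (fun t => s * t)); [|apply Hs]. apply H.
    rewrite Rminus_0_r in *. rewrite Rabs_mult.
    apply (Rmult_lt_compat_l (Rabs s + 1)) in Ht; [|lra].
    replace ((Rabs s + 1) * (d / (Rabs s + 1))) with d in Ht by (field; lra).
    pose proof (Rabs_pos t). nra.
  - replace (s * s * a) with (s * (s * a)) by ring.
    apply (is_derive_scal (fun t => Derive f (s * t))).
    apply (is_derive_comp (Derive f) (fun t => s * t)); [|apply Hs].
    rewrite Rmult_0_r. exact F2.
Qed.

Lemma has_lap_pscal (f : pt -> R) (s : R) (v : pt) (L : R) :
  has_lap f (pscal s v) L -> has_lap (fun w => f (pscal s w)) v (s * s * L).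
Proof.
  intros [d [Hd ->]]. exists (fun i => s * s * d i). split; [|ring].
  intro i. eapply has_d2_ext; [|apply (has_d2_scale_arg _ s _ (Hd i))].
  apply filter_forall. intro t. unfold line. f_equal. apply pt_eq. intro j.
  rewrite crd_padd, !crd_pscal, crd_padd. dix i; dix j; simpl; ring.
Qed.

Lemma nrm2_pscal s v : nrm2 (pscal s v) = s * s * nrm2 v.
Proof. dpt v. unfold nrm2; simpl. ring. Qed.

Lemma rpow_pscal k s v : 0 <= s -> rpow k (pscal s v) = s ^ k * rpow k v.
Proof.
  intro Hs. unfold rpow. rewrite nrm2_pscal, sqrt_mult, sqrt_square, Rpow_mult_distr; auto.
  - nra.
  - apply nrm2_pos.
Qed.

Lemma sphere_projection (v : pt) : v <> p0 ->
  exists s, 0 < s /\ nrm2 (pscal s v) = 1 /\ s * sqrt (nrm2 v) = 1.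
Proof.
  intro Hv. apply nrm2_gt0 in Hv. pose proof (sqrt_lt_R0 _ Hv).
  exists (/ sqrt (nrm2 v)). split; [apply Rinv_0_lt_compat; auto|].
  split; [|field; lra]. rewrite nrm2_pscal. rewrite <- (sqrt_sqrt (nrm2 v)) at 3 by lra.
  field. lra.
Qed.

Section Eigenfunction.
Variables (k : nat) (u : fn4R).
Hypothesis Hu : C2_off0 u.
Hypothesis Hh : homog0 u.
Hypothesis Heig : forall v, nrm2 v = 1 -> un4 (lap4 u) v = - INR (k * (k + 2)) * un4 u v.

Let H : pt -> R := fun w => rpow k w * un4 u w.

Lemma p0_nrm2 v : nrm2 v = 1 -> v <> p0.
Proof. intros E ->. unfold nrm2, p0 in E. lra. Qed.

(** The eigenvalue equation is given on the unit sphere, where it cancels the term [k (k + 2) u];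
    homogeneity carries harmonicity to the other radii. *)
Lemma solid_harmonic v : v <> p0 -> has_lap H v 0.
Proof.
  intro Hv.
  assert (S1 : forall w, nrm2 w = 1 -> has_lap H w 0).
  { intros w Hw. pose proof (has_lap_rpow_mult k u w Hu Hh (p0_nrm2 w Hw)) as L.
    rewrite (Heig w Hw), Hw in L. unfold rpow in L. rewrite Hw, sqrt_1, pow1 in L.
    match type of L with has_lap _ _ ?l => replace l with 0 in L; [exact L|] end.
    rewrite mult_INR, plus_INR. simpl. field. }
  destruct (sphere_projection v Hv) as [s [Hs [E1 E2]]].
  replace 0 with ((/ s) ^ k * (s * s * 0)) by ring.
  apply (has_lap_ext (fun w => (/ s) ^ k * H (pscal s w))).
  - intro w. unfold H. rewrite rpow_pscal, Hh by lra. rewrite <- !Rmult_assoc, <- Rpow_mult_distr.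
    rewrite Rinv_l, pow1 by lra. ring.
  - apply has_lap_scal, has_lap_pscal, S1, E1.
Qed.

Lemma homog0_bounded : exists M, 0 <= M /\ forall v, Rabs (un4 u v) <= M.
Proof.
  destruct (box_bound (fun v => Rabs (un4 u v)) (fun v => nrm2 v = 1) (fun _ => True) 1) as [M [_ HM]]; auto.
  - exists 0; auto.
  - intros v _. destruct (classic (v = p0)) as [->|Hv].
    (* The origin belongs to the cube, but no sphere point is near it, so any bound holds there. *)
    + exists 0. split; auto.
      assert (L : nrm2 p0 < 1) by (unfold nrm2, p0; lra).
      generalize (locally_lt_continuous nrm2 p0 1 (continuous_nrm2 p0) L). apply filter_imp. intros; lra.
    + exists (Rabs (un4 u v) + 1). split; auto. apply locally_near_by.
      destruct (proj1 (continuous_near_by _ v) (C2_continuous u v Hu Hv) 1 Rlt_0_1) as [d [Hd Hw]].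
      exists d. split; auto. intros w Hc _. specialize (Hw w Hc).
      pose proof (Rabs_triang_inv (un4 u w) (un4 u v)). lra.
  (* The value of [u] at the origin is not tied to the sphere by scaling and is added separately. *)
  - exists (Rmax M 0 + Rabs (un4 u p0)). pose proof (Rmax_l M 0). pose proof (Rmax_r M 0).
    pose proof (Rabs_pos (un4 u p0)). split; [lra|]. intro v.
    destruct (classic (v = p0)) as [->|Hv]; [lra|].
    destruct (sphere_projection v Hv) as [s [Hs [E1 _]]]. rewrite <- (Hh s v Hs).
    assert (inbox 1 (pscal s v)).
    { intro i. pose proof (nrm2_crd (pscal s v)) as E. rewrite E1 in E.
      apply Rabs_le_between. destruct (pscal s v) as [[[a b] c] d]. dix i; simpl in *; nra. }
    specialize (HM _ H3 E1). simpl in HM. lra.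
Qed.

Lemma continuous_rpow v : continuous (rpow k) v.
Proof.
  unfold rpow. apply (continuous_comp nrm2 (fun t => sqrt t ^ k)); [apply continuous_nrm2|].
  apply (continuous_comp sqrt (fun t => t ^ k)).
  - apply continuous_sqrt.
  - apply (@ex_derive_continuous R_AbsRing R_NormedModule). auto_derive. auto.
Qed.

Lemma solid_tame : tame k 0 (p0 :: nil) H.
Proof.
  destruct homog0_bounded as [M [HM HMb]].
  assert (Hr : forall w, 0 <= rpow k w) by (intro; apply pow_le, sqrt_pos).
  assert (HB : forall w, Rabs (H w) <= M * rpow k w).
  { intro w. unfold H. rewrite Rabs_mult, Rabs_pos_eq, Rmult_comm by auto.
    apply Rmult_le_compat_r; auto. }
  split.
  - intros v Hv. assert (Hv0 : v <> p0) by (intros ->; apply Hv; left; auto).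
    split; [apply solid_harmonic, Hv0|].
    apply continuous_Rmult; [apply continuous_rpow|apply C2_continuous; auto].
  - intro v. exists (M * (rpow k v + 1)).
    assert (L : rpow k v < rpow k v + 1) by lra.
    generalize (locally_lt_continuous _ v _ (continuous_rpow v) L). apply filter_imp.
    intros w Hw. eapply Rle_trans; [apply HB|]. apply Rmult_le_compat_l; lra.
  (* The Euclidean norm is at most twice the maximum norm. *)
  - exists (M * 2 ^ k), 1. split; [apply Rmult_le_pos; auto; apply pow_le; lra|]. split; [lra|].
    intros v Hv. rewrite pow_O, Rmult_1_r. eapply Rle_trans; [apply HB|].
    rewrite Rmult_assoc. apply Rmult_le_compat_l; auto. rewrite <- Rpow_mult_distr.
    apply pow_incr. split; [apply sqrt_pos|].
    rewrite <- (sqrt_square (2 * nrm v)) by lra. apply sqrt_le_1_alt.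
    pose proof (inbox_nrm2 (nrm v) v (fun i => crd_nrm i v)). lra.
Qed.

(** At the origin the positive power [r^k] tends to 0 while [u] stays bounded. *)
Lemma solid_continuous : (0 < k)%nat -> forall v, continuous H v.
Proof.
  intros Hk v. destruct (classic (v = p0)) as [->|Hv].
  - destruct homog0_bounded as [M [HM HMb]].
    assert (E0 : rpow k p0 = 0).
    { unfold rpow. replace (nrm2 p0) with 0 by (unfold nrm2, p0; ring). rewrite sqrt_0. apply pow_i, Hk. }
    apply continuous_near_by. intros e He.
    assert (He' : 0 < e / (M + 1)) by (apply Rdiv_lt_0_compat; lra).
    destruct (proj1 (continuous_near_by _ p0) (continuous_rpow p0) _ He') as [d [Hd Hw]].
    exists d. split; auto. intros w Hc. specialize (Hw w Hc). rewrite E0, Rminus_0_r in Hw.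
    unfold H. rewrite E0, Rmult_0_l, Rminus_0_r, Rabs_mult.
    apply (Rmult_lt_compat_r (M + 1)) in Hw; [|lra].
    replace (e / (M + 1) * (M + 1)) with e in Hw by (field; lra).
    specialize (HMb w). pose proof (Rabs_pos (rpow k w)). nra.
  - apply continuous_Rmult; [apply continuous_rpow|apply C2_continuous; auto].
Qed.

(** A bounded harmonic function off the origin: a single difference already decays like 1/|v|, hence
    vanishes off two points, so [u] is unchanged by any axis step with both ends away from the
    origin. *)
Lemma degree0_constant : k = 0%nat -> forall v, v <> p0 -> un4 u v = un4 u (1, 0, 0, 0).
Proof.
  intro Hk.
  assert (step : forall i t v, v <> p0 -> padd v (axis i t) <> p0 -> un4 u (padd v (axis i t)) = un4 u v).
  { intros i t v Hv Hw. pose proof (tame_diff _ _ _ _ i t solid_tame) as T.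
    rewrite Hk in T. pose proof (tame_zero 0 _ _ T v) as Z.
    assert (E : forall w, H w = un4 u w) by (intro; unfold H, rpow; rewrite Hk; simpl; ring).
    unfold diff in Z. rewrite !E in Z.
    assert (un4 u (padd v (axis i t)) - un4 u v = 0); [|lra].
    apply Z. simpl. intros [E'|[E'|[]]]; auto. apply Hw. rewrite <- E'.
    apply pt_eq. intro j. rewrite crd_padd. dix i; dix j; simpl; ring. }
  assert (up : forall a b c d a', a <> 0 \/ b <> 0 \/ c <> 0 \/ d <> 0 -> a' <> 0 ->
     un4 u (a', b, c, d) = un4 u (a, b, c, d)).
  { intros a b c d a' Hn Ha. rewrite <- (step 0%nat (a' - a) (a, b, c, d)).
    - f_equal. simpl. repeat f_equal; ring.
    - unfold p0. intro E. inversion E. lra.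
    - simpl. unfold p0. intro E. inversion E. lra. }
  intros v Hv. destruct v as [[[a b] c] d].
  assert (Hn : a <> 0 \/ b <> 0 \/ c <> 0 \/ d <> 0).
  { apply NNPP. intro N. apply Hv. unfold p0. repeat f_equal; apply NNPP; intro; tauto. }
  (* The first coordinate is set to 1 before the others are cleared, so that no intermediate point
     is the origin. *)
  rewrite <- (up a b c d 1 Hn) by lra.
  assert (N1 : forall b c d, (1, b, c, d) <> p0) by (intros; unfold p0; intro E; inversion E; lra).
  transitivity (un4 u (1, 0, c, d)); [|transitivity (un4 u (1, 0, 0, d))].
  - rewrite <- (step 1%nat b (1, 0, c, d)); simpl; rewrite ?Rplus_0_r, ?Rplus_0_l; auto.
  - rewrite <- (step 2%nat c (1, 0, 0, d)); simpl; rewrite ?Rplus_0_r, ?Rplus_0_l; auto.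
  - rewrite <- (step 3%nat d (1, 0, 0, 0)); simpl; rewrite ?Rplus_0_r, ?Rplus_0_l; auto.
Qed.

Lemma eigenfunction_polynomial : exists h, homog k h /\
  forall x y z w, onS3 x y z w -> RtoC (u x y z w) = evp (S k) h x y z w.
Proof.
  destruct (Nat.eq_dec k 0) as [Hk|Hk].
  - destruct (hpoly_const (S k) (un4 u (1, 0, 0, 0))) as [h [H1 H2]]; [lia|].
    exists h. split; [rewrite Hk; exact H1|]. intros x y z w Hs. rewrite <- H2. f_equal.
    apply (degree0_constant Hk (x, y, z, w)). apply p0_nrm2. exact Hs.
  - destruct (tame_homog_hpoly (S k) k (p0 :: nil) H) as [h [H1 H2]].
    + lia.
    + apply solid_continuous. lia.
    + apply solid_tame.
    + intros s v Hs. unfold H. rewrite rpow_pscal by auto.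
      destruct (Rle_lt_or_eq_dec _ _ Hs) as [Hp|<-].
      * rewrite Hh by auto. ring.
      * rewrite pow_i by lia. ring.
    + exists h. split; auto. intros x y z w Hs. rewrite <- H2. unfold H, rpow.
      change (nrm2 (x, y, z, w)) with (x * x + y * y + z * z + w * w). unfold onS3 in Hs.
      rewrite Hs, sqrt_1, pow1, Rmult_1_l. reflexivity.
Qed.

End Eigenfunction.

(** * Counting the admissible exponents *)

Lemma div_succ (x d : Z) : (0 < d)%Z ->
  ((x + 1) / d = x / d + (if ((x + 1) mod d =? 0)%Z then 1 else 0))%Z.
Proof.
  intro Hd. destruct (Z.eqb_spec ((x + 1) mod d) 0) as [E|E].
  - pose proof (Z.div_mod (x + 1) d). pose proof (Z.div_mod x d).
    pose proof (Z.mod_pos_bound x d Hd). pose proof (Z.mod_pos_bound (x + 1) d Hd). nia.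
  - pose proof (Z.div_mod (x + 1) d). pose proof (Z.div_mod x d).
    pose proof (Z.mod_pos_bound x d Hd). pose proof (Z.mod_pos_bound (x + 1) d Hd). nia.
Qed.

(** The floor of [x / d] jumps by one exactly at multiples of [d], so the count telescopes. *)
Lemma count_residue (f : nat -> bool) (c d : Z) (n : nat) : (0 < d)%Z ->
  (forall a, f a = ((Z.of_nat a - c) mod d =? 0)%Z) ->
  Z.of_nat (length (filter f (seq 0 n))) = ((Z.of_nat n - 1 - c) / d - (-1 - c) / d)%Z.
Proof.
  intros Hd Hf. induction n as [|n IH].
  - simpl. replace (0 - 1 - c)%Z with (-1 - c)%Z by lia. lia.
  - rewrite seq_S, filter_app, length_app, Nat2Z.inj_add, IH, Nat.add_0_l. cbn [filter]. rewrite Hf.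
    replace (Z.of_nat (S n) - 1 - c)%Z with (Z.of_nat n - 1 - c + 1)%Z by lia.
    rewrite (div_succ (Z.of_nat n - 1 - c) d Hd).
    replace (Z.of_nat n - 1 - c + 1)%Z with (Z.of_nat n - c)%Z by lia.
    destruct ((Z.of_nat n - c) mod d =? 0)%Z; simpl length; lia.
Qed.

Lemma div_neg_succ (l d : Z) : (0 < d)%Z -> ((-1 - l) / d = - (l / d) - 1)%Z.
Proof.
  intro Hd. pose proof (Z.div_mod l d). pose proof (Z.div_mod (-1 - l) d).
  pose proof (Z.mod_pos_bound l d Hd). pose proof (Z.mod_pos_bound (-1 - l) d Hd). nia.
Qed.

Lemma mod0_iff (x d : Z) : (0 < d)%Z -> (x mod d =? 0)%Z = true <-> (d | x)%Z.
Proof. intro Hd. rewrite Z.eqb_eq. apply Z.mod_divide. lia. Qed.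

(** Divisibility of [2a - k] by [p] is a single residue class for [a], whose centre [c] and modulus
    [d] depend on the parities. *)
Lemma good_a_residue (p k : nat) (c d : Z) : (1 <= p)%nat -> (0 < d)%Z ->
  (forall a, (0 <= a <= Z.of_nat k)%Z ->
     (Z.of_nat p | 2 * a - Z.of_nat k)%Z <-> (d | a - c)%Z) ->
  Z.of_nat (length (filter (good_a p k) (seq 0 (S k)))) = ((Z.of_nat k - c) / d - (-1 - c) / d)%Z.
Proof.
  intros Hp Hd H.
  rewrite (filter_ext_in (good_a p k) (fun a => ((Z.of_nat a - c) mod d =? 0)%Z)).
  - rewrite (count_residue _ c d (S k) Hd) by auto. f_equal. f_equal. lia.
  - intros a Ha. apply in_seq in Ha. apply Bool.eq_iff_eq_true. unfold good_a.
    rewrite !mod0_iff by lia.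
    replace (Z.of_nat a - Z.of_nat (k - a))%Z with (2 * Z.of_nat a - Z.of_nat k)%Z by lia.
    apply H. lia.
Qed.

Lemma length_basis_idx (p k : nat) :
  Z.of_nat (length (basis_idx p k)) =
  (Z.of_nat (length (filter (good_a p k) (seq 0 (S k)))) * (Z.of_nat k + 1))%Z.
Proof.
  unfold basis_idx. rewrite length_prod, length_seq. lia.
Qed.

Lemma Zodd_divide_double (P x : Z) : Z.odd P = true -> (P | 2 * x)%Z -> (P | x)%Z.
Proof.
  intros Ho [q Hq]. apply Z.odd_spec in Ho. destruct Ho as [m ->]. exists (x - m * q)%Z. nia.
Qed.

Lemma nat_parity (n : nat) : if Nat.even n then exists m, n = (2 * m)%nat else exists m, n = (2 * m + 1)%nat.
Proof.
  destruct (Nat.even n) eqn:E.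
  - apply Nat.even_spec in E. exact E.
  - assert (O : Nat.odd n = true) by (rewrite <- Nat.negb_even, E; auto).
    apply Nat.odd_spec in O. exact O.
Qed.

Lemma basis_count_even (p n k : nat) : (1 <= p)%nat -> p = (2 * n)%nat ->
  Z.of_nat (length (basis_idx p k)) =
    (if Nat.even k then (2 * ((Z.of_nat k / 2) / Z.of_nat n) + 1) * (Z.of_nat k + 1) else 0)%Z.
Proof.
  intros Hp ->. rewrite length_basis_idx. pose proof (nat_parity k) as Pk.
  destruct (Nat.even k).
  - destruct Pk as [l ->].
    rewrite (good_a_residue (2 * n) (2 * l) (Z.of_nat l) (Z.of_nat n)); [|lia|lia|].
    + rewrite div_neg_succ by lia.
      replace (Z.of_nat (2 * l) - Z.of_nat l)%Z with (Z.of_nat l) by lia.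
      replace (Z.of_nat (2 * l)) with (Z.of_nat l * 2)%Z by lia.
      rewrite Z.div_mul by lia. ring.
    + intros a _. split; intros [q Hq]; exists q; lia.
  - destruct Pk as [l ->].
    (* For [k] odd, [2a - k] is odd and the even [p] cannot divide it. *)
    rewrite (filter_ext_in _ (fun _ => false)).
    + replace (filter (fun _ : nat => false) (seq 0 (S (2 * l + 1)))) with (@nil nat); [reflexivity|].
      generalize (seq 0 (S (2 * l + 1))). induction l0; auto.
    + intros a Ha. apply in_seq in Ha. apply Bool.not_true_is_false. unfold good_a.
      rewrite mod0_iff by lia. intros [q Hq]. nia.
Qed.

Lemma basis_count_odd (p n k : nat) : p = (2 * n + 1)%nat ->
  Z.of_nat (length (basis_idx p k)) = dim_formula p k.
Proof.
  intros ->. rewrite length_basis_idx. unfold dim_formula.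
  pose proof (nat_parity k) as Pk.
  replace (Nat.even (2 * n + 1)) with false.
  2: { symmetry. rewrite Nat.add_1_r, Nat.even_succ, Nat.odd_mul. reflexivity. }
  assert (Ho : Z.odd (Z.of_nat (2 * n + 1)) = true).
  { apply Z.odd_spec. exists (Z.of_nat n). lia. }
  destruct (Nat.even k); destruct Pk as [l ->].
  - rewrite (good_a_residue (2 * n + 1) (2 * l) (Z.of_nat l) (Z.of_nat (2 * n + 1))); [|lia|lia|].
    + rewrite div_neg_succ by lia.
      replace (Z.of_nat (2 * l) - Z.of_nat l)%Z with (Z.of_nat l) by lia.
      replace (Z.of_nat (2 * l)) with (2 * Z.of_nat l)%Z by lia.
      rewrite Z.div_mul_cancel_l by lia. ring.
    + intros a _. replace (2 * a - Z.of_nat (2 * l))%Z with (2 * (a - Z.of_nat l))%Z by lia.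
      split; [apply Zodd_divide_double, Ho|apply Z.divide_mul_r].
  (* Here [c = (k + p)/2], so [2a - k = 2(a - c) + p]. For [k < p] the floor of [(k - p)/(2p)] is -1
     and the count is 0. *)
  - rewrite (good_a_residue (2 * n + 1) (2 * l + 1) (Z.of_nat (l + n + 1)) (Z.of_nat (2 * n + 1))); [|lia|lia|].
    + rewrite div_neg_succ by lia.
      replace (Z.of_nat (2 * l + 1) - Z.of_nat (l + n + 1))%Z with (Z.of_nat l - Z.of_nat n)%Z by lia.
      replace (Z.of_nat (2 * l + 1) - Z.of_nat (2 * n + 1))%Z with (2 * (Z.of_nat l - Z.of_nat n))%Z by lia.
      rewrite Z.div_mul_cancel_l by lia.
      replace (Z.of_nat (l + n + 1)) with ((Z.of_nat l - Z.of_nat n) + 1 * Z.of_nat (2 * n + 1))%Z by lia.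
      rewrite Z.div_add by lia. ring.
    + intros a _.
      replace (2 * a - Z.of_nat (2 * l + 1))%Z
        with (2 * (a - Z.of_nat (l + n + 1)) + Z.of_nat (2 * n + 1))%Z by lia.
      split.
      * intro H. apply (Zodd_divide_double _ _ Ho).
        apply (Z.divide_add_cancel_r _ (Z.of_nat (2 * n + 1))); [apply Z.divide_refl|].
        rewrite Z.add_comm. exact H.
      * intro H. apply Z.divide_add_r; [apply Z.divide_mul_r, H|apply Z.divide_refl].
Qed.

Lemma basis_count (p k : nat) : (1 <= p)%nat ->
  Z.of_nat (length (basis_idx p k)) = dim_formula p k.
Proof.
  intro Hp. pose proof (nat_parity p) as Pp. destruct (Nat.even p) eqn:Ep; destruct Pp as [n Hn].
  - rewrite (basis_count_even p n k Hp Hn). unfold dim_formula. rewrite Ep. subst p.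
    destruct (Nat.even k); auto.
    rewrite Z.div_div by lia. do 4 f_equal. lia.
  - apply (basis_count_odd p n k Hn).
Qed.

Lemma NoDup_list_prod {A B : Type} (l : list A) (l' : list B) :
  NoDup l -> NoDup l' -> NoDup (list_prod l l').
Proof.
  intros Hl Hl'. induction Hl as [|x l Hx Hl IH]; simpl; [constructor|].
  apply NoDup_app; auto.
  - apply NoDup_map_NoDup_ForallPairs; auto. intros a b _ _ E. congruence.
  - intros [a b] Ha Hb. apply in_map_iff in Ha. destruct Ha as [y [E _]]. inversion E; subst.
    apply in_prod_iff in Hb. tauto.
Qed.

Lemma NoDup_basis_idx (p k : nat) : NoDup (basis_idx p k).
Proof. apply NoDup_list_prod; [apply NoDup_filter|]; apply seq_NoDup. Qed.

Lemma in_basis_idx (p k a j : nat) :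
  In (a, j) (basis_idx p k) <-> (a <= k)%nat /\ good_a p k a = true /\ (j <= k)%nat.
Proof.
  unfold basis_idx. rewrite in_prod_iff, filter_In, !in_seq. intuition lia.
Qed.

Open Scope R_scope.

(** * Restrictions of harmonic polynomials are modes *)

(* A class of functions on R^4 minus the origin closed under partial derivatives. *)
Inductive sm : (pt -> R) -> Prop :=
| sm_const c : sm (fun _ => c)
| sm_crd i : sm (crd i)
| sm_inv_norm : sm (fun v => / sqrt (nrm2 v))
| sm_plus f g : sm f -> sm g -> sm (fun v => f v + g v)
| sm_mult f g : sm f -> sm g -> sm (fun v => f v * g v).

Lemma sm_continuous f : sm f -> forall v, v <> p0 -> continuous f v.
Proof.
  induction 1 as [c|i| |f g Hf IHf Hg IHg|f g Hf IHf Hg IHg]; intros v Hv.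
  - apply continuous_const.
  - apply continuous_crd.
  - pose proof (sqrt_lt_R0 _ (nrm2_gt0 v Hv)) as Hs.
    apply (continuous_comp (fun v => sqrt (nrm2 v)) Rinv).
    + apply (continuous_comp nrm2 sqrt); [apply continuous_nrm2|apply continuous_sqrt].
    + apply (@ex_derive_continuous R_AbsRing R_NormedModule). auto_derive. lra.
  - apply continuous_Rplus; auto.
  - apply continuous_Rmult; auto.
Qed.

Lemma sm_derive f : sm f -> forall i, exists f', sm f' /\
  forall v, v <> p0 -> is_derive (line f v i) 0 (f' v).
Proof.
  induction 1 as [c|j| |f g Hf IHf Hg IHg|f g Hf IHf Hg IHg]; intro i.
  - exists (fun _ => 0). split; [constructor|]. intros v _. apply (is_derive_const c).
  - exists (fun _ => crd j (axis i 1)). split; [constructor|]. intros v _.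
    apply (is_derive_ext (fun t => crd j v + t * crd j (axis i 1))).
    + intro t. unfold line. rewrite crd_padd. f_equal. dix i; dix j; simpl; ring.
    + auto_derive; auto. ring.
  - set (q := fun v => / sqrt (nrm2 v)).
    (* The derivative of [1/r] is [-v_i / r^3], again a product of generators; this is why [1/r] is
       the generator. *)
    exists (fun v => (-1) * crd i v * (q v * (q v * q v))). split.
    + repeat apply sm_mult; constructor.
    + intros v Hv. apply nrm2_gt0 in Hv.
      set (c := nrm2 v - crd i v * crd i v).
      apply (is_derive_ext (fun t => / sqrt ((crd i v + t) * (crd i v + t) + c))).
      * intro t. unfold line, q. rewrite line_nrm2. reflexivity.
      * assert (H' : 0 < (crd i v + 0) * (crd i v + 0) + c) by (rewrite Rplus_0_r; unfold c; lra).
        pose proof (sqrt_lt_R0 _ H') as Hs.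
        auto_derive; [repeat split; auto; lra|].
        rewrite !Rplus_0_r in *. unfold q. replace (nrm2 v) with (crd i v * crd i v + c) by (unfold c; ring).
        field. lra.
  - destruct (IHf i) as [f' [Sf Df]]. destruct (IHg i) as [g' [Sg Dg]].
    exists (fun v => f' v + g' v). split; [constructor; auto|]. intros v Hv.
    apply (is_derive_plus (line f v i) (line g v i)); auto.
  - destruct (IHf i) as [f' [Sf Df]]. destruct (IHg i) as [g' [Sg Dg]].
    exists (fun v => f' v * g v + f v * g' v). split; [repeat constructor; auto|]. intros v Hv.
    pose proof (is_derive_Rmult (line f v i) (line g v i) 0 _ _ (Df v Hv) (Dg v Hv)) as M.
    rewrite !line_0 in M. exact M.
Qed.

Lemma slice_of_line (g : fn4R) i x y z w l :
  is_derive (line (un4 g) (x, y, z, w) i) 0 l -> exd i g x y z w /\ pd i g x y z w = l.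
Proof.
  intro H.
  assert (T : forall (f : R -> R) a, (forall t, line (un4 g) (x, y, z, w) i t = f (a + t)) -> is_derive f a l).
  { intros f a E. apply (is_derive_ext (fun s => line (un4 g) (x, y, z, w) i (- a + s))).
    - intro t. rewrite E. f_equal. ring.
    - apply is_derive_shift. replace (- a + a) with 0 by ring. exact H. }
  assert (G : forall f a, is_derive f a l -> ex_derive f a /\ Derive f a = l).
  { intros f a D. split; [exists l; exact D|apply is_derive_unique, D]. }
  dix i; apply G; apply T; intro t; unfold line; simpl; rewrite !Rplus_0_r; reflexivity.
Qed.

Lemma pd_off0 (G : fn4R) (f f' : pt -> R) i :
  (forall v, v <> p0 -> un4 G v = f v) ->
  (forall v, v <> p0 -> is_derive (line f v i) 0 (f' v)) ->
  forall x y z w, (x, y, z, w) <> p0 -> exd i G x y z w /\ pd i G x y z w = f' (x, y, z, w).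
Proof.
  intros E D x y z w Hv. apply slice_of_line.
  apply (is_derive_ext_loc (line f (x, y, z, w) i)); [|apply D, Hv].
  generalize (locally_line _ i _ (locally_neq0 _ Hv)). apply filter_imp.
  intros t Ht. symmetry. apply E, Ht.
Qed.

Lemma cont4_off0 (G : fn4R) (f : pt -> R) :
  (forall v, v <> p0 -> un4 G v = f v) -> (forall v, v <> p0 -> continuous f v) ->
  forall x y z w, (x, y, z, w) <> p0 -> cont4 G x y z w.
Proof.
  intros E Hc x y z w Hv. change (continuous (un4 G) (x, y, z, w)).
  apply (continuous_ext_loc _ f); [|apply Hc, Hv].
  generalize (locally_neq0 _ Hv). apply filter_imp. intros v H. symmetry. apply E, H.
Qed.

(** Agreement off the origin is agreement on an open set, so it passes to both orders of partial
    derivatives. *)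
Lemma C2_of_sm (G : fn4R) (f : pt -> R) :
  (forall v, v <> p0 -> un4 G v = f v) -> sm f -> C2_off0 G.
Proof.
  intros E Sf x y z w Hv. apply nonzero4_iff in Hv. split; [|split].
  - apply (cont4_off0 G f); auto. apply sm_continuous, Sf.
  - intros i _. destruct (sm_derive f Sf i) as [f' [Sf' D]].
    pose proof (pd_off0 G f f' i E D) as P. split; [apply P, Hv|].
    apply (cont4_off0 (pd i G) f'); auto.
    + intros [[[a b] c] d] H. apply P, H.
    + apply sm_continuous, Sf'.
  - intros i j _ _. destruct (sm_derive f Sf i) as [f' [Sf' D]].
    destruct (sm_derive f' Sf' j) as [f'' [Sf'' D']].
    assert (E' : forall v, v <> p0 -> un4 (pd i G) v = f' v).
    { intros [[[a b] c] d] H. apply (pd_off0 G f f' i E D), H. }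
    pose proof (pd_off0 (pd i G) f' f'' j E' D') as P. split; [apply P, Hv|].
    apply (cont4_off0 (pd j (pd i G)) f''); auto.
    + intros [[[a b] c] d] H. apply P, H.
    + apply sm_continuous, Sf''.
Qed.

Definition smc (F : pt -> C) : Prop := sm (fun v => Re (F v)) /\ sm (fun v => Im (F v)).

Lemma smc_const c : smc (fun _ => c).
Proof. split; constructor. Qed.

Lemma smc_plus F G : smc F -> smc G -> smc (fun v => F v + G v)%C.
Proof. intros [F1 F2] [G1 G2]. split; simpl; constructor; assumption. Qed.

Lemma sm_ext f g : (forall v, f v = g v) -> sm f -> sm g.
Proof. intro E. replace g with f; auto. apply functional_extensionality, E. Qed.

Lemma smc_mult F G : smc F -> smc G -> smc (fun v => F v * G v)%C.
Proof.
  intros [F1 F2] [G1 G2]. split.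
  - apply (sm_ext (fun v => Re (F v) * Re (G v) + (-1) * (Im (F v) * Im (G v)))).
    + intro v. simpl. unfold Re, Im. ring.
    + repeat constructor; assumption.
  - apply (sm_ext (fun v => Re (F v) * Im (G v) + Im (F v) * Re (G v))).
    + intro v. reflexivity.
    + repeat constructor; assumption.
Qed.

Lemma smc_psum N (c : pt -> nat -> C) (z : pt -> C) :
  (forall n, smc (fun v => c v n)) -> smc z -> smc (fun v => psum N (c v) (z v)).
Proof.
  intros Hc Hz. assert (Hp : forall n, smc (fun v => cpow (z v) n)).
  { induction n as [|n IH]; simpl; [apply smc_const|apply smc_mult; auto]. }
  induction N as [|N IH]; simpl; [apply smc_const|]. apply smc_plus; auto. apply smc_mult; auto.
Qed.

Lemma smc_eval N h (a b c d : pt -> C) : smc a -> smc b -> smc c -> smc d ->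
  smc (fun v => eval N h (a v) (b v) (c v) (d v)).
Proof.
  intros Ha Hb Hc Hd. unfold eval, eval3, eval2.
  apply smc_psum; auto. intro A. apply smc_psum; auto. intro B.
  apply smc_psum; auto. intro C. apply smc_psum; auto. intro D. apply smc_const.
Qed.

Lemma C2_S3_evp N h : C2_S3 (evp N h).
Proof.
  set (q := fun v => / sqrt (nrm2 v)).
  assert (Hq : forall i, sm (fun v => crd i v * q v)) by (intro; repeat constructor).
  assert (Hq' : forall i, sm (fun v => - (crd i v * q v))).
  { intro. apply (sm_ext (fun v => (-1) * (crd i v * q v))); [intro; ring|]. repeat constructor. }
  assert (S : smc (fun v => eval N h (crd 0 v * q v, crd 1 v * q v) (crd 2 v * q v, crd 3 v * q v)
     (crd 0 v * q v, - (crd 1 v * q v)) (crd 2 v * q v, - (crd 3 v * q v)))).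
  { apply smc_eval; split; simpl; auto. }
  destruct S as [S1 S2]. split.
  - eapply C2_of_sm; [|apply S1]. intros [[[x y] z] w] _. reflexivity.
  - eapply C2_of_sm; [|apply S2]. intros [[[x y] z] w] _. reflexivity.
Qed.

Lemma has_lap_unique f v a b : has_lap f v a -> has_lap f v b -> a = b.
Proof.
  intros [d [Hd ->]] [e [He ->]].
  assert (E : forall i, d i = e i).
  { intro i. destruct (Hd i) as [_ D]. destruct (He i) as [_ D'].
    apply is_derive_unique in D, D'. congruence. }
  rewrite !E. reflexivity.
Qed.

(** A quarter of the Laplacian, which is 4 times the sum of the mixed derivatives in alpha,
    conj(alpha) and in beta, conj(beta). *)
Definition lapc (h : coef) : coef := cadd (dA (dC h)) (dB (dD h)).

Lemma sum_pdc2 h A B C D :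
  (pdc 0 (pdc 0 h) A B C D + pdc 1 (pdc 1 h) A B C D + pdc 2 (pdc 2 h) A B C D
   + pdc 3 (pdc 3 h) A B C D = cscal 4 (lapc h) A B C D)%C.
Proof.
  unfold pdc, lapc, cadd, cscal, dA, dB, dC, dD.
  pose proof Ci_sqr as E. ring [E].
Qed.

Lemma has_lap_evp N h v : degree_lt N h ->
  has_lap (un4 (ReF (evp N h))) v (un4 (ReF (evp N (cscal 4 (lapc h)))) v) /\
  has_lap (un4 (ImF (evp N h))) v (un4 (ImF (evp N (cscal 4 (lapc h)))) v).
Proof.
  assert (L : forall g i u, degree_lt N g ->
    is_derive (line (un4 (ReF (evp N g))) u i) 0 (un4 (ReF (evp N (pdc i g))) u) /\
    is_derive (line (un4 (ImF (evp N g))) u i) 0 (un4 (ImF (evp N (pdc i g))) u)).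
  { intros g i [[[x y] z] w] Hg. destruct (pd_evp N g i Hg) as [E1 E2].
    rewrite <- E1, <- E2. destruct (isd_evp N g x y z w Hg) as [[? ?] [[? ?] [[? ?] [? ?]]]].
    split; apply exd_line; dix i; eexists; eassumption. }
  intro Hb.
  assert (S : forall x y z w, evp N (cscal 4 (lapc h)) x y z w =
    (evp N (pdc 0 (pdc 0 h)) x y z w + evp N (pdc 1 (pdc 1 h)) x y z w
     + evp N (pdc 2 (pdc 2 h)) x y z w + evp N (pdc 3 (pdc 3 h)) x y z w)%C).
  { intros. rewrite <- !evp_plus. apply eval_ext. intros. symmetry. apply sum_pdc2. }
  split.
  - exists (fun i => un4 (ReF (evp N (pdc i (pdc i h)))) v). split.
    + intro i. apply has_d2_intro with (line (un4 (ReF (evp N (pdc i h)))) v i).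
      * apply filter_forall. intro t. apply is_derive_line_shift, L, Hb.
      * apply L, degree_lt_pdc, Hb.
    + destruct v as [[[x y] z] w]. simpl. unfold ReF. rewrite S. reflexivity.
  - exists (fun i => un4 (ImF (evp N (pdc i (pdc i h)))) v). split.
    + intro i. apply has_d2_intro with (line (un4 (ImF (evp N (pdc i h)))) v i).
      * apply filter_forall. intro t. apply is_derive_line_shift, L, Hb.
      * apply L, degree_lt_pdc, Hb.
    + destruct v as [[[x y] z] w]. simpl. unfold ImF. rewrite S. reflexivity.
Qed.

Lemma ext0_homog0 F : homog0 (ReF (ext0 F)) /\ homog0 (ImF (ext0 F)).
Proof.
  assert (E : forall s x y z w, 0 < s -> ext0 F (s * x) (s * y) (s * z) (s * w) = ext0 F x y z w).
  { intros s x y z w Hs. unfold ext0.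
    replace (s * x * (s * x) + s * y * (s * y) + s * z * (s * z) + s * w * (s * w))
      with (s * s * (x * x + y * y + z * z + w * w)) by ring.
    set (n := x * x + y * y + z * z + w * w).
    rewrite sqrt_mult by (unfold n; nra). rewrite sqrt_square by lra.
    (* Division by a zero radius occurs only at the origin, which scaling fixes. *)
    destruct (Req_dec (sqrt n) 0) as [H0|H0].
    - assert (n = 0) by (apply sqrt_eq_0; auto; unfold n; nra).
      assert (x = 0 /\ y = 0 /\ z = 0 /\ w = 0) as [-> [-> [-> ->]]].
      { unfold n in H. repeat split; nra. }
      rewrite !Rmult_0_r. unfold Rdiv. rewrite !Rmult_0_l. reflexivity.
    - f_equal; field; split; auto; lra. }
  split; intros s [[[x y] z] w] Hs; simpl; unfold ReF, ImF; rewrite E by auto; reflexivity.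
Qed.

Lemma ext0_sphere F x y z w : onS3 x y z w -> ext0 F x y z w = F x y z w.
Proof.
  intro H. unfold ext0, onS3 in *. rewrite H, sqrt_1. unfold Rdiv. rewrite Rinv_1, !Rmult_1_r. reflexivity.
Qed.

Lemma rpow_ext0_evp N k h F v :
  (forall x y z w, onS3 x y z w -> F x y z w = evp N h x y z w) -> homog k h -> v <> p0 ->
  rpow k v * un4 (ReF (ext0 F)) v = un4 (ReF (evp N h)) v /\
  rpow k v * un4 (ImF (ext0 F)) v = un4 (ImF (evp N h)) v.
Proof.
  intros HF Hh Hv. pose proof (sqrt_lt_R0 _ (nrm2_gt0 v Hv)) as Hs.
  pose proof (sqrt_sqrt _ (nrm2_pos v)) as Hss.
  destruct v as [[[x y] z] w]. unfold rpow.
  change (nrm2 (x, y, z, w)) with (x * x + y * y + z * z + w * w) in *.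
  simpl. unfold ReF, ImF, ext0. cbv zeta. set (r := sqrt (x * x + y * y + z * z + w * w)) in *.
  rewrite HF.
  - replace (evp N h x y z w) with (Cmult (RtoC (r ^ k)) (evp N h (x / r) (y / r) (z / r) (w / r))).
    + simpl. unfold Re, Im. split; ring.
    + rewrite <- (evp_homog N k) by auto. f_equal; field; lra.
  - unfold onS3.
    replace (x / r * (x / r) + y / r * (y / r) + z / r * (z / r) + w / r * (w / r))
      with ((x * x + y * y + z * z + w * w) / (r * r)) by (field; lra).
    rewrite Hss. field. rewrite <- Hss. nra.
Qed.

(** The Laplacian of [r^k] times the degree-0 extension is computed twice: it is zero since the
    product is the harmonic polynomial, and the product rule at radius 1 then leaves the eigenvalue
    equation. *)
Lemma eigen_evp N k h x y z w : homog k h -> (k < N)%nat -> (forall A B C D, lapc h A B C D = RtoC 0) ->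
  onS3 x y z w ->
  lapS3 (evp N h) x y z w = Cmult (RtoC (- INR (k * (k + 2)))) (evp N h x y z w).
Proof.
  intros Hh Hk Hl Hs. set (v := (x, y, z, w)).
  assert (Hn : nrm2 v = 1) by exact Hs.
  assert (Hv : v <> p0) by apply p0_nrm2, Hn.
  destruct (ext0_homog0 (evp N h)) as [O1 O2]. destruct (C2_S3_evp N h) as [C1 C2].
  assert (Hd : degree_lt N h) by (apply (homog_degree_lt k); auto).
  assert (Z : forall x y z w, evp N (cscal 4 (lapc h)) x y z w = RtoC 0).
  { intros. rewrite (evp_ext N _ (cscal 0 h)).
    - rewrite evp_scal. ring.
    - intros. unfold cscal. rewrite Hl. ring. }
  assert (key : forall (pr : C -> R) (u : fn4R), C2_off0 u -> homog0 u ->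
     (forall w, w <> p0 -> rpow k w * un4 u w = un4 (fun a b c d => pr (evp N h a b c d)) w) ->
     has_lap (un4 (fun a b c d => pr (evp N h a b c d))) v 0 ->
     un4 (lap4 u) v = - INR (k * (k + 2)) * un4 u v).
  { intros pr u Hu Ho E L. pose proof (has_lap_rpow_mult k u v Hu Ho Hv) as L1.
    eapply has_lap_ext_loc in L1; [|generalize (locally_neq0 v Hv); apply filter_imp; exact E].
    pose proof (has_lap_unique _ _ _ _ L L1) as U.
    unfold rpow in U. rewrite Hn, sqrt_1, pow1 in U.
    rewrite mult_INR, plus_INR. simpl INR. unfold Rdiv in U. rewrite Rinv_1 in U. lra. }
  destruct (has_lap_evp N h v Hd) as [L1 L2].
  assert (R : forall w, w <> p0 -> _) by exact (fun w => rpow_ext0_evp N k h (evp N h) w (fun _ _ _ _ _ => eq_refl) Hh).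
  pose proof (key Re (ReF (ext0 (evp N h))) C1 O1 (fun w Hw => proj1 (R w Hw))) as K1.
  pose proof (key Im (ImF (ext0 (evp N h))) C2 O2 (fun w Hw => proj2 (R w Hw))) as K2.
  unfold v in *. simpl in K1, K2, L1, L2. unfold ReF, ImF in K1, K2, L1, L2.
  rewrite Z in L1, L2. specialize (K1 L1). specialize (K2 L2).
  rewrite !ext0_sphere in K1, K2 by auto.
  unfold lapS3, lap4C. unfold ReF, ImF. rewrite K1, K2.
  apply injective_projections; simpl; unfold Re, Im; ring.
Qed.

Lemma lapc_zero N k h F : homog k h -> (k < N)%nat -> C2_S3 F ->
  (forall x y z w, onS3 x y z w -> F x y z w = evp N h x y z w) ->
  (forall x y z w, onS3 x y z w -> lapS3 F x y z w = Cmult (RtoC (- INR (k * (k + 2)))) (F x y z w)) ->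
  forall A B C D, lapc h A B C D = RtoC 0.
Proof.
  intros Hh Hk [C1 C2] HF Heig.
  assert (Hd : degree_lt N h) by (apply (homog_degree_lt k); auto).
  destruct (ext0_homog0 F) as [O1 O2].
  assert (E : forall v, nrm2 v = 1 -> un4 (lap4 (ReF (ext0 F))) v = - INR (k * (k + 2)) * un4 (ReF (ext0 F)) v
     /\ un4 (lap4 (ImF (ext0 F))) v = - INR (k * (k + 2)) * un4 (ImF (ext0 F)) v).
  { intros [[[x y] z] w] Hn. specialize (Heig x y z w Hn). unfold lapS3, lap4C in Heig.
    rewrite <- (ext0_sphere F x y z w Hn) in Heig.
    simpl. unfold ReF at 2, ImF at 2. split.
    - apply (f_equal Re) in Heig. unfold Re, Im in *. simpl in Heig. rewrite Heig. ring.
    - apply (f_equal Im) in Heig. unfold Re, Im in *. simpl in Heig. rewrite Heig. ring. }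
  assert (Z : forall x y z w, onS3 x y z w -> evp N (lapc h) x y z w = RtoC 0).
  { intros x y z w Hs. set (v := (x, y, z, w)). assert (Hn : nrm2 v = 1) by exact Hs.
    assert (Hv : v <> p0) by apply p0_nrm2, Hn.
    pose proof (solid_harmonic k _ C1 O1 (fun v Hv => proj1 (E v Hv)) v Hv) as S1.
    pose proof (solid_harmonic k _ C2 O2 (fun v Hv => proj2 (E v Hv)) v Hv) as S2.
    eapply has_lap_ext_loc in S1; [|generalize (locally_neq0 v Hv); apply filter_imp;
      intros u Hu; exact (proj1 (rpow_ext0_evp N k h F u HF Hh Hu))].
    eapply has_lap_ext_loc in S2; [|generalize (locally_neq0 v Hv); apply filter_imp;
      intros u Hu; exact (proj2 (rpow_ext0_evp N k h F u HF Hh Hu))].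
    destruct (has_lap_evp N h v Hd) as [L1 L2].
    pose proof (has_lap_unique _ _ _ _ S1 L1) as U1. pose proof (has_lap_unique _ _ _ _ S2 L2) as U2.
    unfold v in U1, U2. simpl in U1, U2. unfold ReF, ImF in U1, U2. rewrite evp_scal in U1, U2.
    unfold Re, Im in U1, U2. simpl in U1, U2.
    apply injective_projections; simpl; lra. }
  (* For [k < 2] the subtraction truncates to 0, harmlessly: [lapc h] then has no nonzero
     coefficient at all. *)
  apply (evp_sphere_zero N (k - 2)); auto; [|lia].
  intros A B C D Hn. unfold lapc, cadd, dA, dB, dC, dD. rewrite !Hh by lia. ring.
Qed.

(** The two coefficients involved are neighbours on one line. The factors from differentiation are
    absorbed by the factorials and leave equal magnitudes, with opposite signs from [(-1)^D]. *)
Lemma lapc_sibc a b j A B C D : lapc (sibc a b j) A B C D = RtoC 0.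
Proof.
  unfold lapc, cadd, dA, dB, dC, dD.
  destruct (classic (S A + D = a /\ B + S C = b /\ S C + D = j)%nat) as [[H1 [H2 H3]]|H].
  - rewrite !sibc_on by lia. unfold succC, sib_val. rewrite <- !RtoC_mult, <- RtoC_plus. f_equal.
    replace (C + S D)%nat with (S C + D)%nat by lia.
    rewrite !(factR_S A), !(factR_S B), !(factR_S C), !(factR_S D). simpl pow.
    pose proof (factR_neq A). pose proof (factR_neq B). pose proof (factR_neq C). pose proof (factR_neq D).
    pose proof (not_0_INR (S A) (Nat.neq_succ_0 A)). pose proof (not_0_INR (S D) (Nat.neq_succ_0 D)).
    pose proof (not_0_INR (S B) (Nat.neq_succ_0 B)). pose proof (not_0_INR (S C) (Nat.neq_succ_0 C)).
    generalize dependent (INR (S A)). generalize dependent (INR (S B)).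
    generalize dependent (INR (S C)). generalize dependent (INR (S D)).
    intros. field. tauto.
  - rewrite !sibc_off by lia. ring.
Qed.

(** * The action of the cyclic group *)

Lemma zeta_pow_add p m n : zeta_pow p (m + n) = Cmult (zeta_pow p m) (zeta_pow p n).
Proof.
  unfold zeta_pow. rewrite plus_IZR.
  replace (2 * PI * (IZR m + IZR n) / INR p) with (2 * PI * IZR m / INR p + 2 * PI * IZR n / INR p)
    by (unfold Rdiv; ring).
  rewrite cos_plus, sin_plus. apply injective_projections; simpl; ring.
Qed.

Lemma zeta_pow_0 p : zeta_pow p 0 = RtoC 1.
Proof.
  unfold zeta_pow. replace (2 * PI * 0 / INR p) with 0 by (unfold Rdiv; ring).
  rewrite cos_0, sin_0. reflexivity.
Qed.

Lemma cpow_zeta p m n : cpow (zeta_pow p m) n = zeta_pow p (m * Z.of_nat n).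
Proof.
  induction n as [|n IH].
  - rewrite Z.mul_0_r, zeta_pow_0. reflexivity.
  - simpl cpow. rewrite IH, <- zeta_pow_add. f_equal. lia.
Qed.

Lemma conj_zeta p m : Cconj (zeta_pow p m) = zeta_pow p (- m).
Proof.
  unfold zeta_pow, Cconj. simpl. rewrite opp_IZR.
  replace (2 * PI * - IZR m / INR p) with (- (2 * PI * IZR m / INR p)) by (unfold Rdiv; ring).
  rewrite cos_neg, sin_neg. reflexivity.
Qed.

Lemma zeta_pow_1_iff p m : (1 <= p)%nat -> zeta_pow p m = RtoC 1 <-> (Z.of_nat p | m)%Z.
Proof.
  intro Hp. assert (Hp0 : INR p <> 0) by (apply not_0_INR; lia).
  pose proof PI_RGT_0 as Hpi. split.
  - intro H. apply (f_equal fst) in H. simpl in H.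
    (* The real part suffices: [cos (2 t) = 1 - 2 sin^2 t] equal to 1 forces [sin t = 0]. *)
    replace (2 * PI * IZR m / INR p) with (2 * (PI * IZR m / INR p)) in H by (field; auto).
    rewrite cos_2a_sin in H.
    assert (Hs : sin (PI * IZR m / INR p) = 0) by nra.
    apply sin_eq_0_0 in Hs. destruct Hs as [q Hq]. exists q.
    apply eq_IZR. rewrite mult_IZR, <- INR_IZR_INZ.
    assert (PI * IZR m = PI * (IZR q * INR p)).
    { replace (PI * IZR m) with (PI * IZR m / INR p * INR p) by (field; auto). rewrite Hq. ring. }
    apply Rmult_eq_reg_l in H0; lra.
  - intros [q ->]. rewrite Z.mul_comm.
    assert (E : zeta_pow p (Z.of_nat p) = RtoC 1).
    { unfold zeta_pow. rewrite <- INR_IZR_INZ. replace (2 * PI * INR p / INR p) with (2 * PI) by (field; auto).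
      rewrite cos_2PI, sin_2PI. reflexivity. }
    assert (N : forall n, zeta_pow p (Z.of_nat p * Z.of_nat n) = RtoC 1).
    { intro n. rewrite <- cpow_zeta, E. induction n; simpl; auto. rewrite IHn. ring. }
    destruct (Z_le_gt_dec 0 q).
    + rewrite <- (Z2Nat.id q) by lia. apply N.
    + replace (Z.of_nat p * q)%Z with (- (Z.of_nat p * Z.of_nat (Z.to_nat (- q))))%Z by lia.
      rewrite <- conj_zeta, N. apply injective_projections; simpl; ring.
Qed.

(** Each monomial is an eigenvector. Acting through the inverse rotates alpha by the power [-m] and
    beta by [m], and conjugation reverses both; in degree [k] with [A + D = a] the weight is
    [k - 2a]. *)
Lemma R_Zp_evp N h p m x y z w :
  R_Zp p m (evp N h) x y z w = evp N (fun A B C D =>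
    Cmult (zeta_pow p (m * (Z.of_nat B + Z.of_nat C - Z.of_nat A - Z.of_nat D))) (h A B C D)) x y z w.
Proof.
  unfold R_Zp, diag_act, evp. cbv zeta. rewrite <- !surjective_pairing, !Cmult_conj, !conj_zeta, Z.opp_involutive.
  rewrite eval_rescale. apply eval_ext. intros A B C D. unfold rescale.
  rewrite !cpow_zeta, <- !zeta_pow_add. f_equal. f_equal. lia.
Qed.

Lemma good_a_divide p k a : (1 <= p)%nat -> (a <= k)%nat ->
  good_a p k a = true <-> (Z.of_nat p | Z.of_nat k - 2 * Z.of_nat a)%Z.
Proof.
  intros Hp Ha. unfold good_a. rewrite mod0_iff by lia.
  replace (Z.of_nat a - Z.of_nat (k - a))%Z with (- (Z.of_nat k - 2 * Z.of_nat a))%Z by lia.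
  apply Z.divide_opp_r.
Qed.

Lemma basis_fn_evp k a j : (a <= k)%nat -> basis_fn k (a, j) = evp (S k) (sibc a (k - a) j).
Proof.
  intro Ha. unfold basis_fn. simpl fst; simpl snd. rewrite sibling_evp.
  replace (a + (k - a))%nat with k by lia. reflexivity.
Qed.

Lemma homog_sibc a b j : homog (a + b) (sibc a b j).
Proof. intros A B C D Hn. apply sibc_off. lia. Qed.

Lemma mode_basis_fn p k a j : (1 <= p)%nat -> (a <= k)%nat -> good_a p k a = true ->
  mode p k (basis_fn k (a, j)).
Proof.
  intros Hp Ha Hg. rewrite basis_fn_evp by auto.
  assert (Hh : homog k (sibc a (k - a) j)).
  { replace k with (a + (k - a))%nat at 1 by lia. apply homog_sibc. }
  split; [|split].
  - apply C2_S3_evp.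
  - intros m x y z w _. rewrite R_Zp_evp. apply eval_ext. intros A B C D.
    destruct (classic (A + D = a /\ B + C = k - a /\ C + D = j)%nat) as [[H1 [H2 H3]]|H].
    + rewrite (proj2 (zeta_pow_1_iff p _ Hp)); [ring|]. apply Z.divide_mul_r.
      apply (good_a_divide p k a Hp Ha) in Hg.
      replace (Z.of_nat B + Z.of_nat C - Z.of_nat A - Z.of_nat D)%Z
        with (Z.of_nat k - 2 * Z.of_nat a)%Z by lia. exact Hg.
    + rewrite sibc_off by auto. ring.
  - intros x y z w Hs. apply eigen_evp; auto. intros. apply lapc_sibc.
Qed.

(** * Linear independence and spanning *)

Fixpoint csum (k : nat) (L : list (nat * nat)) (c : nat * nat -> C) : coef :=
  match L with
  | nil => fun _ _ _ _ => RtoC 0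
  | aj :: L' => cadd (cscal (c aj) (sibc (fst aj) (k - fst aj) (snd aj))) (csum k L' c)
  end.

Lemma evp_zero N x y z w : evp N (fun _ _ _ _ => RtoC 0) x y z w = RtoC 0.
Proof.
  rewrite (evp_ext N _ (cscal (RtoC 0) (fun _ _ _ _ => RtoC 0))).
  - rewrite evp_scal. ring.
  - intros. unfold cscal. ring.
Qed.

Lemma lincomb_evp k L c x y z w : (forall aj, In aj L -> (fst aj <= k)%nat) ->
  lincomb k L c x y z w = evp (S k) (csum k L c) x y z w.
Proof.
  intro HL. unfold lincomb. induction L as [|[a j] L IH]; simpl.
  - rewrite evp_zero. reflexivity.
  - rewrite evp_plus, evp_scal, IH by (intros; apply HL; right; auto).
    rewrite basis_fn_evp by (apply (HL (a, j)); left; auto). reflexivity.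
Qed.

Lemma csum_notin k L c A B C D : ~ In (A + D, C + D)%nat L -> csum k L c A B C D = RtoC 0.
Proof.
  induction L as [|[a j] L IH]; intro H; simpl; auto.
  unfold cadd, cscal. rewrite IH by (intro; apply H; right; auto). simpl.
  rewrite sibc_off; [ring|]. intros [H1 [H2 H3]]. apply H. left. congruence.
Qed.

(** Both indices can be read off the exponents, [a] as [A + D] and [j] as [C + D], so distinct
    siblings have disjoint supports and at most one summand contributes. *)
Lemma csum_in k L c A B C D : NoDup L -> In (A + D, C + D)%nat L ->
  csum k L c A B C D = Cmult (c (A + D, C + D)%nat) (sibc (A + D) (k - (A + D)) (C + D) A B C D).
Proof.
  induction 1 as [|[a j] L Hn HL IH]; intros []; simpl; unfold cadd, cscal.
  - inversion H; subst. rewrite csum_notin by auto. simpl. ring.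
  - rewrite IH by auto. simpl. rewrite (sibc_off a); [ring|].
    intros [H1 [H2 H3]]. apply Hn. subst. auto.
Qed.

Lemma homog_csum k L c : (forall aj, In aj L -> (fst aj <= k)%nat) -> homog k (csum k L c).
Proof.
  intros HL A B C D Hn. induction L as [|[a j] L IH]; simpl; auto.
  unfold cadd, cscal. rewrite IH by (intros; apply HL; right; auto). simpl.
  assert (a <= k)%nat by (apply (HL (a, j)); left; auto).
  rewrite sibc_off by lia. ring.
Qed.

Lemma basis_idx_fst p k aj : In aj (basis_idx p k) -> (fst aj <= k)%nat.
Proof. destruct aj as [a j]. intro H. apply in_basis_idx in H. simpl. tauto. Qed.

(* The entry of the support of [sibc a (k - a) j] with [A = 0] or [C = 0]. *)
Definition pivot (k : nat) (h : coef) (a j : nat) : C :=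
  h (a - Nat.min a j)%nat (k - a - (j - Nat.min a j))%nat (j - Nat.min a j)%nat (Nat.min a j).

Lemma basis_independent p k (c : nat * nat -> C) :
  (forall x y z w, onS3 x y z w -> lincomb k (basis_idx p k) c x y z w = RtoC 0) ->
  forall aj, In aj (basis_idx p k) -> c aj = RtoC 0.
Proof.
  intros Hz [a j] Hin. pose proof (proj1 (in_basis_idx p k a j) Hin) as [Ha [_ Hj]].
  assert (Z : forall A B C D, csum k (basis_idx p k) c A B C D = RtoC 0).
  { apply (evp_sphere_zero (S k) k); [apply homog_csum, basis_idx_fst|lia|].
    intros. rewrite <- lincomb_evp by apply basis_idx_fst. auto. }
  (* This exponent lies in the support because [j <= k]: then [C] is either 0 or [j - a], hence at
     most [k - a], and [B + C = k - a] holds without truncation. *)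
  set (D := Nat.min a j). set (A := (a - D)%nat). set (C := (j - D)%nat). set (B := (k - a - C)%nat).
  assert (EA : (A + D = a)%nat) by lia. assert (EC : (C + D = j)%nat) by lia.
  specialize (Z A B C D). rewrite csum_in in Z; [|apply NoDup_basis_idx|rewrite EA, EC; auto].
  rewrite EA, EC, sibc_on in Z by lia.
  pose proof (sib_val_neq a (k - a) A B C D) as Hn.
  assert (Hn' : RtoC (sib_val a (k - a) A B C D) <> RtoC 0).
  { intro E. apply (f_equal fst) in E. simpl in E. auto. }
  replace (c (a, j)) with (Cmult (Cmult (c (a, j)) (RtoC (sib_val a (k - a) A B C D)))
    (/ RtoC (sib_val a (k - a) A B C D))%C) by (field; auto).
  rewrite Z. ring.
Qed.

(** Induction on [A] along a line, one step trading (A, C) for (B, D). The line ends where [A] or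
    [C] is 0, at the pivot; there the ratio is the given one, and the recurrence shared by [h] and
    [sibc] keeps it constant. *)
Lemma harmonic_coef_ratio k h : (forall A B C D, lapc h A B C D = RtoC 0) ->
  forall A B C D, (A + B + C + D = k)%nat ->
  h A B C D = Cmult (pivot k h (A + D) (C + D) / pivot k (sibc (A + D) (B + C) (C + D)) (A + D) (C + D))%C
    (sibc (A + D) (B + C) (C + D) A B C D).
Proof.
  intros Hl.
  assert (Base : forall A B C D, (A + B + C + D = k)%nat -> (A = 0 \/ C = 0)%nat ->
    h A B C D = Cmult (pivot k h (A + D) (C + D) / pivot k (sibc (A + D) (B + C) (C + D)) (A + D) (C + D))%C
    (sibc (A + D) (B + C) (C + D) A B C D)).
  { intros A B C D Hk H0. unfold pivot.
    replace (Nat.min (A + D) (C + D)) with D by lia.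
    replace (A + D - D)%nat with A by lia. replace (C + D - D)%nat with C by lia.
    replace (k - (A + D) - C)%nat with B by lia. rewrite sibc_on by lia. field.
    intro E. apply (f_equal fst) in E. simpl in E. revert E. apply sib_val_neq. }
  induction A as [|A IH]; intros B C D Hk; [apply Base; auto|].
  destruct C as [|C]; [apply Base; auto|].
  pose proof (IH (S B) C (S D) ltac:(lia)) as E.
  replace (A + S D)%nat with (S A + D)%nat in E by lia.
  replace (S B + C)%nat with (B + S C)%nat in E by lia.
  replace (C + S D)%nat with (S C + D)%nat in E by lia.
  set (q := (_ / _)%C) in *. set (s := sibc (S A + D) (B + S C) (S C + D)) in *.
  pose proof (Hl A B C D) as L1. pose proof (lapc_sibc (S A + D) (B + S C) (S C + D) A B C D) as L2.
  fold s in L2. unfold lapc, cadd, dA, dB, dC, dD in L1, L2. rewrite E in L1.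
  pose proof (succC_neq A) as NA. pose proof (succC_neq C) as NC.
  (* The recurrence of [h] minus [q] times that of the sibling; the terms at the lower neighbour
     cancel by the induction hypothesis. *)
  assert (X : (succC A * (succC C * (h (S A) B (S C) D - q * s (S A) B (S C) D)) = 0)%C).
  { transitivity ((succC A * (succC C * h (S A) B (S C) D) + succC B * (succC D * (q * s A (S B) C (S D))))
      - q * (succC A * (succC C * s (S A) B (S C) D) + succC B * (succC D * s A (S B) C (S D))))%C; [ring|].
    rewrite L1, L2. ring. }
  assert (Y : (h (S A) B (S C) D - q * s (S A) B (S C) D = 0)%C).
  { transitivity (/ succC A * (/ succC C * (succC A * (succC C * (h (S A) B (S C) D - q * s (S A) B (S C) D)))))%C.
    - field. auto.
    - rewrite X. ring. }
  transitivity ((h (S A) B (S C) D - q * s (S A) B (S C) D) + q * s (S A) B (S C) D)%C; [ring|].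
  rewrite Y. ring.
Qed.

Lemma mode_polynomial p k F : mode p k F -> exists h, homog k h /\
  forall x y z w, onS3 x y z w -> F x y z w = evp (S k) h x y z w.
Proof.
  intros [[C1 C2] [_ Heig]]. destruct (ext0_homog0 F) as [O1 O2].
  assert (E : forall v, nrm2 v = 1 -> un4 (lap4 (ReF (ext0 F))) v = - INR (k * (k + 2)) * un4 (ReF (ext0 F)) v
     /\ un4 (lap4 (ImF (ext0 F))) v = - INR (k * (k + 2)) * un4 (ImF (ext0 F)) v).
  { intros [[[x y] z] w] Hn. specialize (Heig x y z w Hn). unfold lapS3, lap4C in Heig.
    rewrite <- (ext0_sphere F x y z w Hn) in Heig.
    simpl. unfold ReF at 2, ImF at 2. split.
    - apply (f_equal Re) in Heig. unfold Re, Im in *. simpl in Heig. rewrite Heig. ring.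
    - apply (f_equal Im) in Heig. unfold Re, Im in *. simpl in Heig. rewrite Heig. ring. }
  destruct (eigenfunction_polynomial k _ C1 O1 (fun v Hv => proj1 (E v Hv))) as [h1 [H1 E1]].
  destruct (eigenfunction_polynomial k _ C2 O2 (fun v Hv => proj2 (E v Hv))) as [h2 [H2 E2]].
  exists (cadd h1 (cscal Ci h2)). split.
  - intros A B C D Hn. unfold cadd, cscal. rewrite H1, H2 by auto. ring.
  - intros x y z w Hs. rewrite evp_plus, evp_scal, <- E1, <- E2 by auto.
    unfold ReF, ImF. rewrite ext0_sphere by auto. unfold Ci, Re, Im.
    apply injective_projections; simpl; ring.
Qed.

Lemma onS3_rotation s t x y z w : onS3 x y z w ->
  let a := Cmult (cos s, sin s) (x, y) in let b := Cmult (cos t, sin t) (z, w) in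
  onS3 (fst a) (snd a) (fst b) (snd b).
Proof.
  intro H. unfold onS3 in *. simpl.
  pose proof (sin2_cos2 s) as Es. pose proof (sin2_cos2 t) as Et. unfold Rsqr in Es, Et.
  transitivity ((sin s * sin s + cos s * cos s) * (x * x + y * y)
    + (sin t * sin t + cos t * cos t) * (z * z + w * w)); [ring|].
  rewrite Es, Et. lra.
Qed.

Lemma modes_span p k F : (1 <= p)%nat -> mode p k F ->
  exists c : nat * nat -> C, forall x y z w, onS3 x y z w ->
    F x y z w = lincomb k (basis_idx p k) c x y z w.
Proof.
  intros Hp HF. destruct (mode_polynomial p k F HF) as [h [Hh E]].
  destruct HF as [HC [Hinv Heig]].
  pose proof (lapc_zero (S k) k h F Hh (Nat.lt_succ_diag_r k) HC E Heig) as Hl.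
  assert (Hgood : forall A B C D, (A + B + C + D = k)%nat -> good_a p k (A + D) <> true -> h A B C D = RtoC 0).
  { intros A B C D Hk Hg.
    (* Invariance under the generator alone says that this homogeneous polynomial vanishes on the
       sphere, so a nonzero coefficient of [h] forces its root of unity to be 1. *)
    set (g := fun A B C D : nat => 
      (zeta_pow p (1 * (Z.of_nat B + Z.of_nat C - Z.of_nat A - Z.of_nat D)) * h A B C D - h A B C D)%C).
    assert (Z : g A B C D = RtoC 0).
    { apply (evp_sphere_zero (S k) k); [|lia|].
      - intros A' B' C' D' Hn. unfold g. rewrite Hh by auto. ring.
      - intros x y z w Hs. specialize (Hinv 1%Z x y z w Hs).
        rewrite (evp_ext _ g (cadd (fun A B C D =>
          Cmult (zeta_pow p (1 * (Z.of_nat B + Z.of_nat C - Z.of_nat A - Z.of_nat D))) (h A B C D))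
          (cscal (-(1))%C h))).
        + rewrite evp_plus, evp_scal, <- R_Zp_evp, <- (E x y z w Hs), <- Hinv.
          replace (R_Zp p 1 F x y z w) with (R_Zp p 1 (evp (S k) h) x y z w); [ring|].
          unfold R_Zp, diag_act. cbv zeta. symmetry. apply E.
          apply onS3_rotation; auto.
        + intros. unfold g, cadd, cscal. ring. }
    destruct (classic (h A B C D = RtoC 0)) as [|Hn]; auto. exfalso. apply Hg.
    apply good_a_divide; [auto|lia|].
    replace (Z.of_nat k - 2 * Z.of_nat (A + D))%Z
      with (1 * (Z.of_nat B + Z.of_nat C - Z.of_nat A - Z.of_nat D))%Z by lia.
    apply zeta_pow_1_iff; auto. unfold g in Z. set (q := zeta_pow _ _) in *.
    transitivity ((q * h A B C D - h A B C D) * / h A B C D + 1)%C; [field; auto|]. rewrite Z. ring. }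
  (* The coordinate of [F] is the ratio of the two pivot entries. A degree [k] monomial whose line
     is missing from the index list can only fail [good_a], because [A + D] and [C + D] are at most
     [k]. *)
  exists (fun aj => pivot k h (fst aj) (snd aj) / pivot k (sibc (fst aj) (k - fst aj) (snd aj)) (fst aj) (snd aj))%C.
  intros x y z w Hs. rewrite E, lincomb_evp by (auto; apply basis_idx_fst).
  apply eval_ext. intros A B C D.
  destruct (Nat.eq_dec (A + B + C + D) k) as [Hk|Hk].
  - destruct (classic (In (A + D, C + D)%nat (basis_idx p k))) as [Hin|Hin].
    + rewrite csum_in by (auto; apply NoDup_basis_idx). simpl.
      replace (k - (A + D))%nat with (B + C)%nat by lia. apply harmonic_coef_ratio; auto.
    + rewrite csum_notin by auto. apply Hgood; auto. intro Hg. apply Hin.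
      apply in_basis_idx. repeat split; auto; lia.
  - rewrite Hh by auto. symmetry. apply homog_csum; auto. apply basis_idx_fst.
Qed.

Theorem theorem14p1 (p k : nat) (hp : (1 <= p)%nat) :
  (* every proposed basis element (restricted to S^3) is a mode *)
  (forall aj, In aj (basis_idx p k) -> mode p k (basis_fn k aj)) /\
  (* they are linearly independent over C as functions on S^3 *)
  (forall c : nat * nat -> C,
     (forall x y z w, onS3 x y z w -> lincomb k (basis_idx p k) c x y z w = RtoC 0) ->
     forall aj, In aj (basis_idx p k) -> c aj = RtoC 0) /\
  (* they span the space of modes *)
  (forall F : fn4C, mode p k F ->
     exists c : nat * nat -> C,
       forall x y z w, onS3 x y z w -> F x y z w = lincomb k (basis_idx p k) c x y z w) /\
  (* the basis is duplicate-free, so the dimension is its length *)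
  NoDup (basis_idx p k) /\
  Z.of_nat (length (basis_idx p k)) = dim_formula p k /\
  (* the special case p = 2n *)
  (forall n : nat, p = (2 * n)%nat ->
     Z.of_nat (length (basis_idx p k)) =
       (if Nat.even k
        then (2 * ((Z.of_nat k / 2) / Z.of_nat n) + 1) * (Z.of_nat k + 1)
        else 0)%Z).
Proof.
  split; [|split; [|split; [|split; [|split]]]].
  - intros [a j] Hin. apply in_basis_idx in Hin. apply mode_basis_fn; tauto.
  - intros c Hz. apply (basis_independent p), Hz.
  - intros F HF. apply modes_span; auto.
  - apply NoDup_basis_idx.
  - apply basis_count, hp.
  - intros n Hn. apply basis_count_even; auto.
Qed.
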